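(* Let $(X_t,Y_t)$, $t\in\mathbb{Z}$, follow the simple linear regression model with Gaussian long memory design and heteroscedastic long memory moving average errors described in the context, with $1/2<H<1$, $1/2<h<1$. Let $(\hat\beta_0,\hat\beta_1)$ be the least squares estimator of $(\beta_0,\beta_1)$ based on $(X_t,Y_t)$, $1\le t\le n$. Then, as $n\to\infty$, $$n^{1-H}\big(\hat\beta_0-\beta_0,\ \hat\beta_1-\beta_1\big)\to_d(\Gamma_0,\Gamma_1)\,Z_1,$$ where $Z_1$ is a normal random variable with mean $0$ and variance $\psi_1^2=G_u\theta(H)/\{H(2H-1)\}$, and $$\Gamma_1=\frac{E[X_0\sigma(X_0)]-\mu\sigma_0}{\gamma^2},\qquad \Gamma_0=\sigma_0-\frac{\mu\,(E[X_0\sigma(X_0)]-\mu\sigma_0)}{\gamma^2},\qquad \sigma_0=E\sigma(X_0).$$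
   Context: Model: $(X_t,Y_t)$, $t\in\mathbb{Z}$, is a strictly stationary process, both components with finite positive variance, with $Y_t=\beta_0+\beta_1X_t+\sigma(X_t)u_t$ for some $(\beta_0,\beta_1)\in\mathbb{R}^2$, where $\sigma:\mathbb{R}\to[0,\infty)$ is measurable and $E\sigma^2(X_0)<\infty$. Errors: $u_t=\sum_{j=0}^\infty b_j\varepsilon_{t-j}$, where $(\varepsilon_t)_{t\in\mathbb{Z}}$ are i.i.d. with mean $0$ and variance $1$, independent of the process $(X_t)$; $b_j\sim Cj^{-(3/2-H)}$ as $j\to\infty$, $1/2<H<1$, with the constant $C$ such that $\sum_{j\ge0}b_j^2=1$; $b_j\to0$ and for some $a<\infty$, $b_{j+1}\le b_j(1+j^{-1}a)$ for all sufficiently large $j$. $G_u>0$ is the constant with $f_u(\lambda)\sim G_u\lambda^{1-2H}$ as $\lambda\to0_+$ and $\gamma_u(k)=E(u_0u_k)\sim G_u\theta(H)k^{-2(1-H)}$ as $k\to\infty$, where $f_u$ is the spectral density of $(u_t)$ and $\theta(z)=2\Gamma(2-2z)\cos(\pi(1-z))$. Design: $(X_t)$ is a stationary Gaussian process with mean $\mu$, variance $\gamma^2$, and autocovariance $\gamma_X(k)\sim G_X\theta(h)k^{-2(1-h)}$ as $k\to\infty$, $1/2<h<1$, $G_X>0$ a constant. The least squares estimator is given by $\hat\beta_1=\sum_{t=1}^n(X_t-\bar X)Y_t/\sum_{t=1}^n(X_t-\bar X)^2$, $\hat\beta_0=\bar Y-\hat\beta_1\bar X$, with $\bar X,\bar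 Y$ the sample means. *)

(* Defs.v *)
From HB Require Import structures.
From mathcomp Require Export all_boot all_order all_algebra.
From mathcomp Require Export all_classical all_reals all_analysis.

Set Implicit Arguments.
Unset Strict Implicit.
Unset Printing Implicit Defensive.

Export Order.TTheory GRing.Theory Num.Theory.
Export numFieldNormedType.Exports.

Local Open Scope classical_set_scope.
Local Open Scope ring_scope.

(* Euler's Gamma function; only meaningful for z > 0, where the integral
   converges. *)
Definition Gamma (R : realType) (z : R) : R :=
  \int[lebesgue_measure]_(x in `]0, +oo[) (x `^ (z - 1) * expR (- x)).

Definition theta (R : realType) (z : R) : R :=
  2 * Gamma (2 - 2 * z) * cos (pi * (1 - z)).

Definition same_law d d' (T : measurableType d) (S : measurableType d')
    (R : realType) (P : probability T R) (V W : T -> S) : Prop :=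
  forall A : set S, measurable A -> P (V @^-1` A) = P (W @^-1` A).

(* Normal law with mean m and variance v >= 0.  The library's [normal_prob m s]
   is parametrized by the standard deviation and is not a point mass at s = 0,
   so the degenerate case is treated separately. *)
Definition normal_rv d (T : measurableType d) (R : realType)
    (P : probability T R) (Z : T -> R) (m v : R) : Prop :=
  0 <= v /\
  forall A : set R, measurable A ->
    P (Z @^-1` A) = if v == 0 then \d_m A else normal_prob m (Num.sqrt v) A.

Definition gaussian_process d (T : measurableType d) (R : realType)
    (P : probability T R) (X : int -> {RV P >-> R}) : Prop :=
  forall (n : nat) (t : 'I_n -> int) (c : 'I_n -> R),
    exists m v : R, normal_rv P (fun w => \sum_(i < n) c i * X (t i) w) m v.

Definition strictly_stationary d (T : measurableType d) (R : realType)
    (P : probability T R) (X Y : int -> {RV P >-> R}) : Prop :=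
  forall (n : nat) (t : 'I_n -> int) (k : int),
    same_law P
      (fun w => [tuple (X (t i) w, Y (t i) w) | i < n])
      (fun w => [tuple (X (t i + k) w, Y (t i + k) w) | i < n]).

Definition mutually_independent d (T : measurableType d) (R : realType)
    (P : probability T R) (eps : int -> {RV P >-> R}) : Prop :=
  forall (s : seq int) (A : int -> set R),
    uniq s -> (forall t, measurable (A t)) ->
    P (\bigcap_(t in [set` s]) (eps t @^-1` A t)) =
    (\prod_(t <- s) P (eps t @^-1` A t))%E.

Definition iid d (T : measurableType d) (R : realType)
    (P : probability T R) (eps : int -> {RV P >-> R}) : Prop :=
  mutually_independent eps /\ forall s t : int, same_law P (eps s) (eps t).

Definition sigma_process d (T : measurableType d) (R : realType)
    (P : probability T R) (X : int -> {RV P >-> R}) : set (set T) :=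
  <<s \bigcup_t preimage_set_system setT (X t) measurable >>.

Definition independent_processes d (T : measurableType d) (R : realType)
    (P : probability T R) (X Y : int -> {RV P >-> R}) : Prop :=
  forall A B : set T, sigma_process X A -> sigma_process Y B ->
    P (A `&` B) = (P A * P B)%E.

(* u_t = \sum_(j >= 0) b_j eps_(t-j), the series converging in mean square. *)
Definition moving_average d (T : measurableType d) (R : realType)
    (P : probability T R) (b : nat -> R) (eps u : int -> {RV P >-> R}) : Prop :=
  forall t : int,
    (fun N => 'E_P[fun w =>
       ((u t w - \sum_(0 <= j < N) b j * eps (t - j%:Z) w) ^+ 2)%R])%E
    @ \oo --> 0%E.

(* gamma(k) = \int_(-pi)^pi e^(i k x) f(x) dx, split into real and imaginary
   parts. *)
Definition spectral_density (R : realType) (gamma : int -> R) (f : R -> R)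
    : Prop :=
  [/\ {in `[- pi, pi], forall x, 0 <= f x},
      lebesgue_measure.-integrable `[- pi, pi] (EFin \o f) &
      forall k : int,
        \int[lebesgue_measure]_(x in `[- pi, pi]) (cos (k%:~R * x) * f x)
          = gamma k /\
        \int[lebesgue_measure]_(x in `[- pi, pi]) (sin (k%:~R * x) * f x) = 0].

(* Expectation of a product; for a centred process this is the
   autocovariance. *)
Definition second_moment d (T : measurableType d) (R : realType)
    (P : probability T R) (u : int -> {RV P >-> R}) (k : int) : R :=
  fine ('E_P[fun w => (u 0 w * u k w)%R])%E.

Definition autocov d (T : measurableType d) (R : realType)
    (P : probability T R) (X : int -> {RV P >-> R}) (k : int) : R :=
  fine (covariance P (X 0) (X k)).

Definition sample_mean (R : realType) (T : Type) (X : int -> T -> R) (n : nat)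
    (w : T) : R :=
  n%:R^-1 * \sum_(1 <= t < n.+1) X t%:Z w.

Definition ls_slope (R : realType) (T : Type) (X Y : int -> T -> R) (n : nat)
    (w : T) : R :=
  (\sum_(1 <= t < n.+1) (X t%:Z w - sample_mean X n w) * Y t%:Z w) /
  (\sum_(1 <= t < n.+1) (X t%:Z w - sample_mean X n w) ^+ 2).

Definition ls_intercept (R : realType) (T : Type) (X Y : int -> T -> R)
    (n : nat) (w : T) : R :=
  sample_mean Y n w - ls_slope X Y n w * sample_mean X n w.

Definition cvg_in_law d (T : measurableType d) d' (T' : measurableType d')
    (R : realType) (P : probability T R) (P' : probability T' R)
    (V : nat -> T -> R * R) (W : T' -> R * R) : Prop :=
  forall g : R * R -> R, continuous g ->
    (exists M : R, forall x, `|g x| <= M) ->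
    ('E_P[g \o V n] @[n --> \oo] --> 'E_P'[g \o W])%E.

(* Main.v *)
(** With [W = n^(-H) \sum u_t], [A = n^(-H) \sum sigma(X_t) u_t] and
    [B = n^(-H) \sum (X_t - mu) sigma(X_t) u_t], the scaled least squares errors are
    explicit functions of A, B, the sample mean and the sample variance of the design.

    The errors being independent of the design, [n^(-H) \sum (g(X_t) - E g) u_t] has
    second moment [n^(-2H) \sum_(s, t) Cov(g(X_s), g(X_t)) gamma_u(s - t)].  Gebelein's
    inequality [|Cov(g(X_s), g(X_t))| <= |rho(s - t)| E g^2] makes it vanish, because
    [rho * gamma_u] decays faster than [gamma_u], whose double sum is of order
    [n^(2H)].  Hence A and B are [E sigma(X_0) * W] and [E((X_0 - mu) sigma(X_0)) * W]
    up to terms vanishing in probability, and the errors are asymptotically a fixed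
    vector times W.

    Finally [W] is asymptotically normal: as a linear combination of the i.i.d.
    innovations it has coefficients of order at most [n^(1/2 - H)], so the Lindeberg
    argument applies to [E cos(a W + th)], and bounded continuous functions are
    approximated by trigonometric polynomials. *)
From HB Require Import structures.
Require Import Defs.
From mathcomp Require Import all_boot all_order all_algebra.
From mathcomp Require Import all_classical all_reals all_analysis.
From mathcomp Require Import measurable_realfun.
From mathcomp Require Import zify ring lra.
Import Order.TTheory GRing.Theory Num.Theory.
Import numFieldNormedType.Exports.

Set Implicit Arguments.
Unset Strict Implicit.
Unset Printing Implicit Defensive.

Local Open Scope classical_set_scope.
Local Open Scope ring_scope.

(** * Integrable and square integrable functions *)

(** Two integrability obstacles shape the proof. Only E sigma^2 is finite, so (x - mu) * sigma x
    need not be square integrable and Gebelein's inequality does not apply to it directly; it is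
    truncated at a level of order sqrt (ln n), which costs a factor ln n. The cost is affordable
    because [rho * gamma_u] beats [gamma_u] by a power of n. Moreover [u t] is known only as a
    mean-square limit: second moments are computed for the finite averages [ma_sum], where
    independence of the two processes gives a factorisation, and pass to the limit as bounds on
    first absolute moments.

    Complex numbers are avoided: the characteristic function is replaced by E cos (a W + th) with
    arbitrary phase th, a sine being a cosine of shifted phase. These waves also carry Gebelein's
    inequality. Under a bivariate normal law their product moments have a closed form, whose power
    series in the correlation is Mehler's formula; the inequality is proved for trigonometric
    polynomials and extended by density, without completeness of the Hermite polynomials. *)

Notation Ex P f := (\int[P]_w f w).

Definition L1 {d} {T : measurableType d} {R : realType} (P : probability T R)
  (f : T -> R) : Prop := P.-integrable setT (EFin \o f).

(** The square of a nonmeasurable function may be integrable, hence the first clause. *)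
Definition L2 {d} {T : measurableType d} {R : realType} (P : probability T R)
  (f : T -> R) : Prop :=
  measurable_fun setT f /\ L1 P (fun w => f w ^+ 2).

Lemma sqr_abs (R : realDomainType) (x : R) : `|x| ^+ 2 = x ^+ 2.
Proof. by rewrite real_normK ?num_real. Qed.

Section expectation.
Context d (T : measurableType d) (R : realType) (P : probability T R).
Implicit Types f g : T -> R.

Lemma L1_meas f : L1 P f -> measurable_fun setT f.
Proof. by move=> /integrableP[/measurable_EFinP]. Qed.

Lemma L1D f g : L1 P f -> L1 P g -> L1 P (fun w => f w + g w).
Proof. by move=> hf hg; apply: (@integrableD _ _ _ P setT _ (EFin \o f) (EFin \o g)). Qed.

Lemma L1Z c f : L1 P f -> L1 P (fun w => c * f w).
Proof. by move=> hf; apply: (@integrableZl _ _ _ P setT _ c (EFin \o f)). Qed.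

Lemma L1N f : L1 P f -> L1 P (fun w => - f w).
Proof. by move=> /(L1Z (-1)); congr (L1 P _); apply/funext => w; rewrite mulN1r. Qed.

Lemma L1B f g : L1 P f -> L1 P g -> L1 P (fun w => f w - g w).
Proof. by move=> hf /L1N hg; exact: L1D. Qed.

Lemma L1_norm f : L1 P f -> L1 P (fun w => `|f w|).
Proof. exact: integrable_norm. Qed.

Lemma L1_le f g : measurable_fun setT f -> L1 P g ->
  (forall w, `|f w| <= g w) -> L1 P f.
Proof.
move=> mf hg fg; apply: (le_integrable _ _ _ hg) => //.
  exact/measurable_EFinP.
by move=> w _ /=; rewrite lee_fin (le_trans (fg w))// ler_norm.
Qed.

Lemma L1_cst c : L1 P (fun=> c).
Proof. exact: finite_measure_integrable_cst. Qed.

Lemma L1_bounded f M : measurable_fun setT f -> (forall w, `|f w| <= M) ->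
  L1 P f.
Proof. by move=> mf fM; exact: (L1_le mf (L1_cst M)). Qed.

Lemma L1_sum (I : Type) (s : seq I) (Q : pred I) (f : I -> T -> R) :
  (forall i, L1 P (f i)) -> L1 P (fun w => \sum_(i <- s | Q i) f i w).
Proof.
move=> h; elim: s => [|i s ih].
  have -> : (fun w => \sum_(i <- [::] | Q i) f i w) = fun=> 0.
    by apply/funext => w; rewrite big_nil.
  exact: L1_cst.
have -> : (fun w => \sum_(j <- i :: s | Q j) f j w) =
    fun w => (if Q i then f i w else 0) + \sum_(j <- s | Q j) f j w.
  by apply/funext => w; rewrite big_cons; case: ifP; rewrite ?add0r.
by apply: L1D => //; case: (Q i) => //; exact: L1_cst.
Qed.

Lemma L1_indic A : measurable A -> L1 P \1_A.
Proof. move=> mA; exact: integrable_indic. Qed.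

Lemma L1M_bounded f g M : L1 P f -> measurable_fun setT g ->
  (forall w, `|g w| <= M) -> L1 P (fun w => f w * g w).
Proof.
move=> hf mg gM; apply: (@L1_le _ (fun w => M * `|f w|)).
- by apply: measurable_funM => //; exact: L1_meas.
- exact/L1Z/L1_norm.
- by move=> w; rewrite normrM mulrC ler_wpM2r.
Qed.

Lemma ExE f : L1 P f -> ('E_P[f] = (Ex P f)%:E)%E.
Proof. by move=> hf; rewrite unlock /Rintegral fineK// integrable_fin_num. Qed.

Lemma fine_expectation f : fine ('E_P[f])%E = Ex P f.
Proof. by rewrite unlock. Qed.

Lemma ExD f g : L1 P f -> L1 P g ->
  Ex P (fun w => f w + g w) = Ex P f + Ex P g.
Proof. by move=> *; exact: RintegralD. Qed.

Lemma ExB f g : L1 P f -> L1 P g ->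
  Ex P (fun w => f w - g w) = Ex P f - Ex P g.
Proof. by move=> *; exact: RintegralB. Qed.

Lemma ExZ c f : L1 P f -> Ex P (fun w => c * f w) = c * Ex P f.
Proof. by move=> *; exact: RintegralZl. Qed.

Lemma Ex_cst c : Ex P (fun=> c) = c.
Proof. by rewrite Rintegral_cst//= probability_setT mulr1. Qed.

Lemma Ex_sum (I : Type) (s : seq I) (Q : pred I) (f : I -> T -> R) :
  (forall i, L1 P (f i)) ->
  Ex P (fun w => \sum_(i <- s | Q i) f i w) = \sum_(i <- s | Q i) Ex P (f i).
Proof.
move=> h; elim: s => [|i s ih].
  by under eq_Rintegral do rewrite big_nil; rewrite Ex_cst big_nil.
under eq_Rintegral do rewrite big_cons; rewrite big_cons; case: ifP => // _.
by rewrite ExD ?ih//; exact: L1_sum.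
Qed.

Lemma Ex_ge0 f : (forall w, 0 <= f w) -> 0 <= Ex P f.
Proof. by move=> h; apply: Rintegral_ge0 => w _. Qed.

Lemma Ex_le f g : L1 P f -> L1 P g -> (forall w, f w <= g w) ->
  Ex P f <= Ex P g.
Proof. by move=> hf hg fg; apply: le_Rintegral. Qed.

Lemma Ex_norm f : L1 P f -> `|Ex P f| <= Ex P (fun w => `|f w|).
Proof. by move=> hf; apply: le_normr_Rintegral. Qed.

Lemma Ex_norm_le f g : L1 P f -> L1 P g -> (forall w, `|f w| <= g w) ->
  `|Ex P f| <= Ex P g.
Proof.
move=> hf hg fg; rewrite (le_trans (Ex_norm hf))//.
by apply: Ex_le => //; exact: L1_norm.
Qed.

Lemma Ex_bounded f M : measurable_fun setT f -> (forall w, `|f w| <= M) ->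
  `|Ex P f| <= M.
Proof.
move=> mf fM; rewrite -[leRHS]Ex_cst; apply: Ex_norm_le => //.
  exact: (L1_bounded mf fM).
exact: L1_cst.
Qed.

Lemma Ex_ae f g : measurable_fun setT f -> measurable_fun setT g ->
  {ae P, forall w, f w = g w} -> Ex P f = Ex P g.
Proof.
move=> mf mg [N [mN N0 h]]; congr fine; apply: ae_eq_integral => //.
- exact/measurable_EFinP.
- exact/measurable_EFinP.
- by exists N; split => // w hw; apply: h => /= ?; apply: hw => _; congr EFin.
Qed.

Lemma Ex_indic A : measurable A -> Ex P \1_A = fine (P A).
Proof. by move=> mA; rewrite /Rintegral integral_indic// setIT. Qed.

Lemma Ex_dominated (f_ : nat -> T -> R) f g :
  (forall n, measurable_fun setT (f_ n)) -> L1 P g ->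
  (forall n w, `|f_ n w| <= g w) -> (forall w, f_ n w @[n --> \oo] --> f w) ->
  Ex P (f_ n) @[n --> \oo] --> Ex P f.
Proof.
move=> mf hg fg fc.
have mF n : measurable_fun setT (fun w => (f_ n w)%:E) by exact/measurable_EFinP.
have fF w : setT w -> (fun n => (f_ n w)%:E) @ \oo --> (f w)%:E.
  by move=> _; apply: cvg_EFin; [exact: nearW|exact: fc].
have mfl : measurable_fun setT (EFin \o f).
  exact: (emeasurable_fun_cvg (fun n w => (f_ n w)%:E)).
have [||intf _] := @dominated_convergence _ _ _ P setT measurableT
  (fun n w => (f_ n w)%:E) (EFin \o f) (EFin \o g) mF mfl _ hg.
  by exists set0; split => // w /=; apply: contra_notP => _ _; exact: fF.
  by apply: aeW => w n _ /=; rewrite lee_fin; exact: fg.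
by move=> /= h; apply: fine_cvg; rewrite fineK//; exact: integrable_fin_num.
Qed.

Lemma L1M f g : L2 P f -> L2 P g -> L1 P (fun w => f w * g w).
Proof.
move=> [mf hf] [mg hg]; apply: (@L1_le _ (fun w => f w ^+ 2 + g w ^+ 2)).
- exact: measurable_funM.
- exact: L1D.
- move=> w; rewrite ler_norml; apply/andP; split; nra.
Qed.

Lemma L2_bounded f M : measurable_fun setT f -> (forall w, `|f w| <= M) ->
  L2 P f.
Proof.
move=> mf fM; split => //; apply: (@L1_bounded _ (M ^+ 2)).
  exact: measurable_funX.
by move=> w; rewrite normrX lerXn2r ?nnegrE// (le_trans _ (fM w)).
Qed.

Lemma L2_cst c : L2 P (fun=> c).
Proof. by apply: (@L2_bounded _ `|c|) => //. Qed.

Lemma L2_L1 f : L2 P f -> L1 P f.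
Proof.
move=> /L1M /(_ (L2_cst 1)); congr (L1 P _).
by apply/funext => w; rewrite mulr1.
Qed.

Lemma L2_le f g : measurable_fun setT f -> L2 P g ->
  (forall w, `|f w| <= `|g w|) -> L2 P f.
Proof.
move=> mf [mg hg] fg; split => //; apply: (L1_le _ hg).
  exact: measurable_funX.
by move=> w; rewrite normrX -[leRHS]sqr_abs lerXn2r ?nnegrE.
Qed.

Lemma L2Z c f : L2 P f -> L2 P (fun w => c * f w).
Proof.
move=> [mf hf]; split; first exact: measurable_funM.
by under eq_fun do rewrite exprMn; exact: L1Z.
Qed.

Lemma L2D f g : L2 P f -> L2 P g -> L2 P (fun w => f w + g w).
Proof.
move=> hf hg; split; first by apply: measurable_funD; [case: hf|case: hg].
have -> : (fun w => (f w + g w) ^+ 2) =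
    (fun w => f w ^+ 2 + (2 * (f w * g w) + g w ^+ 2)).
  by apply/funext => w; ring.
by apply: L1D; [case: hf|apply: L1D; [exact/L1Z/L1M|case: hg]].
Qed.

Lemma L2N f : L2 P f -> L2 P (fun w => - f w).
Proof. by move=> /(L2Z (-1)); congr (L2 P _); apply/funext => w; rewrite mulN1r. Qed.

Lemma L2B f g : L2 P f -> L2 P g -> L2 P (fun w => f w - g w).
Proof. by move=> hf /L2N hg; exact: L2D. Qed.

Lemma L2_norm f : L2 P f -> L2 P (fun w => `|f w|).
Proof.
move=> hf; apply: (L2_le _ hf) => [|w]; last by rewrite normr_id.
by apply: measurableT_comp => //; case: hf.
Qed.

Lemma L2_sum (I : Type) (s : seq I) (Q : pred I) (f : I -> T -> R) :
  (forall i, L2 P (f i)) -> L2 P (fun w => \sum_(i <- s | Q i) f i w).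
Proof.
move=> h; elim: s => [|i s ih].
  have -> : (fun w => \sum_(i <- [::] | Q i) f i w) = fun=> 0.
    by apply/funext => w; rewrite big_nil.
  exact: L2_cst.
have -> : (fun w => \sum_(j <- i :: s | Q j) f j w) =
    fun w => (if Q i then f i w else 0) + \sum_(j <- s | Q j) f j w.
  by apply/funext => w; rewrite big_cons; case: ifP; rewrite ?add0r.
by apply: L2D => //; case: (Q i) => //; exact: L2_cst.
Qed.

(** E (x f + y g)^2 is a nonnegative quadratic form in (x, y) with coefficients a, 2 b, c; the
    inequality is read off at one well-chosen point. *)
Lemma cauchy_schwarz f g : L2 P f -> L2 P g ->
  (Ex P (fun w => f w * g w)) ^+ 2 <=
  Ex P (fun w => f w ^+ 2) * Ex P (fun w => g w ^+ 2).
Proof.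
move=> hf hg; set a := Ex P (fun w => f w ^+ 2); set c := Ex P (fun w => g w ^+ 2).
set b := Ex P _.
have a0 : 0 <= a by apply: Ex_ge0 => w; exact: sqr_ge0.
have c0 : 0 <= c by apply: Ex_ge0 => w; exact: sqr_ge0.
have q x y : 0 <= x ^+ 2 * a + (2 * x * y) * b + y ^+ 2 * c.
  have -> : x ^+ 2 * a + (2 * x * y) * b + y ^+ 2 * c =
      Ex P (fun w => (x * f w + y * g w) ^+ 2).
    rewrite -!ExZ; [|by case: hg|exact: L1M|by case: hf].
    have h1 : L1 P (fun w => x ^+ 2 * f w ^+ 2) by apply: L1Z; case: hf.
    have h2 : L1 P (fun w => 2 * x * y * (f w * g w)) by apply/L1Z/L1M.
    have h3 : L1 P (fun w => y ^+ 2 * g w ^+ 2) by apply: L1Z; case: hg.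
    rewrite -ExD// -ExD//; last exact: L1D.
    by apply: eq_Rintegral => w _; ring.
  by apply: Ex_ge0 => w; exact: sqr_ge0.
have [a_0|a_gt] := leP a 0; last first.
  (* At (- b, a) the form equals a (a c - b^2). *)
  by have := q (- b) a; nra.
have {a_0}a_0 : a = 0 by apply/eqP; rewrite eq_le a_0 a0.
rewrite a_0 mul0r; have [->|b_0] := eqVneq b 0; first by rewrite expr0n.
(* With a = 0 and b nonzero the form is unbounded below; at this point it equals -1. *)
have := q (- (c + 1) / (2 * b)) 1; rewrite a_0.
have -> : (- (c + 1) / (2 * b)) ^+ 2 * 0 + 2 * (- (c + 1) / (2 * b)) * 1 * b +
  1 ^+ 2 * c = -1 by field.
lra.
Qed.

Lemma cauchy_schwarz_norm f g : L2 P f -> L2 P g ->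
  Ex P (fun w => `|f w * g w|) <=
  Num.sqrt (Ex P (fun w => f w ^+ 2)) * Num.sqrt (Ex P (fun w => g w ^+ 2)).
Proof.
move=> hf hg; rewrite -sqrtrM; last by apply: Ex_ge0 => w; exact: sqr_ge0.
have := cauchy_schwarz (L2_norm hf) (L2_norm hg).
under [X in _ <= X * _ -> _]eq_Rintegral do rewrite sqr_abs.
under [X in _ <= _ * X -> _]eq_Rintegral do rewrite sqr_abs.
under eq_Rintegral do rewrite -normrM.
move=> /ler_wsqrtr; rewrite sqrtr_sqr ger0_norm//.
by apply: Ex_ge0 => w.
Qed.

Lemma Ex_norm_sqrt f : L2 P f ->
  Ex P (fun w => `|f w|) <= Num.sqrt (Ex P (fun w => f w ^+ 2)).
Proof.
move=> hf; have := cauchy_schwarz_norm hf (L2_cst 1).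
under eq_Rintegral do rewrite mulr1.
by rewrite Ex_cst expr1n sqrtr1 mulr1.
Qed.

Lemma Ex_sqr_le f : L2 P f -> (Ex P f) ^+ 2 <= Ex P (fun w => f w ^+ 2).
Proof.
move=> hf; have := cauchy_schwarz hf (L2_cst 1).
under eq_Rintegral do rewrite mulr1.
by rewrite Ex_cst expr1n mulr1.
Qed.

Lemma markov_ineq f e : 0 < e -> L1 P f -> (forall w, 0 <= f w) ->
  fine (P [set w | e <= f w]) <= e^-1 * Ex P f.
Proof.
move=> e0 hf f0; have mf := L1_meas hf.
have mA : measurable [set w | e <= f w].
  rewrite -[X in measurable X]setTI; apply: measurable_fun_le => //.
rewrite -Ex_indic// -ExZ//; apply: Ex_le.
- exact: L1_indic.
- exact: L1Z.
- move=> w; rewrite indicE; case: (boolP (w \in _)) => [|_] /=.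
    by rewrite inE/= => ew; rewrite mulrC ler_pdivlMr// mul1r.
  by rewrite mulr_ge0// invr_ge0 ltW.
Qed.

End expectation.

(** * Change of variables between equal laws *)

Section same_law.
Context d d' (T : measurableType d) (S : measurableType d') (R : realType)
  (P : probability T R).

(** Both sides are integrals of [f] against the common image measure; the two variables may live on
    different probability spaces. *)
Lemma same_law_ge0_integral d1 (T1 : measurableType d1) (P1 : probability T1 R)
    (V : T -> S) (W : T1 -> S) (f : S -> \bar R) :
  measurable_fun setT V -> measurable_fun setT W ->
  (forall A, measurable A -> P (V @^-1` A) = P1 (W @^-1` A)) ->
  measurable_fun setT f -> (forall x, 0 <= f x)%E ->
  (\int[P]_w f (V w) = \int[P1]_w f (W w))%E.
Proof.
move=> mV mW VW mf f0.
pose V' : {mfun T >-> S} := HB.pack V (isMeasurableFun.Build _ _ _ _ V mV).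
pose W' : {mfun T1 >-> S} := HB.pack W (isMeasurableFun.Build _ _ _ _ W mW).
transitivity (\int[pushforward P V']_y f y)%E.
  by rewrite ge0_integral_pushforward.
transitivity (\int[pushforward P1 W']_y f y)%E; last first.
  by rewrite ge0_integral_pushforward.
apply: eq_measure_integral => A mA _; exact: VW.
Qed.

Lemma same_law_L1 d1 (T1 : measurableType d1) (P1 : probability T1 R)
    (V : T -> S) (W : T1 -> S) (f : S -> R) :
  measurable_fun setT V -> measurable_fun setT W ->
  (forall A, measurable A -> P (V @^-1` A) = P1 (W @^-1` A)) ->
  measurable_fun setT f -> L1 P1 (f \o W) -> L1 P (f \o V).
Proof.
move=> mV mW VW mf /integrableP[_ h]; apply/integrableP; split.
  by apply/measurable_EFinP; exact: measurableT_comp.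
apply: le_lt_trans h; rewrite le_eqVlt; apply/orP; left; apply/eqP.
apply: (same_law_ge0_integral (f := fun x => `|(f x)%:E|%E) mV mW VW) => //.
by apply: measurableT_comp => //; exact/measurable_EFinP.
Qed.

Lemma same_law_Ex d1 (T1 : measurableType d1) (P1 : probability T1 R)
    (V : T -> S) (W : T1 -> S) (f : S -> R) :
  measurable_fun setT V -> measurable_fun setT W ->
  (forall A, measurable A -> P (V @^-1` A) = P1 (W @^-1` A)) ->
  measurable_fun setT f -> Ex P (f \o V) = Ex P1 (f \o W).
Proof.
move=> mV mW VW mf; have mfE : measurable_fun setT (EFin \o f).
  exact/measurable_EFinP.
have p0 x : (0 <= (EFin \o f)^\+ x)%E by exact: funepos_ge0.
have n0 x : (0 <= (EFin \o f)^\- x)%E by exact: funeneg_ge0.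
have hp := same_law_ge0_integral mV mW VW (measurable_funepos mfE) p0.
have hn := same_law_ge0_integral mV mW VW (measurable_funeneg mfE) n0.
rewrite /Rintegral -[fun w => ((f \o V) w)%:E]/((EFin \o f) \o V).
rewrite -[fun w => ((f \o W) w)%:E]/((EFin \o f) \o W).
rewrite [in LHS]integralE [in RHS]integralE (funepos_comp (EFin \o f)) (funeneg_comp (EFin \o f)).
rewrite (funepos_comp (EFin \o f)) (funeneg_comp (EFin \o f)) hp hn.
by congr (fine (_ - _)%E); apply: eq_integral => x _; rewrite ?funeposE ?funenegE.
Qed.

End same_law.

(** * Normal laws *)

Section density.
Context d (T : measurableType d) (R : realType)
  (mu nu : {measure set T -> \bar R}) (p : T -> R).
Hypothesis mp : measurable_fun setT p.
Hypothesis p0 : forall x, 0 <= p x.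
Hypothesis nuE : forall A, measurable A -> nu A = (\int[mu]_(x in A) (p x)%:E)%E.

Import HBNNSimple.

(** Monotone convergence along simple functions reduces the claim to indicators, where it is the
    hypothesis [nuE]. *)
Lemma ge0_integral_density (f : T -> \bar R) :
  measurable_fun setT f -> (forall x, 0 <= f x)%E ->
  (\int[nu]_x f x = \int[mu]_x (f x * (p x)%:E))%E.
Proof.
move=> mf f0; pose h := nnsfun_approx measurableT mf.
have mpE : measurable_fun setT (fun x => (p x)%:E) by exact/measurable_EFinP.
have mh n : measurable_fun setT (EFin \o h n) by exact/measurable_EFinP.
have -> : (\int[nu]_x f x = lim (\int[nu]_x (EFin \o h n) x @[n --> \oo]))%E.
  have fE x : f x = (lim ((EFin \o h n) x @[n --> \oo]))%E.
    by apply/esym/cvg_lim => //; exact: cvg_nnsfun_approx.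
  under eq_integral do rewrite fE.
  apply: monotone_convergence => //.
  - by move=> n x _ //=; rewrite lee_fin.
  - by move=> x _ a b ab; rewrite lee_fin; exact/lefP/nd_nnsfun_approx.
have -> : (\int[mu]_x (f x * (p x)%:E) =
    lim (\int[mu]_x ((EFin \o h n) x * (p x)%:E) @[n --> \oo]))%E.
  have fg x : (f x * (p x)%:E = lim ((EFin \o h n) x * (p x)%:E @[n --> \oo]))%E.
    apply/esym/cvg_lim => //; apply: cvgeZr => //.
    exact: cvg_nnsfun_approx.
  under eq_integral do rewrite fg.
  apply: monotone_convergence => //; [|move=> n x _|move=> x _ a b ab] => /=.
  - by move=> n; exact: (emeasurable_funM (mh n) mpE).
  - by rewrite mule_ge0 ?lee_fin.
  - by rewrite lee_wpmul2r ?lee_fin//; exact/lefP/nd_nnsfun_approx.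
congr (lim (_ @ \oo)); apply/funext => n.
transitivity (\int[nu]_x
   (\sum_(y \in range (h n)) (y * \1_(h n @^-1` [set y]) x)%:E))%E.
  by apply: eq_integral => t tE; rewrite /= fimfunE -fsumEFin.
have indich r : measurable_fun setT (fun x => (r * \1_(h n @^-1` [set r]) x)%:E).
  by apply: (measurable_comp measurableT) => //; exact: measurable_funM.
rewrite ge0_integral_fsum//; last by move=> m y Ey; exact: nnfun_muleindic_ge0.
transitivity (\int[mu]_x (\sum_(y \in range (h n))
    (y * \1_(h n @^-1` [set y]) x)%:E * (p x)%:E))%E; last first.
  under eq_integral => x xE.
    rewrite -ge0_mule_fsuml => [|y]; last exact: nnfun_muleindic_ge0.
    rewrite fsumEFin // -(fimfunE _ x); over.
  by [].
rewrite ge0_integral_fsum//; last 2 first.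
  - by move=> y; apply: emeasurable_funM.
  - by move=> m y Ey; rewrite mule_ge0 ?lee_fin//; exact: nnfun_muleindic_ge0.
apply: eq_fsbigr => r rhn.
have r0 : 0 <= r by move: rhn; rewrite inE => -[x _ <-].
under eq_integral do rewrite EFinM.
rewrite ge0_integralZl_EFin//; last exact/measurable_EFinP.
under [RHS]eq_integral do rewrite EFinM -muleA.
rewrite ge0_integralZl_EFin//; last 2 first.
  - by move=> x _; rewrite mule_ge0 ?lee_fin.
  - by apply: emeasurable_funM => //; exact/measurable_EFinP.
congr (_ * _)%E; rewrite integral_indic// setIT nuE//.
rewrite integral_mkcond; apply: eq_integral => x _.
rewrite patchE indicE; case: ifPn => _; first by rewrite mul1e.
by rewrite mul0e.
Qed.

Lemma integrable_density (f : T -> R) : measurable_fun setT f ->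
  mu.-integrable setT (fun x => (f x * p x)%:E) ->
  nu.-integrable setT (EFin \o f).
Proof.
move=> mf /integrableP[_ h]; apply/integrableP; split.
  exact/measurable_EFinP.
rewrite ge0_integral_density//; last first.
  by apply: measurableT_comp => //; exact/measurable_EFinP.
apply: le_lt_trans h; rewrite le_eqVlt; apply/orP; left; apply/eqP.
by apply: eq_integral => x _ /=; rewrite normrM EFinM (ger0_norm (p0 x)).
Qed.

Lemma Rintegral_density (f : T -> R) : measurable_fun setT f ->
  \int[nu]_x f x = \int[mu]_x (f x * p x).
Proof.
move=> mf; have mfE : measurable_fun setT (EFin \o f).
  exact/measurable_EFinP.
rewrite /Rintegral [in LHS]integralE [in RHS]integralE; congr (fine (_ - _)%E).
- rewrite ge0_integral_density//; last exact: measurable_funepos.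
  apply: eq_integral => x _.
  by rewrite !funeposE /= -EFin_max -EFinM -EFin_max maxr_pMl// mul0r.
- rewrite ge0_integral_density//; last exact: measurable_funeneg.
  apply: eq_integral => x _.
  by rewrite !funenegE /= -!EFin_max -EFinM maxr_pMl// mul0r mulNr.
Qed.

End density.

(** Adding y^2 / (4 s^2) to the exponent of a centred normal density of variance s^2 gives the
    exponent of variance 2 s^2. *)
Lemma gauss_exponent_half (F : numFieldType) (y s : F) : s != 0 ->
  - y ^+ 2 / (s ^+ 2 *+ 2) + y ^+ 2 / (4 * s ^+ 2) =
  - y ^+ 2 / (2 * s ^+ 2 *+ 2).
Proof. by move=> s0; rewrite -(mulr_natr (s ^+ 2)) -(mulr_natr (2 * s ^+ 2)); field. Qed.

(** With z = y^2 / (4 s^2) one has y^4 = 16 s^4 z^2, and z <= 2 exp (z / 2) gives z^2 <= 4 exp z;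
    hence the constant 64. *)
Lemma pow4_le_expR (R : realType) (y s : R) : s != 0 ->
  `|y ^+ 4| <= 64 * (s ^+ 2) ^+ 2 * expR (y ^+ 2 / (4 * s ^+ 2)).
Proof.
move=> s0; have s20 : 0 < s ^+ 2 by rewrite exprn_even_gt0.
pose z := y ^+ 2 / (4 * s ^+ 2); rewrite -/z.
have -> : y ^+ 4 = (4 * s ^+ 2 * z) ^+ 2.
  by rewrite /z mulrC divfK -?exprM// mulf_neq0// gt_eqF.
have z0 : 0 <= z by rewrite divr_ge0 ?sqr_ge0// mulr_ge0// ltW.
rewrite ger0_norm ?sqr_ge0// exprMn.
have -> : expR z = expR (z / 2) ^+ 2 by rewrite expr2 -expRD -splitr.
have -> : 64 * (s ^+ 2) ^+ 2 * expR (z / 2) ^+ 2 =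
  (4 * s ^+ 2) ^+ 2 * (2 * expR (z / 2)) ^+ 2 by ring.
rewrite ler_wpM2l ?sqr_ge0// lerXn2r ?nnegrE//.
by have := expR_ge1Dx (z / 2); lra.
Qed.

Lemma sqr_le_pow4 (R : realDomainType) (y : R) : `|y ^+ 2| <= 1 + y ^+ 4.
Proof.
rewrite ger0_norm ?sqr_ge0//.
have -> : y ^+ 4 = (y ^+ 2) ^+ 2 by rewrite -exprM.
by have := sqr_ge0 (y ^+ 2 - 1); have := sqr_ge0 y; nra.
Qed.

Section normal_law.
Context d (T : measurableType d) (R : realType) (P : probability T R)
  (Z : T -> R) (m s : R).
Hypothesis s0 : s != 0.
Hypothesis mZ : measurable_fun setT Z.
Hypothesis ZN : forall A : set R, measurable A ->
  P (Z @^-1` A) = normal_prob m s A.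
Let N : probability (measurableTypeR R) R := normal_prob m s.

Let mg : measurable_fun (setT : set (measurableTypeR R)) (normal_pdf m s).
Proof. exact: measurable_normal_pdf. Qed.

Let g0 x : 0 <= normal_pdf m s x.
Proof. exact: normal_pdf_ge0. Qed.

Let NE A : measurable A ->
  N A = (\int[lebesgue_measure]_(x in A) (normal_pdf m s x)%:E)%E.
Proof. by []. Qed.

Lemma L1_normal (f : R -> R) : measurable_fun setT f ->
  (@lebesgue_measure R).-integrable setT (fun x => (f x * normal_pdf m s x)%:E) ->
  L1 P (fun w => f (Z w)).
Proof.
move=> mf intf.
apply: (@same_law_L1 _ _ _ (measurableTypeR R) _ P _ _ N Z id f) => //.
exact: (integrable_density mg g0 NE (f := f)).
Qed.

Lemma Ex_normal (f : R -> R) : measurable_fun setT f ->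
  Ex P (fun w => f (Z w)) = \int[lebesgue_measure]_x (f x * normal_pdf m s x).
Proof.
move=> mf.
transitivity (Ex N f).
  exact: (@same_law_Ex _ _ _ (measurableTypeR R) _ P _ _ N Z id f).
exact: (Rintegral_density mg g0 NE (f := f)).
Qed.

(** Times the normal density, this exponential is a multiple of the density of variance 2 s^2. The
    moment bounds for [Z], and later the tail bound for the truncated design, rest on it. *)
Lemma L1_normal_expR : L1 P (fun w => expR ((Z w - m) ^+ 2 / (4 * s ^+ 2))).
Proof.
have s20 : 0 < s ^+ 2 by rewrite exprn_even_gt0.
pose s' := Num.sqrt 2 * s.
have s'0 : s' != 0 by rewrite mulf_neq0// sqrtr_eq0 -ltNge.
have s'2 : s' ^+ 2 = 2 * s ^+ 2 by rewrite exprMn sqr_sqrtr.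
apply: (L1_normal (f := fun x => expR ((x - m) ^+ 2 / (4 * s ^+ 2)))).
  by apply: measurableT_comp => //; apply: measurable_funM => //; apply: measurable_funX; exact: measurable_funB.
have E x : (expR ((x - m) ^+ 2 / (4 * s ^+ 2)) * normal_pdf m s x)%:E =
    ((normal_peak s / normal_peak s')%:E * (normal_pdf m s' x)%:E)%E.
  rewrite -EFinM !normal_pdfE// /normal_fun s'2; congr EFin.
  rewrite [RHS]mulrA divfK ?gt_eqF ?normal_peak_gt0//.
  rewrite mulrCA -expRD; congr (_ * expR _).
  by rewrite addrC; exact: gauss_exponent_half.
under eq_fun do rewrite E.
by apply: integrableZl => //; exact: integrable_normal_pdf.
Qed.

Lemma L1_normal_pow4 : L1 P (fun w => (Z w - m) ^+ 4).
Proof.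
apply: (L1_le _ (L1Z (64 * (s ^+ 2) ^+ 2) L1_normal_expR)).
  by apply: measurable_funX; exact: measurable_funB.
by move=> w; exact: pow4_le_expR.
Qed.

Lemma L2_normal_sub : L2 P (fun w => Z w - m).
Proof.
split; first exact: measurable_funB.
apply: (L1_le _ (L1D (L1_cst P 1) L1_normal_pow4)).
  by apply: measurable_funX; exact: measurable_funB.
by move=> w; exact: sqr_le_pow4.
Qed.

End normal_law.

Section normal_pdf.
Context (R : realType) (m s : R).
Hypothesis s0 : s != 0.

(** Makes the boundary terms of an integration by parts vanish: exp (- z) <= 1 / (1 + z) with z
    quadratic in |x - m| beats the linear factor. *)
Lemma normal_pdf_tail (A e : R) : 0 < e -> exists Y : R, forall x,
  Y <= `|x - m| -> A * (1 + `|x - m|) * normal_pdf m s x <= e.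
Proof.
move=> e0; have s20 : 0 < s ^+ 2 by rewrite exprn_even_gt0.
have pk := normal_peak_gt0 s0.
pose B := `|A| * normal_peak s + 1.
have B0 : 0 < B by rewrite ltr_pwDr// mulr_ge0// ltW.
(* Beyond 1 the factor 1 + y is at most 2 y; beyond the second bound 2 B y <= e y^2 / (2 s^2). *)
exists (Num.max 1 (4 * s ^+ 2 * B / e)) => x; rewrite ge_max => /andP[y1 y2].
rewrite normal_pdfE// /normal_fun; set y := `|x - m| in y1 y2 *.
have -> : - (x - m) ^+ 2 / (s ^+ 2 *+ 2) = - (y ^+ 2 / (2 * s ^+ 2)).
  by rewrite /y sqr_abs mulNr mulr_natl.
rewrite expRN; set z := y ^+ 2 / _; have ez := expR_ge1Dx z.
have z0 : 0 <= z by rewrite divr_ge0 ?sqr_ge0// mulr_ge0// ltW.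
rewrite !mulrA ler_pdivrMr ?expR_gt0//.
apply: (@le_trans _ _ (e * (1 + z))); last by rewrite ler_pM2l.
have zy : z * (2 * s ^+ 2) = y ^+ 2 by rewrite /z divfK// gt_eqF// mulr_gt0.
have h : 4 * s ^+ 2 * B <= e * y by rewrite [leRHS]mulrC -ler_pdivrMr.
have h1 : 2 * B * y <= e * z.
  have s2p : 0 < 2 * s ^+ 2 by rewrite mulr_gt0.
  rewrite -(ler_pM2r s2p) -[e * z * _]mulrA zy.
  have y0 : 0 < y by rewrite (lt_le_trans _ y1).
  by rewrite expr2 mulrA; have := ler_wpM2r (ltW y0) h; lra.
apply: (@le_trans _ _ (2 * B * y)); last by lra.
apply: (@le_trans _ _ (B * (1 + y))); last by nra.
rewrite mulrAC ler_wpM2r//; first by lra.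
apply: (@le_trans _ _ (`|A| * normal_peak s)); last by rewrite /B lerDl.
by rewrite ler_pM2r// ler_norm.
Qed.

Lemma is_derive_normal_pdf (x : R) :
  is_derive x 1 (normal_pdf m s) (- ((x - m) / s ^+ 2) * normal_pdf m s x).
Proof.
rewrite normal_pdfE// /normal_fun.
have s20 : s ^+ 2 != 0 by rewrite expf_neq0.
apply: is_derive_eq; rewrite /GRing.scale /=.
rewrite !mulr0 ?mul0r ?addr0.
rewrite -(mulr_natr (s ^+ 2)); field.
by rewrite s0.
Qed.
End normal_pdf.

Lemma near_ge_natS (R : realType) (x : R) : \forall n \near \oo, x <= n.+1%:R.
Proof.
exists (Num.truncn `|x|) => // n /= xn.
rewrite (le_trans (ler_norm x))// (le_trans (ltW (truncnS_gt _)))//.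
by rewrite ler_nat ltnS.
Qed.


Section normal_stein.
Context d (T : measurableType d) (R : realType) (P : probability T R)
  (Z : T -> R) (m s : R).
Hypothesis s0 : s != 0.
Hypothesis mZ : measurable_fun setT Z.
Hypothesis ZN : forall A : set R, measurable A ->
  P (Z @^-1` A) = normal_prob m s A.

(** Gaussian integration by parts. With g the normal density, [k * g] is the derivative of
    [phi * g], whose boundary values tend to 0 by [normal_pdf_tail]; hence E k(Z) = 0. *)
Lemma normal_stein (phi dphi : R -> R) (A B : R) :
  (forall x : R, is_derive x 1 phi (dphi x)) -> continuous dphi ->
  (forall x, `|phi x| <= A * (1 + `|x - m|)) -> (forall x, `|dphi x| <= B) ->
  Ex P (fun w => (Z w - m) * phi (Z w)) = s ^+ 2 * Ex P (fun w => dphi (Z w)).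
Proof.
move=> dphiE cdphi phiA dphiB.
have s20 : s ^+ 2 != 0 by rewrite expf_neq0.
have cphi : continuous phi.
  by move=> x; apply: differentiable_continuous; apply/derivable1_diffP; case: (dphiE x).
have mphi : measurable_fun setT phi by exact: continuous_measurable_fun.
have mdphi : measurable_fun setT dphi by exact: continuous_measurable_fun.
have L2y : L2 P (fun w => Z w - m) by exact: (L2_normal_sub s0 mZ ZN).
have A0 : 0 <= A.
  have := le_trans (normr_ge0 _) (phiA m); rewrite subrr normr0 addr0.
  by rewrite mulr1.
have L2phi : L2 P (fun w => phi (Z w)).
  apply: (@L2_le _ _ _ _ _ (fun w => A * (1 + `|Z w - m|))).
  - exact: (measurableT_comp mphi mZ).
  - exact/L2Z/(L2D (L2_cst _ 1))/L2_norm.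
  - by move=> w; rewrite [leRHS]ger0_norm// mulr_ge0// addr_ge0.
have L1dphi : L1 P (fun w => dphi (Z w)).
  by apply: (@L1_bounded _ _ _ _ _ B) => //; exact: (measurableT_comp mdphi mZ).
have L1yphi : L1 P (fun w => (Z w - m) * phi (Z w)) by exact: L1M.
pose k x := dphi x - (s ^+ 2)^-1 * ((x - m) * phi x).
have L1k : L1 P (fun w => k (Z w)) by apply: L1B => //; exact: L1Z.
suff k0 : Ex P (fun w => k (Z w)) = 0.
  apply/eqP; rewrite eq_sym -subr_eq0; apply/eqP.
  transitivity (s ^+ 2 * Ex P (fun w => k (Z w))); last by rewrite k0 mulr0.
  by rewrite /k ExB//; [rewrite ExZ// mulrBr mulVKf|exact: L1Z].
(* The bound [n.+1] keeps the interval nondegenerate at n = 0, as the fundamental theorem of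
   calculus requires. *)
pose I (n : nat) := `[(- n.+1%:R : R), n.+1%:R]%classic.
have mI n : measurable (I n) by exact: measurable_itv.
pose g := normal_pdf m s.
have cg : continuous g by exact: continuous_normal_pdf.
have ck : continuous k.
  move=> x; apply: cvgB; first exact: cdphi.
  apply: cvgM; first exact: cvg_cst.
  apply: cvgM; last exact: cphi.
  by apply: cvgB; [exact: cvg_id|exact: cvg_cst].
have mk : measurable_fun setT k by exact: continuous_measurable_fun.
have bnd n : Ex P (fun w => k (Z w) * \1_(I n) (Z w)) =
    phi n.+1%:R * g n.+1%:R - phi (- n.+1%:R) * g (- n.+1%:R).
  rewrite (Ex_normal mZ ZN (f := fun x => k x * \1_(I n) x)); last first.
    exact: measurable_funM.
  transitivity (\int[lebesgue_measure]_(x in I n) (k x * g x)).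
    rewrite [RHS]Rintegral_mkcond; apply: eq_Rintegral => x _.
    rewrite patchE indicE; case: ifPn => _; first by rewrite mulr1.
    by rewrite mulr0 mul0r.
  rewrite /Rintegral (@continuous_FTC2 _ _ (fun x => phi x * g x))//.
  - by rewrite gtrN.
  - apply: continuous_subspaceT => x.
    by apply: cvgM; [exact: ck|exact: cg].
  - split.
    + by move=> x _; apply: derivableM; [case: (dphiE x)|case: (is_derive_normal_pdf m s0 x)].
    + by apply: cvg_at_right_filter; apply: cvgM; [exact: cphi|exact: cg].
    + by apply: cvg_at_left_filter; apply: cvgM; [exact: cphi|exact: cg].
  - move=> x _; have := is_derive_normal_pdf m s0 x => dg.
    rewrite derive1E; have dM := is_deriveM (dphiE x) dg.
    rewrite derive_val /GRing.scale /= /k -/g.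
    ring.
have lim1 : Ex P (fun w => k (Z w) * \1_(I n) (Z w)) @[n --> \oo] --> Ex P (fun w => k (Z w)).
  apply: (@Ex_dominated _ _ _ _ _ _ (fun w => `|k (Z w)|)).
  - move=> n; apply: (measurableT_comp (f := fun x => k x * \1_(I n) x)) => //.
    exact: measurable_funM.
  - exact: L1_norm.
  - move=> n w; rewrite normrM ler_piMr// indicE.
    by case: (_ \in _); rewrite ?normr1 ?normr0.
  - move=> w; apply: cvg_near_cst; near=> n.
    rewrite indicE mem_set ?mulr1//; rewrite /I /= in_itv/= -ler_norml.
    by near: n; exact: near_ge_natS.
have lim0 : Ex P (fun w => k (Z w) * \1_(I n) (Z w)) @[n --> \oo] --> (0 : R).
  apply/cvgrPdist_le => e e0.
  have [Y hY] := normal_pdf_tail m s0 A (divr_gt0 e0 (ltr0Sn _ 1)).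
  near=> n; rewrite sub0r normrN bnd (le_trans (ler_normB _ _))//.
  rewrite [leRHS](splitr e) lerD// normrM (ger0_norm (normal_pdf_ge0 _ _ _)).
    apply: le_trans (hY n.+1%:R _).
      by rewrite ler_wpM2r ?normal_pdf_ge0.
    rewrite (le_trans _ (lerB_dist _ _))// ger0_norm// lerBrDr.
    by near: n; exact: near_ge_natS.
  apply: le_trans (hY (- n.+1%:R) _).
    by rewrite ler_wpM2r ?normal_pdf_ge0.
  rewrite (le_trans _ (lerB_dist _ _))// normrN ger0_norm// lerBrDr.
  by near: n; exact: near_ge_natS.
exact: (cvg_unique (@norm_hausdorff _ _) lim1 lim0).
Unshelve. all: by end_near. Qed.

End normal_stein.

Lemma measurable_cos (R : realType) : measurable_fun setT (@cos R).
Proof. by apply: continuous_measurable_fun; exact: continuous_cos. Qed.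

Lemma measurable_sin (R : realType) : measurable_fun setT (@sin R).
Proof. by apply: continuous_measurable_fun; exact: continuous_sin. Qed.

Section normal_cos.
Context d (T : measurableType d) (R : realType) (P : probability T R)
  (Z : T -> R) (m s : R).
Hypothesis s0 : s != 0.
Hypothesis mZ : measurable_fun setT Z.
Hypothesis ZN : forall A : set R, measurable A ->
  P (Z @^-1` A) = normal_prob m s A.

Lemma Ex_normal_center : Ex P (fun w => Z w - m) = 0.
Proof.
have := @normal_stein _ _ _ _ _ m s s0 mZ ZN (fun=> 1) (fun=> 0) 1 0.
under eq_Rintegral do rewrite mulr1.
rewrite Ex_cst mulr0; apply => [x|x|x].
- exact: cvg_cst.
- by rewrite normr1 mul1r lerDl.
- by rewrite normr0.
Qed.

Lemma Ex_normal_sqr : Ex P (fun w => (Z w - m) ^+ 2) = s ^+ 2.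
Proof.
have := @normal_stein _ _ _ _ _ m s s0 mZ ZN (fun x => x - m) (fun=> 1) 1 1.
rewrite Ex_cst mulr1; apply => [x|x|x|x].
- by apply: is_derive_eq; rewrite subr0.
- exact: cvg_cst.
- by rewrite mul1r lerDr.
- by rewrite normr1.
Qed.

(** The free phase lets this family carry both the real and the imaginary part of the characteristic
    function. *)
Let J th t := Ex P (fun w => cos (t * (Z w - m) + th)).

(** Differentiation under the expectation followed by Stein's identity gives a linear differential
    equation in t. *)
Let is_derive_J th (t : R) : is_derive t 1 (J th) (- (s ^+ 2 * t) * J th t).
Proof.
have ddcos (y x : R) : is_derive x 1 (fun t => cos (t * y + th)) (- (y * sin (x * y + th))).
  apply: is_derive_eq; rewrite /GRing.scale /=. ring.
have E (y x : R) : derive1 (fun t => cos (t * y + th)) x = - (y * sin (x * y + th)).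
  by rewrite derive1E; have h := ddcos y x; exact: derive_val.
have my : measurable_fun setT (fun w => Z w - m) by exact: measurable_funB.
have mC c : measurable_fun setT (fun w => cos (c * (Z w - m) + th)).
  apply: measurableT_comp; first exact: measurable_cos.
  by apply: measurable_funD => //; exact: measurable_funM.
have tI : `]t - 1, t + 1[%classic t by rewrite /= in_itv/=; apply/andP; split; lra.
have intf x : `]t - 1, t + 1[%classic x ->
    P.-integrable setT (EFin \o (fun w => cos (x * (Z w - m) + th))).
  by move=> _; apply: (@L1_bounded _ _ _ _ _ 1) => // w; exact: cos_max.
have der x w : `]t - 1, t + 1[%classic x -> setT w ->
    derivable ((fun t w => cos (t * (Z w - m) + th)) ^~ w) x 1.
  by move=> _ _; case: (ddcos (Z w - m) x).
have L1y : L1 P (fun w => `|Z w - m|).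
  by apply/L1_norm/L2_L1; exact: (L2_normal_sub s0 mZ ZN).
have G_ub x w : `]t - 1, t + 1[%classic x -> setT w ->
    `|partial1of2 (fun t w => cos (t * (Z w - m) + th)) x w| <= `|Z w - m|.
  move=> _ _; rewrite /partial1of2 E normrN normrM ler_piMr// sin_max//.
have G0 w : 0 <= `|Z w - m| by [].
apply: DeriveDef.
  exact: (derivable_under_integral measurableT tI intf der G0 L1y G_ub).
rewrite -derive1E (differentiation_under_integral measurableT tI intf der G0 L1y G_ub).
under eq_Rintegral do rewrite /partial1of2 E.
have dsin (x : R) : is_derive x 1 (fun x => sin (t * (x - m) + th))
    (t * cos (t * (x - m) + th)).
  by apply: is_derive_eq; rewrite /GRing.scale /=; ring.
have stein := @normal_stein _ _ _ _ _ m s s0 mZ ZN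
  (fun x => sin (t * (x - m) + th)) (fun x => t * cos (t * (x - m) + th)) 1 `|t| dsin.
transitivity (- 1 * Ex P (fun w => (Z w - m) * sin (t * (Z w - m) + th))).
  rewrite -ExZ; first by apply: eq_Rintegral => w _; rewrite mulN1r.
  apply: (L1M_bounded (M := 1)).
  - by apply: L2_L1; exact: (L2_normal_sub s0 mZ ZN).
  - apply: measurableT_comp; first exact: measurable_sin.
    by apply: measurable_funD => //; exact: measurable_funM.
  - by move=> w; exact: sin_max.
rewrite stein; first last.
- by move=> x; rewrite normrM ler_piMr// cos_max.
- by move=> x; rewrite mul1r (le_trans (sin_max _))// lerDl.
- move=> x; apply: cvgM; first exact: cvg_cst.
  apply: continuous_comp; last exact: continuous_cos.
  apply: cvgD; last exact: cvg_cst.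
  by apply: cvgM; [exact: cvg_cst|apply: cvgB; [exact: cvg_id|exact: cvg_cst]].
rewrite ExZ; last by apply: (@L1_bounded _ _ _ _ _ 1) => // w; exact: cos_max.
by rewrite mulN1r mulrA mulNr.
Qed.

(** By that equation J times exp (t^2 s^2 / 2) is constant; the mean is absorbed into the phase t m
    + th. *)
Lemma Ex_normal_cos (t th : R) :
  Ex P (fun w => cos (t * Z w + th)) =
  cos (t * m + th) * expR (- (t ^+ 2 * s ^+ 2 / 2)).
Proof.
have K (x : R) th' : is_derive x 1 (fun t => J th' t * expR (t ^+ 2 * s ^+ 2 / 2)) 0.
  have := is_derive_J th' x => dJ.
  apply: is_derive_eq; rewrite /GRing.scale /=.
  by field.
have := is_derive_0_is_cst t 0 (fun x => K x (t * m + th)).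
rewrite expr0n /= !mul0r expR0 mulr1 => h.
have J0 : J (t * m + th) 0 = cos (t * m + th).
  by rewrite /J; under eq_Rintegral do rewrite mul0r add0r; rewrite Ex_cst.
rewrite expRN -J0 -h mulfK ?gt_eqF ?expR_gt0//.
by apply: eq_Rintegral => w _; congr cos; ring.
Qed.

End normal_cos.

Section normal_rv.
Context d (T : measurableType d) (R : realType) (P : probability T R)
  (Z : T -> R) (m v : R).
Hypothesis mZ : measurable_fun setT Z.
Hypothesis ZN : normal_rv P Z m v.

(** Linear combinations in a Gaussian process can be degenerate, so the point mass has to be
    treated: there [Z] equals [m] almost surely. *)
Lemma normal_rv_cst (f : R -> R) : v = 0 -> measurable_fun setT f ->
  L1 P (fun w => f (Z w)) /\ Ex P (fun w => f (Z w)) = f m.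
Proof.
case: ZN => _ + v0 mf; rewrite v0 eqxx => h.
have Zm : {ae P, forall w, Z w = m}.
  exists (Z @^-1` (~` [set m])); split.
  - by rewrite -[X in measurable X]setTI; apply: mZ => //; apply: measurableC.
  - rewrite h; last exact: measurableC.
    by rewrite diracE memNset//= => /(_ erefl).
  - by move=> w /= zm.
have mfZ : measurable_fun setT (fun w => f (Z w)) by exact: (measurableT_comp mf mZ).
have ae : {ae P, forall w, f (Z w) = f m}.
  by apply: filterS Zm => w ->.
split; last by rewrite (Ex_ae mfZ _ ae)// Ex_cst.
apply/integrableP; split; first exact/measurable_EFinP.
rewrite (@ae_eq_integral _ _ _ P setT (fun=> `|(f m)%:E|%E)) => //.
- by rewrite integral_cst//= probability_setT mule1 ltry.
- by apply: measurableT_comp => //; exact/measurable_EFinP.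
- by apply: filterS ae => w + _ => /= ->.
Qed.

Let caseN : v != 0 -> Num.sqrt v != 0 /\
  (forall A : set R, measurable A -> P (Z @^-1` A) = normal_prob m (Num.sqrt v) A).
Proof.
case: ZN => v0 + vn0; rewrite (negbTE vn0) => h; split => //.
by rewrite sqrtr_eq0 -ltNge lt_neqAle eq_sym vn0.
Qed.

Let sqr_v : Num.sqrt v ^+ 2 = v.
Proof. by case: ZN => v0 _; rewrite sqr_sqrtr. Qed.

Lemma normal_rv_L2 : L2 P Z.
Proof.
suff : L2 P (fun w => (Z w - m) + m) by under eq_fun do rewrite subrK.
apply: L2D; last exact: L2_cst.
have [v0|/caseN[s0 h]] := eqVneq v 0; last exact: (L2_normal_sub s0 mZ h).
split; first exact: measurable_funB.
have [|//] := normal_rv_cst (f := fun x => (x - m) ^+ 2) v0.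
by apply: measurable_funX; exact: measurable_funB.
Qed.

Lemma normal_rv_mean : Ex P Z = m.
Proof.
have [v0|/caseN[s0 h]] := eqVneq v 0.
  by have [] := normal_rv_cst (f := id) v0 (@measurable_id _ _ _).
have := Ex_normal_center s0 mZ h; rewrite ExB ?Ex_cst.
- by move/eqP; rewrite subr_eq0 => /eqP.
- exact: L2_L1 normal_rv_L2.
- exact: L1_cst.
Qed.

Lemma normal_rv_var : Ex P (fun w => (Z w - m) ^+ 2) = v.
Proof.
have [v0|/caseN[s0 h]] := eqVneq v 0; last by rewrite (Ex_normal_sqr s0 mZ h).
have [|_ ->] := normal_rv_cst (f := fun x => (x - m) ^+ 2) v0.
  by apply: measurable_funX; exact: measurable_funB.
by rewrite subrr expr0n v0.
Qed.

Lemma normal_rv_cos (t th : R) : Ex P (fun w => cos (t * Z w + th)) =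
  cos (t * m + th) * expR (- (t ^+ 2 * v / 2)).
Proof.
have [v0|/caseN[s0 h]] := eqVneq v 0; last by rewrite (Ex_normal_cos s0 mZ h) sqr_v.
have [|_ ->] := normal_rv_cst (f := fun x => cos (t * x + th)) v0.
  apply: measurableT_comp; first exact: measurable_cos.
  by apply: measurable_funD => //; exact: measurable_funM.
by rewrite v0 mulr0 mul0r oppr0 expR0 mulr1.
Qed.

End normal_rv.

(** * Approximation by trigonometric polynomials *)

(** Only the first point has to lie in [K]; the second may leave it. This follows from the
    near-covering form of compactness with the radius as parameter. *)
Lemma compact_uniform_continuity (R : realType) (U : pseudoMetricType R)
    (K : set U) (G : U -> R) (e : R) :
  compact K -> continuous G -> 0 < e ->
  exists2 r : R, 0 < r & forall y z, K y -> ball y r z -> `|G z - G y| < e.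
Proof.
move=> /compact_near_coveringP cK cG e0.
have e20 : 0 < e / 2 by rewrite divr_gt0.
have : \forall r \near (0:R)^'+, forall y, K y -> forall z, ball y r z -> `|G z - G y| < e.
  apply: (cK R (0:R)^'+ (fun r y => forall z, ball y r z -> `|G z - G y| < e)).
  move=> x Kx.
  have /cvgrPdist_lt /(_ _ e20) := cG x.
  move=> /nbhs_ballP[r /= r0 hr].
  near=> y t.
  have tr : t <= r / 2 by near: t; apply: nbhs_right_le; rewrite divr_gt0.
  move=> z yz.
  have xy : ball x (r / 2) y by near: y; apply: nbhsx_ballx; rewrite divr_gt0.
  have xz : ball x r z.
    rewrite [r]splitr; apply: (ball_triangle xy).
    exact: le_ball yz.
  have h1 := hr _ xz.
  have h2 : `|G x - G y| < e / 2.
    by apply: hr; apply: le_ball xy; lra.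
  rewrite (_ : G z - G y = (G z - G x) + (G x - G y)); last by rewrite addrA subrK.
  by rewrite (le_lt_trans (ler_normD _ _))// [ltRHS]splitr ltrD// distrC.
move=> h; near (0:R)^'+ => r; exists r => //.
by move=> y z Ky; have : forall y, K y -> forall z, ball y r z -> `|G z - G y| < e;
  [near: r|move=> /(_ y Ky z)].
Unshelve. all: by end_near. Qed.

(* bern n phi y = E phi(S) for S binomial with parameters n and y: the Bernstein
   polynomial with values phi, in de Casteljau form. *)
Fixpoint bern (R : realType) (n : nat) (phi : nat -> R) (y : R) : R :=
  if n is n'.+1 then y * bern n' (phi \o S) y + (1 - y) * bern n' phi y
  else phi 0%N.

Section bernstein.
Context (R : realType).
Implicit Types (phi psi : nat -> R) (y c : R).

Lemma bern_le n phi psi y : 0 <= y <= 1 ->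
  (forall k, (k <= n)%N -> phi k <= psi k) -> bern n phi y <= bern n psi y.
Proof.
move=> /andP[y0 y1]; elim: n phi psi => [|n ih] phi psi h /=; first exact: h.
rewrite lerD// ler_wpM2l ?subr_ge0//; apply: ih => k kn; apply: h => //.
exact: leqW.
Qed.

Lemma bern_lin n phi psi y a b :
  bern n (fun k => a * phi k + b * psi k) y = a * bern n phi y + b * bern n psi y.
Proof.
elim: n phi psi => [//|n ih] phi psi /=.
have -> : (fun k => a * phi k + b * psi k) \o S =
  fun k => a * (phi \o S) k + b * (psi \o S) k by [].
by rewrite !ih; ring.
Qed.

Lemma bern_cst n y c : bern n (fun=> c) y = c.
Proof.
elim: n => [//|n ih] /=; have -> : (fun=> c) \o S = fun=> c by [].
by rewrite ih; ring.
Qed.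

(** Squared bias plus variance of a binomial variable with parameters n and y. *)
Lemma bern_var n y c : bern n (fun k => (k%:R - c) ^+ 2) y =
  (n%:R * y - c) ^+ 2 + n%:R * y * (1 - y).
Proof.
elim: n c => [|n ih] c /=; first by rewrite !mul0r addr0.
have -> : (fun k => (k%:R - c) ^+ 2) \o S = fun k => (k%:R - (c - 1)) ^+ 2.
  by apply/funext => k /=; rewrite -natr1; ring.
by rewrite !ih -natr1; ring.
Qed.

(** Bernstein's argument: uniform continuity of [G] when k / n is within r of y, Chebyshev's
    inequality otherwise. *)
Lemma bern_approx (G : R -> R) (M e : R) : continuous G -> 0 < e ->
  (forall x, `|G x| <= M) ->
  exists2 n : nat, (0 < n)%N & forall y, 0 <= y <= 1 ->
    `|bern n (fun k => G (k%:R / n%:R)) y - G y| <= e.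
Proof.
move=> cG e0 GM; have e20 : 0 < e / 2 by rewrite divr_gt0.
have M0 : 0 <= M by rewrite (le_trans _ (GM 0)).
have [r r0 hr] := compact_uniform_continuity (@segment_compact R 0 1) cG e20.
(* This n makes the Chebyshev term 2 M / (r^2 n) at most e / 2. *)
pose n := (Num.truncn (4 * M / (r ^+ 2 * e))).+1.
have n0 : 0 < n%:R :> R by rewrite ltr0n.
exists n => // y /[dup] y01 /andP[y0 y1].
have hn : 4 * M / (r ^+ 2 * e) <= n%:R.
  by apply: ltW; exact: truncnS_gt.
have bnd k : `|G (k%:R / n%:R) - G y| <= e / 2 + 2 * M / r ^+ 2 * (k%:R / n%:R - y) ^+ 2.
  set x := k%:R / n%:R; have [xy|xy] := ltP `|x - y| r.
    have /ltW : `|G x - G y| < e / 2.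
      by apply: hr; [rewrite /= in_itv/= y0|rewrite -ball_normE /ball_ /= distrC].
    move=> /le_trans; apply; rewrite lerDl mulr_ge0 ?sqr_ge0//.
    by rewrite divr_ge0 ?sqr_ge0// mulr_ge0.
  rewrite (le_trans (ler_normB _ _))// (@le_trans _ _ (2 * M))//.
    by rewrite mulr2n mulrDl mul1r lerD.
  rewrite -[leLHS]add0r lerD ?(ltW e20)// -mulrA -[leLHS]mulr1 ler_wpM2l ?mulr_ge0//.
  rewrite mulrC ler_pdivlMr ?exprn_gt0// mul1r -(sqr_abs (x - y)).
  by rewrite lerXn2r ?nnegrE// ltW.
have key : bern n (fun k => e / 2 + 2 * M / r ^+ 2 * (k%:R / n%:R - y) ^+ 2) y <= e.
  have -> : (fun k : nat => e / 2 + 2 * M / r ^+ 2 * (k%:R / n%:R - y) ^+ 2) =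
     (fun k => e / 2 * 1 + (2 * M / (r ^+ 2 * n%:R ^+ 2)) * (k%:R - n%:R * y) ^+ 2).
    apply/funext => k; field.
    by rewrite !gt_eqF.
  rewrite bern_lin bern_cst bern_var mulr1 subrr expr0n add0r [leRHS]splitr lerD2l.
  apply: (@le_trans _ _ (2 * M / (r ^+ 2 * n%:R))).
    have -> : 2 * M / (r ^+ 2 * n%:R ^+ 2) * (n%:R * y * (1 - y)) =
      2 * M / (r ^+ 2 * n%:R) * (y * (1 - y)) by field; rewrite !gt_eqF.
    rewrite ler_piMr//; last by nra.
    by apply: divr_ge0; [exact: mulr_ge0|apply: mulr_ge0; [exact: sqr_ge0|exact: ltW]].
  rewrite ler_pdivrMr ?mulr_gt0 ?exprn_gt0//.
  move: hn; rewrite ler_pdivrMr ?mulr_gt0 ?exprn_gt0//; lra.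
rewrite ler_norml; apply/andP; split.
- rewrite lerBrDl (@le_trans _ _ (bern n (fun k =>
    1 * G y + - 1 * (e / 2 + 2 * M / r ^+ 2 * (k%:R / n%:R - y) ^+ 2)) y))//.
    by rewrite bern_lin bern_cst; lra.
  apply: bern_le => // k _; have := bnd k; rewrite ler_norml => /andP[+ _]; lra.
- rewrite lerBlDl (@le_trans _ _ (bern n (fun k =>
    1 * G y + 1 * (e / 2 + 2 * M / r ^+ 2 * (k%:R / n%:R - y) ^+ 2)) y))//.
    apply: bern_le => // k _; have := bnd k; rewrite ler_norml => /andP[_]; lra.
  by rewrite bern_lin bern_cst; lra.
Qed.

End bernstein.

(** A triple holds amplitude, frequency and phase; frequencies are arbitrary reals, so no common
    period is imposed. *)
Definition trig_sum (R : realType) (s : seq (R * R * R)) (x : R) : R :=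
  \sum_(i <- s) i.1.1 * cos (i.1.2 * x + i.2).

Definition trig_poly (R : realType) (f : R -> R) : Prop :=
  exists s : seq (R * R * R), f = trig_sum s.

Section trig_poly.
Context (R : realType).
Implicit Types (f g : R -> R) (a b c th : R).

Lemma trig_poly_cos c a th : trig_poly (fun x => c * cos (a * x + th)).
Proof. by exists [:: (c, a, th)]; apply/funext => x; rewrite /trig_sum big_seq1. Qed.

Lemma trig_poly_cst c : trig_poly (fun=> c).
Proof.
have := trig_poly_cos c 0 0; congr (trig_poly _).
by apply/funext => x; rewrite mul0r addr0 cos0 mulr1.
Qed.

Lemma trig_polyD f g : trig_poly f -> trig_poly g ->
  trig_poly (fun x => f x + g x).
Proof.
move=> [s ->] [t ->]; exists (s ++ t); apply/funext => x.
by rewrite /trig_sum big_cat.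
Qed.

Lemma trig_polyMcos f c a th : trig_poly f ->
  trig_poly (fun x => c * cos (a * x + th) * f x).
Proof.
move=> [s ->]; elim: s => [|[[c' b] et] s ih].
  have := trig_poly_cst 0; congr (trig_poly _).
  by apply/funext => x; rewrite /trig_sum big_nil mulr0.
have := trig_polyD (trig_polyD (trig_poly_cos (c * c' / 2) (a + b) (th + et))
  (trig_poly_cos (c * c' / 2) (a - b) (th - et))) ih.
congr (trig_poly _); apply/funext => x; rewrite /trig_sum big_cons /= mulrDr.
congr (_ + _).
have -> : (a + b) * x + (th + et) = (a * x + th) + (b * x + et) by ring.
have -> : (a - b) * x + (th - et) = (a * x + th) - (b * x + et) by ring.
by rewrite cosD cosB; field.
Qed.

Lemma trig_polyM f g : trig_poly f -> trig_poly g ->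
  trig_poly (fun x => f x * g x).
Proof.
move=> [s ->] hg; elim: s => [|[[c a] th] s ih].
  have := trig_poly_cst 0; congr (trig_poly _).
  by apply/funext => x; rewrite /trig_sum big_nil mul0r.
have := trig_polyD (trig_polyMcos c a th hg) ih.
by congr (trig_poly _); apply/funext => x; rewrite /trig_sum big_cons /= mulrDl.
Qed.

Lemma trig_poly_bern n (phi : nat -> R) f : trig_poly f ->
  trig_poly (fun x => bern n phi (f x)).
Proof.
move=> hf; elim: n phi => [|n ih] phi /=; first exact: trig_poly_cst.
apply: trig_polyD; apply: trig_polyM => //.
apply: trig_polyD; first exact: trig_poly_cst.
have := trig_polyM (trig_poly_cst (-1)) hf; congr (trig_poly _).
by apply/funext => x; rewrite mulN1r.
Qed.

Lemma continuous_trig_poly f : trig_poly f -> continuous f.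
Proof.
move=> [s ->]; elim: s => [|i s ih] x.
  rewrite (_ : trig_sum [::] = fun=> 0); first exact: cvg_cst.
  by apply/funext => y; rewrite /trig_sum big_nil.
rewrite (_ : trig_sum (i :: s) = fun y => i.1.1 * cos (i.1.2 * y + i.2) + trig_sum s y).
  apply: cvgD; last exact: ih.
  apply: cvgM; first exact: cvg_cst.
  apply: continuous_comp; last exact: continuous_cos.
  by apply: cvgD; [apply: cvgM; [exact: cvg_cst|exact: cvg_id]|exact: cvg_cst].
by apply/funext => y; rewrite /trig_sum big_cons.
Qed.

Lemma measurable_trig_poly f : trig_poly f -> measurable_fun setT f.
Proof. by move=> /continuous_trig_poly; exact: continuous_measurable_fun. Qed.

(* On [-L, L], f factors through the injective map x |-> sin (x / (2 * L)) as
   G (sin (x / (2 * L))) with G continuous, and Bernstein polynomials of G keep the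
   bound M on the whole line. *)
Theorem trig_poly_approx f M L e : continuous f -> (forall x, `|f x| <= M) ->
  0 < L -> 0 < e -> exists p, [/\ trig_poly p, forall x, `|p x| <= M &
    forall x, `|x| <= L -> `|p x - f x| <= e].
Proof.
move=> cf fM L0 e0; have M0 : 0 <= M by rewrite (le_trans _ (fM 0)).
have pi1 : 2^-1 < pi / 2 :> R by have := @pihalf_ge1 R; lra.
have K0 : 0 < 2 * L by lra.
pose s1 := sin (2^-1 : R).
have s1_lt1 : s1 < 1.
  rewrite -sin_pihalf ltr_sin// in_itv/=; apply/andP; split; lra.
have s1_gt0 : 0 < s1 by apply: sin_gt0_pihalf; apply/andP; split; lra.
(* Clipping keeps the argument of [asin] inside ]-1, 1[, where it is continuous, and is inactive for
   |x| <= L because then |x / (2 L)| <= 1 / 2. *)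
pose clip (s : R) := Num.max (- s1) (Num.min s1 s).
have clip1 s : -1 < clip s < 1.
  rewrite /clip; apply/andP; split.
    by rewrite lt_max ltrN2 s1_lt1.
  by rewrite gt_max gt_min s1_lt1 andbT; lra.
have cclip : continuous clip.
  move=> x; apply: (@continuous_max _ _ (fun=> - s1) (fun s => Num.min s1 s)).
    exact: cvg_cst.
  by apply: (@continuous_min _ _ (fun=> s1) id); [exact: cvg_cst|exact: cvg_id].
pose G (y : R) := f (2 * L * asin (clip (2 * y - 1))).
have cG : continuous G.
  have c1 : continuous (fun y : R => 2 * y - 1).
    by move=> y; apply: cvgB; [apply: cvgM; [exact: cvg_cst|exact: cvg_id]|exact: cvg_cst].
  have c2 : continuous (fun y : R => clip (2 * y - 1)).
    by move=> y; exact: (@continuous_comp R R R _ clip y (c1 y) (@cclip _)).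
  have c3 : continuous (fun y : R => asin (clip (2 * y - 1))).
    by move=> y; exact: (@continuous_comp R R R _ asin y (c2 y) (@continuous_asin _ _ (clip1 _))).
  have c4 : continuous (fun y : R => 2 * L * asin (clip (2 * y - 1))).
    by move=> y; apply: cvgM; [exact: cvg_cst|exact: c3].
  by move=> y; exact: (@continuous_comp R R R _ f y (c4 y) (@cf _)).
have GM y : `|G y| <= M by exact: fM.
have [n n0 hn] := bern_approx cG e0 GM.
pose y x : R := (1 + sin (x / (2 * L))) / 2.
have y01 x : 0 <= y x <= 1.
  by rewrite /y; have := sin_geN1 (x / (2 * L)); have := sin_le1 (x / (2 * L)); move=> *; apply/andP; split; lra.
exists (fun x => bern n (fun k => G (k%:R / n%:R)) (y x)); split.
- apply: trig_poly_bern.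
  (* The sine in [y] is a cosine with phase shifted by - pi / 2. *)
  have := trig_polyD (trig_poly_cst (2^-1)) (trig_poly_cos 2^-1 (2 * L)^-1 (- (pi / 2))).
  congr (trig_poly _); apply/funext => x; rewrite /y cosBpihalf mulrC.
  by rewrite (mulrC x); field.
- move=> x; rewrite ler_norml; apply/andP; split.
    rewrite -[leLHS](bern_cst n (y x)); apply: bern_le => // k _.
    by have := GM (k%:R / n%:R); rewrite ler_norml => /andP[].
  rewrite -[leRHS](bern_cst n (y x)); apply: bern_le => // k _.
  by have := GM (k%:R / n%:R); rewrite ler_norml => /andP[].
- move=> x xL; have -> : f x = G (y x); last exact: hn.
  have xL1 : - 2^-1 <= x / (2 * L) <= 2^-1.
    rewrite -ler_norml normrM normfV (gtr0_norm K0) ler_pdivrMr// mulrA mulVf//.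
    by rewrite mul1r.
  have /andP[xl xr] := xL1.
  rewrite /G /y.
  have -> : 2 * ((1 + sin (x / (2 * L))) / 2) - 1 = sin (x / (2 * L)) by field.
  have h1 : - s1 <= sin (x / (2 * L)).
    rewrite -sinN; have [->//|ne] := eqVneq (x / (2 * L)) (- 2^-1).
    by rewrite ltW// ltr_sin ?in_itv/=; [rewrite lt_neqAle eq_sym ne|apply/andP; split; lra..].
  have h2 : sin (x / (2 * L)) <= s1.
    have [->//|ne] := eqVneq (x / (2 * L)) 2^-1.
    by rewrite ltW// ltr_sin ?in_itv/=; [rewrite lt_neqAle ne|apply/andP; split; lra..].
  rewrite /clip (min_idPr _)// (max_idPr _)// sinK.
    by rewrite mulrC divfK// gt_eqF.
  by rewrite in_itv/=; apply/andP; split; lra.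
Qed.

End trig_poly.

(** * Gebelein's inequality *)

Section gebelein_trig.
Context (R : realType) (m v : R).
Hypothesis v0 : 0 <= v.
(* [trig_weight i k] is, up to a sign depending on k only, the k-th Hermite coefficient
   of x |-> i.1.1 * cos (i.1.2 * x + i.2) under the normal law N(m, v). *)
Definition cos_or_sin (k : nat) (x : R) := if odd k then sin x else cos x.

(** The value of E f(X) g(Y) for two waves f, g and a normal pair with common mean m, common
    variance v and correlation r. *)
Definition trig_kernel (r : R) (i j : R * R * R) : R :=
  i.1.1 * j.1.1 * (expR (- (v * (i.1.2 ^+ 2 + j.1.2 ^+ 2) / 2)) *
  (cos ((i.1.2 * m + i.2) + (j.1.2 * m + j.2)) * expR (- (v * i.1.2 * j.1.2 * r)) +
   cos ((i.1.2 * m + i.2) - (j.1.2 * m + j.2)) * expR (v * i.1.2 * j.1.2 * r)) / 2).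

Definition trig_weight (i : R * R * R) (k : nat) : R :=
  i.1.1 * expR (- (v * i.1.2 ^+ 2 / 2)) * (Num.sqrt v * i.1.2) ^+ k *
  cos_or_sin k (i.1.2 * m + i.2).

(** Even powers of z collect the products of cosines, odd powers those of sines. *)
Let series_tau (z x y : R) N :
  \sum_(0 <= k < N) z ^+ k / k`!%:R * (cos_or_sin k x * cos_or_sin k y) =
  (cos (x + y) * series (exp_coeff (- z)) N +
   cos (x - y) * series (exp_coeff z) N) / 2.
Proof.
rewrite /series /= !mulr_sumr -big_split /= mulr_suml; apply: eq_bigr => k _.
rewrite /exp_coeff /= exprNn cosB cosD /cos_or_sin -signr_odd.
by case: (odd k); rewrite ?expr1 ?expr0; field; rewrite pnatr_eq0 -lt0n fact_gt0.
Qed.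

(** Mehler's expansion for two waves: the two exponentials of the kernel are expanded in powers of
    r. *)
Let kern_cvg r i j :
  \sum_(0 <= k < N) r ^+ k / k`!%:R * (trig_weight i k * trig_weight j k) @[N --> \oo] --> trig_kernel r i j.
Proof.
pose z := v * i.1.2 * j.1.2 * r.
pose c := i.1.1 * j.1.1 * expR (- (v * (i.1.2 ^+ 2 + j.1.2 ^+ 2) / 2)).
have E N : \sum_(0 <= k < N) r ^+ k / k`!%:R * (trig_weight i k * trig_weight j k) = c *
    ((cos ((i.1.2 * m + i.2) + (j.1.2 * m + j.2)) * series (exp_coeff (- z)) N +
     cos ((i.1.2 * m + i.2) - (j.1.2 * m + j.2)) * series (exp_coeff z) N) / 2).
  rewrite -series_tau mulr_sumr; apply: eq_bigr => k _.
  rewrite /trig_weight /c /z mulrDr mulrDl opprD expRD.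
  rewrite -[X in (X * _ * _ * r) ^+ k](sqr_sqrtr v0).
  by rewrite !exprMn; field; rewrite pnatr_eq0 -lt0n fact_gt0.
under eq_fun do rewrite E.
have -> : trig_kernel r i j = c * ((cos ((i.1.2 * m + i.2) + (j.1.2 * m + j.2)) * expR (- z) +
     cos ((i.1.2 * m + i.2) - (j.1.2 * m + j.2)) * expR z) / 2).
  by rewrite /trig_kernel /c /z; field.
have ce (y : R) : series (exp_coeff y) @ \oo --> expR y.
  exact: is_cvg_series_exp_coeff.
apply: cvgM; first exact: cvg_cst.
apply: cvgM; last exact: cvg_cst.
by apply: cvgD; apply: cvgM; [exact: cvg_cst|exact: ce|exact: cvg_cst|exact: ce].
Qed.

Definition trig_kernel_sum r (s : seq (R * R * R)) : R := \sum_(i <- s) \sum_(j <- s) trig_kernel r i j.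

Definition trig_weight_sum (s : seq (R * R * R)) k : R := \sum_(i <- s) trig_weight i k.

Let dkern_cvg r s :
  \sum_(0 <= k < N) r ^+ k / k`!%:R * trig_weight_sum s k ^+ 2 @[N --> \oo] --> trig_kernel_sum r s.
Proof.
have E N : \sum_(0 <= k < N) r ^+ k / k`!%:R * trig_weight_sum s k ^+ 2 =
   \sum_(i <- s) \sum_(j <- s) \sum_(0 <= k < N) r ^+ k / k`!%:R * (trig_weight i k * trig_weight j k).
  transitivity (\sum_(0 <= k < N) \sum_(i <- s) \sum_(j <- s)
      r ^+ k / k`!%:R * (trig_weight i k * trig_weight j k)).
    apply: eq_bigr => k _; rewrite expr2 /trig_weight_sum big_distrlr /= mulr_sumr.
    by apply: eq_bigr => i _; rewrite mulr_sumr.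
  by rewrite exchange_big /=; apply: eq_bigr => i _; rewrite exchange_big.
under eq_fun do rewrite E.
suff gen (s1 s2 : seq (R * R * R)) : \sum_(i <- s1) \sum_(j <- s2)
     \sum_(0 <= k < N) r ^+ k / k`!%:R * (trig_weight i k * trig_weight j k)
   @[N --> \oo] --> \sum_(i <- s1) \sum_(j <- s2) trig_kernel r i j by exact: gen.
elim: s1 => [|i s1 ih].
  by under eq_fun do rewrite big_nil; rewrite big_nil; exact: cvg_cst.
under eq_fun do rewrite big_cons; rewrite big_cons.
apply: cvgD ih.
elim: s2 => [|j s2 ih].
  by under eq_fun do rewrite big_nil; rewrite big_nil; exact: cvg_cst.
under eq_fun do rewrite big_cons; rewrite big_cons.
by apply: cvgD ih; exact: kern_cvg.
Qed.

Lemma trig_kernel_gebelein r s : `|r| <= 1 ->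
  `|trig_kernel_sum r s - trig_weight_sum s 0 ^+ 2| <= `|r| * trig_kernel_sum 1 s.
Proof.
move=> r1.
have c1 := @dkern_cvg r s; have c2 := @dkern_cvg 1 s.
have c3 : `|\sum_(0 <= k < N) r ^+ k / k`!%:R * trig_weight_sum s k ^+ 2 - trig_weight_sum s 0 ^+ 2|
    @[N --> \oo] --> `|trig_kernel_sum r s - trig_weight_sum s 0 ^+ 2|.
  by apply: cvg_norm; apply: cvgB c1 _; exact: cvg_cst.
have c4 : `|r| * \sum_(0 <= k < N) 1 ^+ k / k`!%:R * trig_weight_sum s k ^+ 2
    @[N --> \oo] --> `|r| * trig_kernel_sum 1 s.
  by apply: cvgM c2; exact: cvg_cst.
rewrite -(cvg_lim _ c3)// -(cvg_lim _ c4)//; apply: ler_lim.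
- by apply/cvg_ex; eexists; exact: c3.
- by apply/cvg_ex; eexists; exact: c4.
near=> N.
have N0 : (0 < N)%N by near: N; exists 1%N.
rewrite -(prednK N0) big_nat_recl//= fact0 divr1 mul1r addrAC subrr add0r.
rewrite (le_trans (ler_norm_sum _ _ _))// mulr_sumr [leRHS]big_nat_recl//=.
rewrite -[leLHS]add0r lerD//.
  by rewrite mulr_ge0// mulr_ge0 ?sqr_ge0// divr_ge0// exprn_ge0.
apply: ler_sum => k _; rewrite expr1n normrM (ger0_norm (sqr_ge0 _)) [leRHS]mulrA.
rewrite ler_wpM2r ?sqr_ge0// normrM normfV (ger0_norm (ler0n _ _)) mul1r.
rewrite ler_wpM2r ?invr_ge0// normrX exprS ler_piMr//.
by rewrite exprn_ile1.
Unshelve. all: by end_near. Qed.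

End gebelein_trig.

Section gebelein_trig_expectation.
Context d (T : measurableType d) (R : realType) (P : probability T R)
  (m v : R) (X Y : T -> R) (r : R).
Hypotheses (mX : measurable_fun setT X) (mY : measurable_fun setT Y).
Hypothesis XYcos : forall a b th, Ex P (fun w => cos (a * X w + b * Y w + th)) =
  cos (a * m + b * m + th) *
  expR (- (v * (a ^+ 2 + b ^+ 2 + 2 * a * b * r) / 2)).

Let Ex_kern (i j : R * R * R) :
  Ex P (fun w => (i.1.1 * cos (i.1.2 * X w + i.2)) * (j.1.1 * cos (j.1.2 * Y w + j.2)))
  = trig_kernel m v r i j.
Proof.
case: i => [[c a] th]; case: j => [[c' b] et] /=.
have mc (a' b' th' : R) : L1 P (fun w => cos (a' * X w + b' * Y w + th')).
  apply: (@L1_bounded _ _ _ _ _ 1) => [|w]; last exact: cos_max.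
  apply: measurableT_comp; first exact: measurable_cos.
  by apply: measurable_funD => //; apply: measurable_funD; exact: measurable_funM.
transitivity (Ex P (fun w => c * c' / 2 * cos (a * X w + b * Y w + (th + et)) +
   c * c' / 2 * cos (a * X w + (- b) * Y w + (th - et)))).
  apply: eq_Rintegral => w _.
  have -> : a * X w + b * Y w + (th + et) = (a * X w + th) + (b * Y w + et) by ring.
  have -> : a * X w + (- b) * Y w + (th - et) = (a * X w + th) - (b * Y w + et) by ring.
  move: (a * X w + th) (b * Y w + et) => A B.
  by rewrite cosD cosB; field.
rewrite ExD; [|exact: L1Z|exact: L1Z].
rewrite !ExZ// !XYcos /trig_kernel /=.
have -> : a * m + b * m + (th + et) = a * m + th + (b * m + et) by ring.
have -> : a * m + - b * m + (th - et) = a * m + th - (b * m + et) by ring.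
have -> : - (v * (a ^+ 2 + b ^+ 2 + 2 * a * b * r) / 2) =
  - (v * (a ^+ 2 + b ^+ 2) / 2) + - (v * a * b * r) by field.
have -> : - (v * (a ^+ 2 + (- b) ^+ 2 + 2 * a * (- b) * r) / 2) =
  - (v * (a ^+ 2 + b ^+ 2) / 2) + v * a * b * r by field.
by rewrite !expRD; field.
Qed.

Lemma Ex_trig_sumM s : Ex P (fun w => trig_sum s (X w) * trig_sum s (Y w)) =
  trig_kernel_sum m v r s.
Proof.
have mcX (i : R * R * R) : L2 P (fun w => i.1.1 * cos (i.1.2 * X w + i.2)).
  apply: L2Z; apply: (@L2_bounded _ _ _ _ _ 1) => [|w]; last exact: cos_max.
  apply: measurableT_comp; first exact: measurable_cos.
  by apply: measurable_funD => //; exact: measurable_funM.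
have mcY (i : R * R * R) : L2 P (fun w => i.1.1 * cos (i.1.2 * Y w + i.2)).
  apply: L2Z; apply: (@L2_bounded _ _ _ _ _ 1) => [|w]; last exact: cos_max.
  apply: measurableT_comp; first exact: measurable_cos.
  by apply: measurable_funD => //; exact: measurable_funM.
under eq_Rintegral do rewrite /trig_sum big_distrlr /=.
rewrite Ex_sum => [|i]; last by apply: L1_sum => j; exact: L1M.
apply: eq_bigr => i _; rewrite Ex_sum => [|j]; last exact: L1M.
by apply: eq_bigr => j _; exact: Ex_kern.
Qed.

End gebelein_trig_expectation.

Lemma Ex_trig_sum d (T : measurableType d) (R : realType) (P : probability T R)
    (m v : R) (X : T -> R) s : measurable_fun setT X ->
  (forall a th, Ex P (fun w => cos (a * X w + th)) =
    cos (a * m + th) * expR (- (a ^+ 2 * v / 2))) ->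
  Ex P (fun w => trig_sum s (X w)) = trig_weight_sum m v s 0.
Proof.
move=> mX Xcos; have mc (a th : R) : L1 P (fun w => cos (a * X w + th)).
  apply: (@L1_bounded _ _ _ _ _ 1) => [|w]; last exact: cos_max.
  apply: measurableT_comp; first exact: measurable_cos.
  by apply: measurable_funD => //; exact: measurable_funM.
rewrite /trig_sum Ex_sum => [|i]; last exact: L1Z.
apply: eq_bigr => i _; rewrite ExZ// Xcos /trig_weight /cos_or_sin /= expr0 mulr1.
by rewrite [v * _]mulrC mulrA mulrAC.
Qed.

(* Mehler: E f(X) f(Y) = \sum_k r ^ k / k! * A_k ^ 2, where the term k = 0 is (E f) ^ 2
   and the others are at most |r| times their value at r = 1. *)
Lemma gebelein_trig d (T : measurableType d) (R : realType) (P : probability T R)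
    (m v r : R) (X Y : T -> R) (f : R -> R) :
  0 <= v -> `|r| <= 1 -> measurable_fun setT X -> measurable_fun setT Y ->
  (forall a th, Ex P (fun w => cos (a * X w + th)) =
    cos (a * m + th) * expR (- (a ^+ 2 * v / 2))) ->
  (forall a b th, Ex P (fun w => cos (a * X w + b * Y w + th)) =
    cos (a * m + b * m + th) *
    expR (- (v * (a ^+ 2 + b ^+ 2 + 2 * a * b * r) / 2))) ->
  trig_poly f ->
  `|Ex P (fun w => f (X w) * f (Y w)) - Ex P (fun w => f (X w)) ^+ 2| <=
  `|r| * Ex P (fun w => f (X w) ^+ 2).
Proof.
move=> v0 r1 mX mY Xcos XYcos [s ->].
rewrite (Ex_trig_sumM mX mY XYcos) (Ex_trig_sum s mX Xcos).
(* E f(X)^2 is the kernel sum of the pair (X, X), whose correlation is 1. *)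
rewrite (@Ex_trig_sumM _ _ _ _ m v X X 1 mX mX).
  exact: trig_kernel_gebelein.
move=> a b th; under eq_Rintegral do rewrite -mulrDl.
by rewrite Xcos mulrDl; congr (_ * expR _); field.
Qed.

(** * Mean-square density of trigonometric polynomials under a normal law *)

Section trig_density.
Context d (T : measurableType d) (R : realType) (P : probability T R)
  (Z : T -> R) (m s : R).
Hypothesis s0 : s != 0.
Hypothesis mZ : measurable_fun setT Z.
Hypothesis ZN : forall A : set R, measurable A ->
  P (Z @^-1` A) = normal_prob m s A.

Let mpre (A : set R) : measurable A -> measurable (Z @^-1` A).
Proof. by move=> mA; rewrite -[X in measurable X]setTI; exact: mZ. Qed.

Let prob_Lebesgue (A : set R) (e : R) : measurable A ->
  (lebesgue_measure A <= e%:E)%E ->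
  fine (P (Z @^-1` A)) <= normal_peak s * e.
Proof.
move=> mA Ae; rewrite -lee_fin fineK ?fin_num_measure//; last exact: mpre.
rewrite ZN// /normal_prob.
apply: (@le_trans _ _ (\int[lebesgue_measure]_(x in A) (normal_peak s)%:E)%E).
  apply: ge0_le_integral => //.
  - by move=> x _; rewrite lee_fin normal_pdf_ge0.
  - apply/measurable_EFinP; apply: measurable_funTS; exact: measurable_normal_pdf.
  - by move=> x _; rewrite lee_fin normal_pdf_ub.
by rewrite integral_cst// EFinM lee_wpmul2l// lee_fin normal_peak_ge0.
Qed.

Let tail (e : R) : 0 < e -> exists2 L : R, 0 < L &
  fine (P [set w | L <= `|Z w|]) <= e.
Proof.
move=> e0; have L2Z : L2 P Z.
  suff : L2 P (fun w => (Z w - m) + m) by under eq_fun do rewrite subrK.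
  by apply: L2D; [exact: (L2_normal_sub s0 mZ ZN)|exact: L2_cst].
have L1Z : L1 P (fun w => `|Z w|) by exact/L1_norm/L2_L1.
pose L := (Ex P (fun w => `|Z w|) + 1) / e.
have E0 : 0 <= Ex P (fun w => `|Z w|) by exact: Ex_ge0.
have L0 : 0 < L by rewrite divr_gt0// ltr_wpDl.
exists L => //; apply: le_trans (markov_ineq L0 L1Z _) _ => //.
by rewrite /L invf_div mulrAC ler_pdivrMr ?ltr_wpDl// ler_pM2l// lerDl.
Qed.

(** Lusin's theorem gives a compact [K] in [-L, L] on which [g] is continuous, Tietze's theorem a
    bounded continuous extension [G], and [trig_poly_approx] a polynomial close to [G] on [-L, L]
    and bounded everywhere. The bounded normal density converts the Lebesgue measure of the
    exceptional set into probability. *)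
Let approx_bounded (g : R -> R) (M e : R) : measurable_fun setT g ->
  (forall x, `|g x| <= M) -> 0 < e ->
  exists2 p, trig_poly p & Ex P (fun w => (g (Z w) - p (Z w)) ^+ 2) <= e.
Proof.
move=> mg gM e0.
have M0 : 0 <= M by rewrite (le_trans _ (gM 0)).
pose M' := M + 1.
have M'0 : 0 < M' by rewrite ltr_wpDl.
(* Off [K] the squared error is at most 4 M'^2 and the probability at most 2 e1, which contributes 2
   e / 3; the points of [K] contribute e / 3. *)
pose e1 := e / (12 * M' ^+ 2).
have M'2 : 0 < M' ^+ 2 by rewrite exprn_gt0.
have e10 : 0 < e1 by rewrite divr_gt0// mulr_gt0.
have [L L0 tailL] := tail e10.
pose A := `[- L, L]%classic : set R.
have mA : measurable A by exact: measurable_itv.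
have finA : (lebesgue_measure A < +oo)%E.
  by rewrite lebesgue_measure_itv /=; case: ifPn => _; rewrite ?ltry// -EFinB ltry.
have pk := normal_peak_gt0 s0.
have e20 : 0 < e1 / normal_peak s by rewrite divr_gt0.
have [K [cK KA AK gK]] := measurable_almost_continuous mA finA e20
  (measurable_funTS mg).
have clK : closed K by apply: compact_closed => //; exact: Rhausdorff.
have mK : measurable K by exact: closed_measurable.
have [G [gG cG GM]] := continuous_bounded_extension pseudometric_normal clK M'0 gK
  (fun x _ => le_trans (gM x) (ltW (ltr_pwDr ltr01 (lexx M)))).
have [e4 e40 e4e] : exists2 e4 : R, 0 < e4 & e4 ^+ 2 <= e / 3.
  exists (Num.min 1 (e / 3)); first by rewrite lt_min ltr01 divr_gt0.
  have h : 0 < Num.min 1 (e / 3) by rewrite lt_min ltr01 divr_gt0.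
  rewrite expr2 (@le_trans _ _ (1 * Num.min 1 (e / 3)))//.
    by apply: ler_wpM2r; [exact: ltW|rewrite ge_min lexx].
  by rewrite mul1r ge_min lexx orbT.
have [p [tp pM pG]] := trig_poly_approx cG GM L0 e40.
exists p => //.
have mp := measurable_trig_poly tp.
have bnd w : (g (Z w) - p (Z w)) ^+ 2 <=
    e / 3 + 4 * M' ^+ 2 * \1_(Z @^-1` (~` K)) w.
  rewrite indicE; case: (boolP (w \in _)) => [_|]; last first.
    rewrite notin_setE /= => /contrapT KZ.
    rewrite mulr0 addr0 gG ?inE// (le_trans _ e4e)// -sqr_abs lerXn2r ?nnegrE ?(ltW e40)//.
    rewrite distrC; apply: pG.
    by have := KA _ KZ; rewrite /A /= in_itv/= ler_norml.
  rewrite mulr1 -[leLHS]add0r lerD ?divr_ge0 ?(ltW e0)//.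
  have -> : 4 * M' ^+ 2 = (2 * M') ^+ 2 by ring.
  rewrite -sqr_abs lerXn2r ?nnegrE ?mulr_ge0 ?(ltW M'0)//.
  rewrite (le_trans (ler_normB _ _))// mulr2n mulrDl mul1r lerD//.
  by rewrite (le_trans (gM _))// lerDl.
have mKc : measurable (Z @^-1` (~` K)) by apply: mpre; exact: measurableC.
have bgp : L2 P (fun w => g (Z w) - p (Z w)).
  apply: L2B; [apply: (@L2_bounded _ _ _ _ _ M)|apply: (@L2_bounded _ _ _ _ _ M')] => //.
  - exact: (measurableT_comp mg mZ).
  - exact: (measurableT_comp mp mZ).
apply: (@le_trans _ _ (Ex P (fun w => e / 3 + 4 * M' ^+ 2 * \1_(Z @^-1` (~` K)) w))).
  apply: Ex_le => //; first by case: bgp.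
  by apply: L1D; [exact: L1_cst|apply: L1Z; exact: L1_indic].
rewrite ExD; [|exact: L1_cst|by apply: L1Z; exact: L1_indic].
rewrite Ex_cst ExZ ?Ex_indic//; last exact: L1_indic.
have PK : fine (P (Z @^-1` (~` K))) <= e1 + e1.
  have mAK : measurable (A `\` K) by exact: measurableD.
  have mt : measurable [set w | L <= `|Z w|].
    rewrite -[X in measurable X]setTI; apply: measurable_fun_le => //.
    exact: measurableT_comp.
  apply: (@le_trans _ _ (fine (P (Z @^-1` (A `\` K))) + fine (P [set w | L <= `|Z w|]))).
    rewrite -fineD ?fin_num_measure//; last exact: mpre.
    rewrite fine_le ?fin_numD ?fin_num_measure//; try exact: mpre.
    apply: le_trans (measureU2 _ (mpre mAK) mt).
    apply: le_measure; rewrite ?inE//; first by apply: measurableU => //; exact: mpre.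
    move=> w /= nK; have [AZ|nA] := pselect (A (Z w)); first by left.
    right => /=; move: nA; rewrite /A /= in_itv/= -ler_norml => /negP.
    by rewrite -ltNge => /ltW.
  rewrite lerD// (le_trans (prob_Lebesgue mAK (ltW AK)))//.
  by rewrite mulrC divfK// gt_eqF.
apply: (@le_trans _ _ (e / 3 + 4 * M' ^+ 2 * (e1 + e1))).
  by rewrite lerD2l ler_wpM2l// mulr_ge0// ltW.
have -> : 4 * M' ^+ 2 * (e1 + e1) = e * (2 / 3).
  by rewrite /e1; field; rewrite gt_eqF.
lra.
Qed.

(** [f] is set to 0 where |f| > n, at a small cost by dominated convergence, and the bounded case
    applies. Two errors of e / 4 add up to e because (x + y)^2 <= 2 x^2 + 2 y^2. *)
Lemma trig_poly_dense (f : R -> R) (e : R) : measurable_fun setT f ->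
  L2 P (fun w => f (Z w)) -> 0 < e ->
  exists2 p, trig_poly p & Ex P (fun w => (f (Z w) - p (Z w)) ^+ 2) <= e.
Proof.
move=> mf Lf e0.
pose B n := [set x | `|f x| <= n%:R].
have mB n : measurable (B n).
  rewrite /B -[X in measurable X]setTI; apply: measurable_fun_le => //.
  exact: measurableT_comp.
pose g n x := f x * \1_(B n) x.
have mg n : measurable_fun setT (g n) by exact: measurable_funM.
have gn n x : `|g n x| <= n%:R.
  rewrite /g indicE; case: (boolP (x \in _)) => [|_]; last by rewrite mulr0 normr0.
  by rewrite inE /B /= mulr1.
have cvg0 : Ex P (fun w => (f (Z w) - g n (Z w)) ^+ 2) @[n --> \oo] --> (0 : R).
  rewrite -(Ex_cst P (0:R)); apply: (@Ex_dominated _ _ _ _ _ _ (fun w => f (Z w) ^+ 2)).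
  - move=> n; apply: measurable_funX; apply: measurable_funB.
      exact: (measurableT_comp mf mZ).
    exact: (measurableT_comp (mg n) mZ).
  - by case: Lf.
  - move=> n w; rewrite ger0_norm ?sqr_ge0// -sqr_abs -[leRHS]sqr_abs.
    rewrite lerXn2r ?nnegrE// /g indicE.
    by case: (_ \in _); rewrite ?mulr1 ?subrr ?normr0// mulr0 subr0.
  - move=> w; apply: cvg_near_cst; near=> n.
    rewrite /g indicE mem_set ?mulr1 ?subrr ?expr0n// /B /=.
    by near: n; exact: nbhs_infty_ger.
have e40 : 0 < e / 4 by rewrite divr_gt0.
have /cvgrPdist_le /(_ _ e40) := cvg0; move=> [n _ /(_ n (leqnn n))].
rewrite sub0r normrN => /(le_trans (ler_norm _)) hn.
have [p tp hp] := approx_bounded (mg n) (gn n) e40.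
exists p => //; have mp := measurable_trig_poly tp.
have Lg : L2 P (fun w => g n (Z w)).
  by apply: (@L2_bounded _ _ _ _ _ n%:R) => //; exact: (measurableT_comp (mg n) mZ).
have [Mp hMp] : exists Mp, forall x, `|p x| <= Mp.
  case: tp => s' ->; elim: s' => [|i s' [M' hM']].
    by exists 0 => x; rewrite /trig_sum big_nil normr0.
  exists (`|i.1.1| + M') => x; rewrite /trig_sum big_cons.
  rewrite (le_trans (ler_normD _ _))// lerD//; last exact: hM'.
  by rewrite normrM ler_piMr// cos_max.
have Lp : L2 P (fun w => p (Z w)).
  by apply: (@L2_bounded _ _ _ _ _ Mp) => //; exact: (measurableT_comp mp mZ).
have [_ L1a] := L2B Lf Lg; have [_ L1b] := L2B Lg Lp; have [_ L1c] := L2B Lf Lp.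
apply: (@le_trans _ _ (Ex P (fun w => 2 * (f (Z w) - g n (Z w)) ^+ 2 +
   2 * (g n (Z w) - p (Z w)) ^+ 2))).
  apply: Ex_le => //; first by apply: L1D; exact: L1Z.
  by move=> w; have := sqr_ge0 ((f (Z w) - g n (Z w)) - (g n (Z w) - p (Z w))); lra.
rewrite ExD; [|exact: L1Z|exact: L1Z].
by rewrite !ExZ//; lra.
Unshelve. all: by end_near. Qed.

End trig_density.

(** * Extension to square integrable functions *)

Section gebelein.
Context d (T : measurableType d) (R : realType) (P : probability T R)
  (X Y : T -> R) (m v r : R).
Hypotheses (mX : measurable_fun setT X) (mY : measurable_fun setT Y).
Hypotheses (v0 : 0 < v) (r1 : `|r| <= 1).
Hypotheses (XN : normal_rv P X m v) (YN : normal_rv P Y m v).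
Hypothesis XYN : forall a b, normal_rv P (fun w => a * X w + b * Y w)
  (a * m + b * m) (v * (a ^+ 2 + b ^+ 2 + 2 * a * b * r)).

Let XY A : measurable A -> P (X @^-1` A) = P (Y @^-1` A).
Proof. by move=> mA; rewrite XN.2// YN.2. Qed.

Let s0 : Num.sqrt v != 0.
Proof. by rewrite sqrtr_eq0 -ltNge. Qed.

Let XN' A : measurable A -> P (X @^-1` A) = normal_prob m (Num.sqrt v) A.
Proof. by move=> mA; rewrite XN.2// gt_eqF. Qed.

(** Cauchy-Schwarz in the form by which [f] is exchanged for its approximation, one factor at a
    time. *)
Let Ex_diff (f g : T -> R) : L2 P f -> L2 P g -> forall e, 0 <= e ->
  Ex P (fun w => (f w - g w) ^+ 2) <= e ^+ 2 ->
  forall h, L2 P h -> forall H, 0 <= H -> Ex P (fun w => h w ^+ 2) <= H ^+ 2 ->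
  `|Ex P (fun w => f w * h w) - Ex P (fun w => g w * h w)| <= e * H.
Proof.
move=> Lf Lg e e0 fg h Lh H H0 hH.
rewrite -ExB; [|exact: L1M|exact: L1M].
under eq_Rintegral do rewrite -mulrBl.
have Lfg := L2B Lf Lg.
apply: le_trans (Ex_norm (L1M Lfg Lh)) _.
apply: le_trans (cauchy_schwarz_norm Lfg Lh) _.
apply: ler_pM => //.
- by rewrite -(ger0_norm e0) -sqrtr_sqr ler_sqrt// sqr_ge0.
- by rewrite -(ger0_norm H0) -sqrtr_sqr ler_sqrt// sqr_ge0.
Qed.

Theorem gebelein (f : R -> R) : measurable_fun setT f ->
  L2 P (fun w => f (X w)) ->
  `|Ex P (fun w => f (X w) * f (Y w)) - Ex P (fun w => f (X w)) ^+ 2| <=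
  `|r| * Ex P (fun w => f (X w) ^+ 2).
Proof.
move=> mf LfX.
have mf2 (g : R -> R) : measurable_fun setT g -> measurable_fun setT (fun x => g x ^+ 2).
  by move=> mg; exact: measurable_funX.
have LfY : L2 P (fun w => f (Y w)).
  split; first exact: (measurableT_comp mf mY).
  have [_] := LfX; apply: (same_law_L1 (f := fun x => f x ^+ 2) mY mX) => //.
  - by move=> A mA; rewrite XY.
  - exact: mf2.
set F := Ex P (fun w => f (X w) ^+ 2).
have F0 : 0 <= F by apply: Ex_ge0 => w; exact: sqr_ge0.
pose N := Num.sqrt F.
have NF : N ^+ 2 = F by rewrite sqr_sqrtr.
have N0 : 0 <= N by exact: sqrtr_ge0.
(* Exchanging [f] for [p] costs e N and e (N + e) in the product moment, e (2 N + e) in the squared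
   mean and again in the second moment: 6 N e + 3 e^2 in all. *)
suff key e : 0 < e -> e <= 1 ->
  `|Ex P (fun w => f (X w) * f (Y w)) - Ex P (fun w => f (X w)) ^+ 2| <=
  `|r| * F + 3 * (2 * N + 1) * e.
  apply/ler_addgt0Pr => e e0.
  pose C := 3 * (2 * N + 1).
  have C0 : 0 < C by rewrite /C; lra.
  have e'0 : 0 < Num.min 1 (e / C) by rewrite lt_min ltr01 divr_gt0.
  apply: le_trans (key _ e'0 _) _; first by rewrite ge_min lexx.
  by rewrite lerD2l -/C mulrC -ler_pdivlMr// ge_min lexx orbT.
move=> e0 e1.
have [p tp hp] := trig_poly_dense s0 mX XN' mf LfX (exprn_gt0 2 e0).
have mp := measurable_trig_poly tp.
have LpX : L2 P (fun w => p (X w)).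
  have [s ->] := tp; apply: L2_sum => i; apply: L2Z.
  apply: (@L2_bounded _ _ _ _ _ 1) => [|w]; last exact: cos_max.
  apply: measurableT_comp; first exact: measurable_cos.
  by apply: measurable_funD => //; exact: measurable_funM.
have LpY : L2 P (fun w => p (Y w)).
  split; first exact: (measurableT_comp mp mY).
  have [_] := LpX; apply: (same_law_L1 (f := fun x => p x ^+ 2) mY mX) => //.
  - by move=> A mA; rewrite XY.
  - exact: mf2.
have hpY : Ex P (fun w => (f (Y w) - p (Y w)) ^+ 2) <= e ^+ 2.
  apply: le_trans hp; rewrite le_eqVlt; apply/orP; left; apply/eqP/esym.
  apply: (same_law_Ex (f := fun x => (f x - p x) ^+ 2) mX mY) => //.
  exact: mf2 (measurable_funB mf mp).
have FY : Ex P (fun w => f (Y w) ^+ 2) <= N ^+ 2.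
  rewrite NF le_eqVlt; apply/orP; left; apply/eqP/esym.
  by apply: (same_law_Ex (f := fun x => f x ^+ 2) mX mY) => //; exact: mf2.
have PF : Ex P (fun w => p (X w) ^+ 2) <= (N + e) ^+ 2.
  have h : Ex P (fun w => p (X w) ^+ 2) = Ex P (fun w => (f (X w) - p (X w)) ^+ 2)
      + F - 2 * Ex P (fun w => (f (X w) - p (X w)) * f (X w)).
    have Ld := L2B LfX LpX.
    have i1 : L1 P (fun w => (f (X w) - p (X w)) ^+ 2) by case: Ld.
    have i2 : L1 P (fun w => f (X w) ^+ 2) by case: LfX.
    have i3 := L1M Ld LfX.
    rewrite -ExZ// -ExD// -ExB; [|exact: L1D|exact: L1Z].
    by apply: eq_Rintegral => w _; ring.
  have := Ex_diff LfX LpX (ltW e0) hp LfX N0 _; rewrite NF => /(_ (lexx _)).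
  rewrite -ExB; [|exact: L1M|exact: L1M].
  under [X in `|X| <= _ -> _]eq_Rintegral do rewrite -mulrBl.
  rewrite ler_norml => /andP[h1 h2]; rewrite h -NF; lra.
have geb := gebelein_trig (ltW v0) r1 mX mY (normal_rv_cos mX XN) _ tp.
have {}geb : `|Ex P (fun w => p (X w) * p (Y w)) - Ex P (fun w => p (X w)) ^+ 2| <=
   `|r| * Ex P (fun w => p (X w) ^+ 2).
  apply: geb => a b th.
  have mab : measurable_fun setT (fun w => a * X w + b * Y w).
    by apply: measurable_funD; exact: measurable_funM.
  have := normal_rv_cos mab (XYN a b) 1 th.
  by under eq_Rintegral do rewrite mul1r; rewrite mul1r expr1n mul1r.
have Ne0 : 0 <= N + e by rewrite addr_ge0// ltW.
have b1 : `|Ex P (fun w => f (X w) * f (Y w)) - Ex P (fun w => p (X w) * f (Y w))| <= e * N.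
  exact: (Ex_diff LfX LpX (ltW e0) hp LfY N0 FY).
have b2 : `|Ex P (fun w => f (Y w) * p (X w)) - Ex P (fun w => p (Y w) * p (X w))| <= e * (N + e).
  exact: (Ex_diff LfY LpY (ltW e0) hpY LpX Ne0 PF).
have b3 : `|Ex P (fun w => f (X w)) - Ex P (fun w => p (X w))| <= e.
  have h := Ex_diff LfX LpX (ltW e0) hp (L2_cst P 1) ler01.
  move: h; rewrite Ex_cst expr1n => /(_ (lexx _)).
  under eq_Rintegral do rewrite mulr1.
  by under [X in `|_ - X| <= _ -> _]eq_Rintegral do rewrite mulr1; rewrite mulr1.
have b4 : `|Ex P (fun w => f (X w))| <= N.
  have := Ex_sqr_le LfX; rewrite -/F -NF -sqr_abs.
  by rewrite ler_sqr ?nnegrE.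
have b5 : `|Ex P (fun w => p (X w))| <= N + e.
  have /le_trans/(_ PF) := Ex_sqr_le LpX; rewrite -sqr_abs.
  by rewrite ler_sqr ?nnegrE.
have b6 : `|Ex P (fun w => p (X w) * p (X w)) - Ex P (fun w => f (X w) * p (X w))| <= e * (N + e).
  by rewrite distrC; exact: (Ex_diff LfX LpX (ltW e0) hp LpX Ne0 PF).
have b7 : `|Ex P (fun w => p (X w) * f (X w)) - Ex P (fun w => f (X w) * f (X w))| <= e * N.
  rewrite distrC; apply: (Ex_diff LfX LpX (ltW e0) hp LfX N0).
  by rewrite NF.
have sw (a b : T -> R) : Ex P (fun w => a w * b w) = Ex P (fun w => b w * a w).
  by apply: eq_Rintegral => w _; rewrite mulrC.
move: b1 b2 b6 b7.
rewrite (sw (f \o Y) (p \o X)) (sw (p \o Y) (p \o X)) (sw (p \o X) (f \o X)) /=.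
have -> : Ex P (fun w => p (X w) * p (X w)) = Ex P (fun w => p (X w) ^+ 2).
  by apply: eq_Rintegral => w _; rewrite expr2.
set ff := Ex P (fun w => f (X w) * f (Y w)); set pf := Ex P (fun w => p (X w) * f (Y w)).
set pp := Ex P (fun w => p (X w) * p (Y w)).
set p2 := Ex P (fun w => p (X w) ^+ 2) in PF geb *.
set fp2 := Ex P (fun w => f (X w) * p (X w)).
have -> : Ex P (fun w => f (X w) * f (X w)) = F.
  by apply: eq_Rintegral => w _; rewrite expr2.
set f1 := Ex P (fun w => f (X w)) in b3 b4 *.
set p1 := Ex P (fun w => p (X w)) in b3 b5 geb *.
rewrite -/pp in geb.
move=> b1 b2 b6 b7.
have h1 : `|p1 ^+ 2 - f1 ^+ 2| <= e * (2 * N + e).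
  rewrite subr_sqr normrM; apply: ler_pM => //; first by rewrite distrC.
  by rewrite (le_trans (ler_normD _ _))//; lra.
have h2 : p2 <= F + e * (2 * N + e).
  move: b6 b7; rewrite !ler_norml => /andP[_ x1] /andP[_ x2]; lra.
have h3 : `|r| * p2 <= `|r| * F + e * (2 * N + e).
  have pos : 0 <= e * (2 * N + e) by rewrite mulr_ge0// ?addr_ge0 ?mulr_ge0// ltW.
  apply: (@le_trans _ _ (`|r| * (F + e * (2 * N + e)))); first by rewrite ler_wpM2l.
  by rewrite mulrDr lerD2l ler_piMl.
have -> : ff - f1 ^+ 2 = (ff - pf) + (pf - pp) + (pp - p1 ^+ 2) + (p1 ^+ 2 - f1 ^+ 2) by ring.
have t : `|(ff - pf) + (pf - pp) + (pp - p1 ^+ 2) + (p1 ^+ 2 - f1 ^+ 2)| <=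
  `|ff - pf| + `|pf - pp| + `|pp - p1 ^+ 2| + `|p1 ^+ 2 - f1 ^+ 2|.
  by do 3 (apply: (le_trans (ler_normD _ _)); rewrite lerD2r).
apply: (le_trans t).
have : e * (2 * N + e) <= e * (2 * N + 1) by rewrite ler_pM2l// lerD2l.
have : e * e <= e * 1 by rewrite ler_pM2l.
lra.
Qed.

End gebelein.

(** * Double sums of slowly decaying sequences *)

Section power_sequences.
Context (R : realType).
Implicit Types (p b c l : R) (x g : nat -> R).

Lemma cvg_powRN p : 0 < p -> (n%:R : R) `^ (- p) @[n --> \oo] --> (0 : R).
Proof.
move=> p0; apply/cvgrPdist_le => e e0; near=> n.
have n0 : 0 < n%:R :> R by rewrite ltr0n; near: n; exists 1%N.
rewrite sub0r normrN ger0_norm ?powR_ge0// powRN -[leRHS]invrK.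
rewrite lef_pV2 ?posrE ?powR_gt0 ?invr_gt0//.
have -> : e^-1 = (e^-1 `^ p^-1) `^ p by rewrite -powRrM mulVf ?gt_eqF// powRr1// invr_ge0 ltW.
apply: ge0_ler_powR; rewrite ?nnegrE ?powR_ge0 ?ler0n ?ltW//.
by near: n; exact: nbhs_infty_gtr.
Unshelve. all: by end_near. Qed.

(** The derivative of x^p at 1 along the sequence h = 1 / n, since (n + 1)^p - n^p = n^p ((1 + h)^p
    - 1). *)
Lemma powR_increment p : 0 < p ->
  ((n.+1%:R `^ p - n%:R `^ p) / n%:R `^ (p - 1) : R) @[n --> \oo] --> p.
Proof.
move=> p0.
have [dp /= dpE] := @is_derive1_powR R p 1 ltr01.
rewrite powR1 mulr1 in dpE.
have : h^-1 *: ((1 + h) `^ p - 1 `^ p) @[h --> 0^'] --> p.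
  rewrite -[X in _ --> X]dpE /derive.
  have := dp; rewrite /derivable => /cvg_ex[l hl].
  rewrite (cvg_lim _ hl)//; move: hl; apply: cvg_trans; apply: near_eq_cvg.
  near=> h => /=; congr (_ *: (_ - _)).
  by rewrite /GRing.scale /= mulr1 addrC.
move=> /cvgr_dnbhsP /(_ (fun n => n.+1%:R^-1)) H.
have {}H := H (conj _ (@cvg_harmonic R)).
rewrite -cvg_shiftS.
have : n.+1%:R^-1^-1 *: ((1 + n.+1%:R^-1) `^ p - 1 `^ p) @[n --> \oo] --> p.
  by apply: H => n; rewrite invr_eq0 pnatr_eq0.
apply: cvg_trans; apply: near_eq_cvg; near=> n.
rewrite invrK /GRing.scale /= powR1.
have n0 : 0 < n.+1%:R :> R by rewrite ltr0n.
have -> : n.+2%:R `^ p = n.+1%:R `^ p * (1 + n.+1%:R^-1) `^ p :> R.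
  rewrite -powRM ?ler0n ?addr_ge0 ?invr_ge0 ?ler0n//; congr (_ `^ _).
  by rewrite mulrDr mulr1 mulfV ?gt_eqF// natr1.
rewrite -(mulr_powRB1 (ltW n0) p0).
by field; rewrite gt_eqF ?powR_gt0.
Unshelve. all: by end_near. Qed.

(** Stolz-Cesaro with denominators n^p, their increments replaced by the equivalent p n^(p - 1).
    Subtracting (l / p) n^p reduces to the limit 0. *)
Lemma stolz_powR p l x : 0 < p ->
  ((x n.+1 - x n) / n%:R `^ (p - 1)) @[n --> \oo] --> l ->
  (x n / n%:R `^ p) @[n --> \oo] --> l / p.
Proof.
move=> p0 dx.
have dy := powR_increment p0.
pose z n := x n - l / p * n%:R `^ p.
have dz : ((z n.+1 - z n) / n%:R `^ (p - 1)) @[n --> \oo] --> (0 : R).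
  have : (x n.+1 - x n) / n%:R `^ (p - 1) -
    l / p * ((n.+1%:R `^ p - n%:R `^ p) / n%:R `^ (p - 1)) @[n --> \oo] --> l - l / p * p.
    by apply: cvgB => //; apply: cvgM => //; exact: cvg_cst.
  rewrite divfK ?gt_eqF// subrr; apply: cvg_trans; apply: near_eq_cvg; near=> n.
  by rewrite /z; ring.
suff zc : z n / n%:R `^ p @[n --> \oo] --> (0 : R).
  have : z n / n%:R `^ p + l / p @[n --> \oo] --> 0 + l / p.
    by apply: cvgD => //; exact: cvg_cst.
  rewrite add0r; apply: cvg_trans; apply: near_eq_cvg; near=> n.
  have n0 : 0 < n%:R :> R by rewrite ltr0n; near: n; exists 1%N.
  by rewrite /z; field; rewrite !gt_eqF ?powR_gt0.
apply/cvgrPdist_le => e e0.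
(* Increments of n^p eventually exceed (p / 2) n^(p - 1), so (e p / 4) n^(p - 1) is at most e / 2
   times such an increment, and the bounds telescope. *)
have e1 : 0 < e * p / 4 by rewrite divr_gt0// mulr_gt0.
have /cvgrPdist_le /(_ _ e1) [N1 _ hz] := dz.
have p2 : 0 < p / 2 by rewrite divr_gt0.
have /cvgrPdist_le /(_ _ p2) [N2 _ hy] := dy.
pose N := maxn 1 (maxn N1 N2).
have step n : (N <= n)%N -> `|z n.+1 - z n| <= e / 2 * (n.+1%:R `^ p - n%:R `^ p).
  move=> Nn.
  have n1 : (1 <= n)%N by rewrite (leq_trans _ Nn)// leq_max leqnn.
  have nN1 : (N1 <= n)%N by rewrite (leq_trans _ Nn)// !leq_max leqnn orbT.
  have nN2 : (N2 <= n)%N by rewrite (leq_trans _ Nn)// !leq_max leqnn !orbT.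
  have w0 : 0 < n%:R `^ (p - 1) :> R by rewrite powR_gt0// ltr0n.
  have := hz n nN1; rewrite sub0r normrN normrM normfV (gtr0_norm w0) ler_pdivrMr//.
  move=> /le_trans; apply.
  have := hy n nN2; rewrite ler_norml => /andP[_]; rewrite lerBlDr -lerBlDl.
  rewrite ler_pdivlMr// => h.
  have : e / 2 * ((p - p / 2) * n%:R `^ (p - 1)) <= e / 2 * (n.+1%:R `^ p - n%:R `^ p).
    by rewrite ler_pM2l ?divr_gt0.
  by apply: le_trans; rewrite le_eqVlt; apply/orP; left; apply/eqP; field.
have tele k : `|z (N + k)%N - z N| <= e / 2 * ((N + k)%:R `^ p - N%:R `^ p).
  elim: k => [|k ih]; first by rewrite addn0 !subrr normr0 mulr0.
  rewrite addnS; have := step (N + k)%N (leq_addr _ _) => h.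
  have -> : z (N + k).+1 - z N = (z (N + k).+1 - z (N + k)%N) + (z (N + k)%N - z N) by ring.
  rewrite (le_trans (ler_normD _ _))// (le_trans (lerD h ih))//.
  by rewrite -mulrDr addrA subrK.
have zN : `|z N| * n%:R `^ (- p) @[n --> \oo] --> `|z N| * 0.
  by apply: cvgM; [exact: cvg_cst|exact: cvg_powRN].
rewrite mulr0 in zN.
have e2 : 0 < e / 2 by rewrite divr_gt0.
have /cvgrPdist_le /(_ _ e2) [N3 _ hzN] := zN.
near=> n.
have Nn : (N <= n)%N by near: n; exists N.
have N3n : (N3 <= n)%N by near: n; exists N3.
have n0 : 0 < n%:R :> R.
  by rewrite ltr0n (leq_trans _ Nn)// leq_max leqnn.
have w0 : 0 < n%:R `^ p :> R by rewrite powR_gt0.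
rewrite sub0r normrN normrM normfV (gtr0_norm w0) ler_pdivrMr//.
have := tele (n - N)%N; rewrite subnKC// => h.
have h3 := hzN n N3n; rewrite sub0r normrN normrM normr_id (gtr0_norm (powR_gt0 _ n0)) in h3.
rewrite powRN ler_pdivrMr// in h3.
have -> : z n = (z n - z N) + z N by rewrite subrK.
rewrite (le_trans (ler_normD _ _))// [e]splitr mulrDl lerD//.
by rewrite (le_trans h)// ler_pM2l// lerBlDr lerDl powR_ge0.
Unshelve. all: by end_near. Qed.

(** For [g] the autocovariance of a stationary sequence this is the variance of the sum of n
    terms. *)
Definition toeplitz_sum g n : R :=
  \sum_(1 <= s < n.+1) \sum_(1 <= t < n.+1) g `|s%:Z - t%:Z|%N.

(** The new row and the new column each run over the lags 1, ..., n, and meet in the corner of lag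
    0. *)
Lemma toeplitz_sumS g n :
  toeplitz_sum g n.+1 = toeplitz_sum g n + (g 0%N + 2 * \sum_(1 <= k < n.+1) g k).
Proof.
have row : \sum_(1 <= t < n.+1) g `|n.+1%:Z - t%:Z|%N = \sum_(1 <= k < n.+1) g k.
  rewrite big_nat_rev /= [LHS]big_nat [RHS]big_nat; apply: eq_bigr => t /andP[t1 tn].
  congr g; lia.
have col : \sum_(1 <= s < n.+1) g `|s%:Z - n.+1%:Z|%N = \sum_(1 <= k < n.+1) g k.
  by rewrite -row; apply: eq_bigr => s _; congr g; lia.
rewrite /toeplitz_sum big_nat_recr //=.
rewrite [X in _ + X]big_nat_recr //= row subrr absz0.
rewrite (eq_bigr (fun s => \sum_(1 <= t < n.+1) g `|s%:Z - t%:Z|%N + g `|s%:Z - n.+1%:Z|%N)).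
  rewrite big_split /=.
  by rewrite col; ring.
by move=> s _; rewrite big_nat_recr.
Qed.

(** Stolz-Cesaro twice: for the sum over lags, of order n^(1 - b), and for the double sum, whose
    increments are twice that sum. The case c = 0 is the little-o version used for products of
    correlations. *)
Lemma toeplitz_sum_cvg g b c : 0 < b < 1 -> g n * n%:R `^ b @[n --> \oo] --> c ->
  toeplitz_sum g n / n%:R `^ (2 - b) @[n --> \oo] --> 2 * c / ((1 - b) * (2 - b)).
Proof.
move=> /andP[b0 b1] gc.
have b1' : 0 < 1 - b by lra.
have b2' : 0 < 2 - b by lra.
have inv_cvg p : 0 < p -> (n%:R `^ p)^-1 @[n --> \oo] --> (0 : R).
  by move=> p0; under eq_fun do rewrite -powRN; exact: cvg_powRN.
have S1 : (\sum_(1 <= k < n) g k) / n%:R `^ (1 - b) @[n --> \oo] --> c / (1 - b).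
  apply: stolz_powR => //; apply: cvg_trans gc; apply: near_eq_cvg; near=> n.
  have n1 : (1 <= n)%N by near: n; exists 1%N.
  rewrite big_nat_recr //= addrAC subrr add0r.
  by rewrite (_ : 1 - b - 1 = - b) ?powRN ?invrK//; ring.
have -> : 2 * c / ((1 - b) * (2 - b)) = (0 + 2 * (c / (1 - b)) + 2 * (c * 0)) / (2 - b).
  by field; rewrite !gt_eqF.
apply: stolz_powR => //.
have h : g 0%N * (n%:R `^ (1 - b))^-1 + 2 * ((\sum_(1 <= k < n) g k) / n%:R `^ (1 - b)) +
   2 * (g n * n%:R `^ b * (n%:R `^ 1)^-1) @[n --> \oo] -->
   g 0%N * 0 + 2 * (c / (1 - b)) + 2 * (c * 0).
  apply: cvgD.
    apply: cvgD; first by apply: cvgM; [exact: cvg_cst|exact: inv_cvg].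
    by apply: cvgM; [exact: cvg_cst|exact: S1].
  apply: cvgM; first exact: cvg_cst.
  by apply: cvgM; [exact: gc|exact: inv_cvg].
rewrite mulr0 in h; apply: cvg_trans h; apply: near_eq_cvg; near=> n.
have n1 : (1 <= n)%N by near: n; exists 1%N.
have n0 : 0 < n%:R :> R by rewrite ltr0n.
rewrite toeplitz_sumS big_nat_recr //= [_ - toeplitz_sum g n]addrAC subrr add0r.
have -> : 2 - b - 1 = 1 - b by ring.
have -> : n%:R `^ 1 = n%:R `^ b * n%:R `^ (1 - b) :> R.
  by rewrite -powRD ?(gt_eqF n0) ?implybT//; congr (_ `^ _); ring.
by field; rewrite !gt_eqF ?powR_gt0.
Unshelve. all: by end_near. Qed.

Lemma equiv_powR_cvg g c a : 
  g ~_\oo (fun k : nat => c * k%:R `^ (- a)) ->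
  g n * n%:R `^ a @[n --> \oo] --> c.
Proof.
move=> /eqaddoP h; apply/cvgrPdist_le => e e0.
(* The [+ 1] covers c = 0. *)
have e1 : 0 < e / (`|c| + 1) by rewrite divr_gt0// ltr_wpDl.
have := h _ e1; apply: filterS2 (nbhs_infty_gt 0%N) => n n0' hn.
have n0 : 0 < n%:R :> R by rewrite ltr0n.
have w0 : 0 < n%:R `^ a :> R by rewrite powR_gt0.
have -> : c - g n * n%:R `^ a = - ((g n - c * n%:R `^ (- a)) * n%:R `^ a).
  by rewrite powRN; field; rewrite gt_eqF.
rewrite normrN normrM (gtr0_norm w0) -ler_pdivlMr//.
rewrite (le_trans hn)// normrM powRN normfV (gtr0_norm w0) mulrA.
rewrite ler_pM2r ?invr_gt0// mulrAC ler_pdivrMr ?ltr_wpDl// ler_pM2l//.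
by rewrite lerDl.
Qed.

End power_sequences.

(** * Independence *)

Section independence.
Context d (T : measurableType d) (R : realType) (P : probability T R).

Import HBNNSimple.

Let measurable_indic_comp (W : T -> R) (B : set R) :
  measurable_fun setT W -> measurable B ->
  measurable_fun setT (fun w => \1_B (W w) : R).
Proof.
move=> mW mB; apply: (@measurableT_comp _ _ _ _ _ _ (\1_B : R -> R) _ W) => //.
Qed.

(** [f] is approximated from below by simple functions; boundedness of [U] and [f] allows dominated
    convergence on both sides. *)
Let ext_ge0 (U W : T -> R) (f : R -> R) (K M : R) :
  measurable_fun setT U -> (forall w, `|U w| <= K) -> measurable_fun setT W ->
  (forall B : set R, measurable B ->
    Ex P (fun w => U w * \1_B (W w)) = Ex P U * fine (P (W @^-1` B))) ->
  measurable_fun setT f -> (forall x, 0 <= f x <= M) ->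
  Ex P (fun w => U w * f (W w)) = Ex P U * Ex P (fun w => f (W w)).
Proof.
move=> mU UK mW H mf fM.
have K0 (w : T) : 0 <= K by rewrite (le_trans _ (UK w)).
have mfE : measurable_fun setT (EFin \o f) by exact/measurable_EFinP.
pose h := nnsfun_approx measurableT mfE.
have fx0 y : setT y -> (0 <= (EFin \o f) y)%E.
  by move=> _; rewrite lee_fin; case/andP: (fM y).
have hc x : h n x @[n --> \oo] --> f x.
  have := @cvg_nnsfun_approx _ _ _ _ measurableT _ mfE fx0 x Logic.I.
  by move/fine_cvg.
have hf n x : 0 <= h n x <= f x.
  apply/andP; split; first by [].
  rewrite -(cvg_lim _ (hc x))//; apply: (@nondecreasing_cvgn_le _ (fun n => h n x)).
    by move=> a b ab; exact/lefP/nd_nnsfun_approx.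
  by apply/cvg_ex; eexists; exact: hc.
have mh n : measurable_fun setT (h n) by [].
have mhW n : measurable_fun setT (fun w => h n (W w)) by exact: (measurableT_comp (mh n) mW).
have hM n x : `|h n x| <= M.
  have /andP[h0 h1] := hf n x; rewrite ger0_norm// (le_trans h1)//.
  by case/andP: (fM x).
have c1 : Ex P (fun w => U w * h n (W w)) @[n --> \oo] --> Ex P (fun w => U w * f (W w)).
  apply: (@Ex_dominated _ _ _ _ _ _ (fun=> K * M)).
  - by move=> n; exact: measurable_funM.
  - exact: L1_cst.
  - by move=> n w; rewrite normrM ler_pM.
  - by move=> w; apply: cvgM; [exact: cvg_cst|exact: hc].
have c2 : Ex P U * Ex P (fun w => h n (W w)) @[n --> \oo] --> Ex P U * Ex P (fun w => f (W w)).
  apply: cvgM; first exact: cvg_cst.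
  apply: (@Ex_dominated _ _ _ _ _ _ (fun=> M)).
  - exact: mhW.
  - exact: L1_cst.
  - by move=> n w; exact: hM.
  - by move=> w; exact: hc.
have E n : Ex P (fun w => U w * h n (W w)) = Ex P U * Ex P (fun w => h n (W w)).
  have hE x : h n x = \sum_(y <- finmap.enum_fset (fset_set (range (h n)))) y * \1_(h n @^-1` [set y]) x.
    by rewrite {1}fimfunE fsbig_finite.
  have mB y : measurable (h n @^-1` [set y]) by [].
  have mBW y : measurable (W @^-1` (h n @^-1` [set y])).
    by rewrite -[X in measurable X]setTI; exact: mW.
  have LB y : L1 P (fun w => \1_(h n @^-1` [set y]) (W w)).
    apply: (@L1_bounded _ _ _ _ _ 1).
      exact: measurable_indic_comp.
    by move=> w; rewrite indicE; case: (_ \in _); rewrite ?normr1 ?normr0.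
  have LU y : L1 P (fun w => U w * \1_(h n @^-1` [set y]) (W w)).
    apply: (@L1_bounded _ _ _ _ _ K).
      by apply: measurable_funM => //; exact: measurable_indic_comp.
    move=> w; rewrite normrM indicE; case: (_ \in _); rewrite ?normr1 ?normr0 ?mulr1 ?mulr0//.
    exact: K0 w.
  transitivity (\sum_(y <- finmap.enum_fset (fset_set (range (h n)))) y * (Ex P U * fine (P (W @^-1` (h n @^-1` [set y]))))).
    rewrite (_ : (fun w => U w * h n (W w)) = fun w => \sum_(y <- finmap.enum_fset (fset_set (range (h n)))) y * (U w * \1_(h n @^-1` [set y]) (W w))).
      rewrite Ex_sum => [|y]; last exact: L1Z.
      by apply: eq_bigr => y _; rewrite ExZ// H.
    apply/funext => w; rewrite {1}hE mulr_sumr; apply: eq_bigr => y _.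
    by rewrite mulrCA.
  rewrite (_ : (fun w => h n (W w)) = fun w => \sum_(y <- finmap.enum_fset (fset_set (range (h n)))) y * \1_(h n @^-1` [set y]) (W w)).
    rewrite Ex_sum => [|y]; last exact: L1Z.
    rewrite mulr_sumr; apply: eq_bigr => y _; rewrite ExZ//.
    rewrite mulrCA; congr (_ * (_ * _)).
    by rewrite -(Ex_indic _ (mBW y)).
  by apply/funext => w; exact: hE.
rewrite (_ : (fun n => _) = (fun n => Ex P U * Ex P (fun w => h n (W w)))) in c1.
  exact: (cvg_unique _ c1 c2).
by apply/funext => n; exact: E.
Qed.

(** Factorisation is assumed against indicators of [W] only, and [U] is an arbitrary bounded
    variable. This generality lets the lemma be iterated over several independent variables. *)
Lemma indep_ext (U W : T -> R) (f : R -> R) (K M : R) :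
  measurable_fun setT U -> (forall w, `|U w| <= K) -> measurable_fun setT W ->
  (forall B : set R, measurable B ->
    Ex P (fun w => U w * \1_B (W w)) = Ex P U * fine (P (W @^-1` B))) ->
  measurable_fun setT f -> (forall x, `|f x| <= M) ->
  Ex P (fun w => U w * f (W w)) = Ex P U * Ex P (fun w => f (W w)).
Proof.
move=> mU UK mW H mf fM.
(* Shifting by the bound makes the function nonnegative; linearity undoes the shift. *)
have mfM : measurable_fun setT (fun x => f x + M) by exact: measurable_funD.
have := @ext_ge0 U W (fun x => f x + M) K (M + M) mU UK mW H mfM.
have h x : 0 <= f x + M <= M + M.
  by have := fM x; rewrite ler_norml => /andP[a b]; apply/andP; split; lra.
move=> /(_ h) {h}.
have LU : L1 P U by exact: (L1_bounded P mU UK).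
have mfW : measurable_fun setT (fun w => f (W w)) by exact: (measurableT_comp mf mW).
have Lf : L1 P (fun w => f (W w)) by exact: (@L1_bounded _ _ _ _ _ M).
have LUf : L1 P (fun w => U w * f (W w)) by exact: (@L1M_bounded _ _ _ _ _ _ M).
rewrite ExD//; last exact: L1_cst.
rewrite Ex_cst; under eq_Rintegral do rewrite mulrDr (mulrC _ M).
rewrite ExD//; last exact: L1Z.
by rewrite ExZ// => h; lra.
Qed.

Lemma indep_bounded (V W : T -> R) (f g : R -> R) (K M : R) :
  measurable_fun setT V -> measurable_fun setT W ->
  (forall A B : set R, measurable A -> measurable B ->
    P (V @^-1` A `&` W @^-1` B) = (P (V @^-1` A) * P (W @^-1` B))%E) ->
  measurable_fun setT f -> (forall x, `|f x| <= K) ->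
  measurable_fun setT g -> (forall x, `|g x| <= M) ->
  Ex P (fun w => f (V w) * g (W w)) = Ex P (fun w => f (V w)) * Ex P (fun w => g (W w)).
Proof.
move=> mV mW H mf fK mg gM.
have mpre (Z : T -> R) A : measurable_fun setT Z -> measurable A -> measurable (Z @^-1` A).
  by move=> mZ mA; rewrite -[X in measurable X]setTI; exact: mZ.
have mfV : measurable_fun setT (fun w => f (V w)) by exact: (measurableT_comp mf mV).
apply: (@indep_ext _ _ _ K M) => // B mB.
under eq_Rintegral do rewrite mulrC.
rewrite mulrC.
have mB' : measurable (W @^-1` B) by exact: mpre.
have EB : Ex P (\1_(W @^-1` B) : T -> R) = fine (P (W @^-1` B)) by rewrite Ex_indic.
rewrite -EB.
apply: (@indep_ext (fun w => \1_B (W w)) V f 1 K) => //.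
- exact: measurable_indic_comp.
- by move=> w; rewrite indicE; case: (_ \in _); rewrite ?normr1 ?normr0.
- move=> A mA.
  transitivity (Ex P (\1_(V @^-1` A `&` W @^-1` B) : T -> R)).
    apply: eq_Rintegral => w _; rewrite !indicE -[(W w \in B)]/(w \in W @^-1` B).
    rewrite -[(V w \in A)]/(w \in V @^-1` A) in_setI.
    by case: (w \in V @^-1` A); case: (w \in W @^-1` B); rewrite ?mulr1 ?mulr0.
  have mA' : measurable (V @^-1` A) by exact: mpre.
  rewrite Ex_indic; last exact: measurableI.
  rewrite H// fineM ?fin_num_measure// mulrC.
  by congr (_ * _); rewrite -EB.
Qed.

(** Integrability of the product is part of the conclusion. Truncated variables factor by
    [indep_bounded]; monotone convergence yields integrability, dominated convergence the
    identity. *)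
Lemma indep_L1M (V W : T -> R) : L1 P V -> L1 P W ->
  (forall A B : set R, measurable A -> measurable B ->
    P (V @^-1` A `&` W @^-1` B) = (P (V @^-1` A) * P (W @^-1` B))%E) ->
  L1 P (fun w => V w * W w) /\ Ex P (fun w => V w * W w) = Ex P V * Ex P W.
Proof.
move=> LV LW H.
have mV := L1_meas LV; have mW := L1_meas LW.
pose B (n : nat) := [set x : R | `|x| <= n%:R].
have mB n : measurable (B n).
  by rewrite /B -[X in measurable X]setTI; apply: measurable_fun_le.
pose tr n (x : R) := x * \1_(B n) x.
have mtr n : measurable_fun setT (tr n) by exact: measurable_funM.
have trM n x : `|tr n x| <= n%:R.
  rewrite /tr indicE; case: (boolP (x \in _)) => [|_]; last by rewrite mulr0 normr0.
  by rewrite inE /B /= mulr1.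
have trx n x : `|tr n x| <= `|x|.
  by rewrite /tr normrM ler_piMr// indicE; case: (_ \in _); rewrite ?normr1 ?normr0.
have trc x : tr n x @[n --> \oo] --> x.
  apply: cvg_near_cst; near=> n.
  rewrite /tr indicE mem_set ?mulr1// /B /=.
  by near: n; exact: nbhs_infty_ger.
have mtrZ n (Z : T -> R) : measurable_fun setT Z -> measurable_fun setT (fun w => tr n (Z w)).
  by move=> mZ; exact: (measurableT_comp (mtr n) mZ).
have LVW : L1 P (fun w => V w * W w).
  apply/integrableP; split.
    by apply/measurable_EFinP; exact: measurable_funM.
  have bnd n : (\int[P]_w `|tr n (V w) * tr n (W w)|%:E <=
      (Ex P (fun w => `|V w|) * Ex P (fun w => `|W w|))%:E)%E.
    have mN : measurable_fun setT (fun x => `|tr n x|) by exact: measurableT_comp.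
    have := @indep_bounded V W (fun x => `|tr n x|) (fun x => `|tr n x|) n%:R n%:R mV mW H mN _ mN.
    have h x : `| `|tr n x| | <= n%:R by rewrite normr_id.
    move=> /(_ h h) E.
    have LtV : L1 P (fun w => `|tr n (V w)|).
      by apply/L1_norm/(@L1_bounded _ _ _ _ _ n%:R) => //; exact: mtrZ.
    have LtW : L1 P (fun w => `|tr n (W w)|).
      by apply/L1_norm/(@L1_bounded _ _ _ _ _ n%:R) => //; exact: mtrZ.
    have LtVW : L1 P (fun w => `|tr n (V w) * tr n (W w)|).
      apply: L1_norm; apply: (@L1_bounded _ _ _ _ _ (n%:R * n%:R)).
        by apply: measurable_funM; exact: mtrZ.
      by move=> w; rewrite normrM ler_pM.
    rewrite -[leLHS]fineK ?integrable_fin_num// lee_fin.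
    have -> : fine (\int[P]_w `|tr n (V w) * tr n (W w)|%:E)%E =
       Ex P (fun w => `|tr n (V w)| * `|tr n (W w)|).
      by apply: eq_Rintegral => w _; rewrite normrM.
    rewrite E; apply: ler_pM; rewrite ?Ex_ge0//; apply: Ex_le => //; exact: L1_norm.
  apply: le_lt_trans (_ : _ <= (Ex P (fun w => `|V w|) * Ex P (fun w => `|W w|))%:E)%E (ltry _).
  have mono := @cvg_monotone_convergence _ _ _ P setT measurableT
    (fun n w => (`|tr n (V w) * tr n (W w)|)%:E).
  have mg n : measurable_fun setT (fun w => (`|tr n (V w) * tr n (W w)|)%:E).
    apply/measurable_EFinP; apply: measurableT_comp => //.
    by apply: measurable_funM; exact: mtrZ.
  have {}mono := mono mg _ _.
  have lim_eq w : limn (fun n => (`|tr n (V w) * tr n (W w)|)%:E) = (`|V w * W w|)%:E.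
    apply/cvg_lim => //; apply: cvg_EFin; first exact: nearW.
    by apply: cvg_norm; apply: cvgM; exact: trc.
  have c : (\int[P]_w (`|tr n (V w) * tr n (W w)|)%:E)%E @[n --> \oo] -->
      (\int[P]_w (`|V w * W w|)%:E)%E.
    under [X in _ --> X]eq_integral do rewrite -lim_eq.
    apply: mono => [n w _|w _ a b ab]; first by rewrite lee_fin.
    have trm x : `|tr a x| <= `|tr b x|.
      rewrite /tr !normrM ler_wpM2l// !indicE /B.
      case: (boolP (x \in _)) => [|_]; last by rewrite normr0.
      by rewrite inE /= => h; rewrite mem_set//= (le_trans h)// ler_nat.
    by rewrite lee_fin [leLHS]normrM [leRHS]normrM; apply: ler_pM.
  rewrite -(cvg_lim _ c)//; apply: lime_le; first by apply/cvg_ex; eexists; exact: c.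
  by apply: nearW => n; exact: bnd.
split => //.
have c1 : Ex P (fun w => tr n (V w) * tr n (W w)) @[n --> \oo] --> Ex P (fun w => V w * W w).
  apply: (@Ex_dominated _ _ _ _ _ _ (fun w => `|V w * W w|)).
  - by move=> n; apply: measurable_funM; exact: mtrZ.
  - exact: L1_norm.
  - by move=> n w; rewrite [leLHS]normrM [leRHS]normrM; apply: ler_pM.
  - by move=> w; apply: cvgM; exact: trc.
have c2 : Ex P (fun w => tr n (V w)) * Ex P (fun w => tr n (W w)) @[n --> \oo] --> Ex P V * Ex P W.
  apply: cvgM.
    apply: (@Ex_dominated _ _ _ _ _ _ (fun w => `|V w|)).
    - by move=> n; exact: mtrZ.
    - exact: L1_norm.
    - by move=> n w; exact: trx.
    - by move=> w; exact: trc.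
  apply: (@Ex_dominated _ _ _ _ _ _ (fun w => `|W w|)).
  - by move=> n; exact: mtrZ.
  - exact: L1_norm.
  - by move=> n w; exact: trx.
  - by move=> w; exact: trc.
apply: (cvg_unique _ c1) => //.
apply: cvg_trans c2; apply: near_eq_cvg; near=> n.
by rewrite (@indep_bounded V W (tr n) (tr n) n%:R n%:R).
Unshelve. all: by end_near. Qed.

End independence.

(** * Central limit theorem for moving averages *)

(** Integrates a bound on the derivative; repeated use yields Taylor bounds for sine and cosine with
    crude constants. *)
Lemma MVT_bound (R : realType) (f df : R -> R) (C y : R) :
  (forall x : R, is_derive x 1 f (df x)) -> f 0 = 0 ->
  (forall x, `|x| <= `|y| -> `|df x| <= C) -> `|f y| <= C * `|y|.
Proof.
move=> dfE f0 dfC.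
have cf : continuous f.
  by move=> x; apply: differentiable_continuous; apply/derivable1_diffP; case: (dfE x).
have [y0|y0|<-] := ltgtP 0 y; last by rewrite f0 !normr0 mulr0.
- have [c] := @MVT _ f df _ _ y0 (fun x _ => dfE x) (continuous_subspaceT cf).
  rewrite in_itv /= => /andP[c0 cy]; rewrite f0 !subr0 => ->.
  rewrite normrM ler_wpM2r//; apply: dfC.
  by rewrite !gtr0_norm ?ltW.
- have [c] := @MVT _ f df _ _ y0 (fun x _ => dfE x) (continuous_subspaceT cf).
  rewrite in_itv /= => /andP[c0 cy]; rewrite f0 !sub0r => fy.
  rewrite -(normrN (f y)) fy normrM normrN ler_wpM2r//; apply: dfC.
  by rewrite !ltr0_norm// lerN2 ltW.
Qed.

Section trig_taylor.
Context (R : realType).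
Implicit Types y : R.

Lemma norm_sin_le y : `|sin y| <= `|y|.
Proof.
rewrite -[leRHS]mul1r; apply: (@MVT_bound _ sin cos); first exact: sin0.
by move=> x _; exact: cos_max.
Qed.

Lemma norm_cosB1_le y : `|cos y - 1| <= `|y| ^+ 2.
Proof.
rewrite expr2; apply: (@MVT_bound _ (fun y => cos y - 1) (fun y => - sin y)).
- by move=> x; apply: is_derive_eq; rewrite subr0.
- by rewrite cos0 subrr.
- by move=> x xy; rewrite normrN (le_trans (norm_sin_le x)).
Qed.

Lemma norm_sinB_le y : `|sin y - y| <= `|y| ^+ 3.
Proof.
rewrite [leRHS]exprSr; apply: (@MVT_bound _ (fun y => sin y - y) (fun y => cos y - 1)).
- by rewrite sin0 subrr.
- move=> x xy; rewrite (le_trans (norm_cosB1_le x))// lerXn2r// nnegrE//.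
Qed.

Lemma norm_cosB_le y : `|cos y - 1 + y ^+ 2 / 2| <= `|y| ^+ 4.
Proof.
rewrite [leRHS]exprSr; apply: (@MVT_bound _ (fun y => cos y - 1 + y ^+ 2 / 2) (fun y => - (sin y - y))).
- by move=> x; apply: is_derive_eq; rewrite /GRing.scale /=; field.
- by rewrite cos0 subrr add0r expr0n mul0r.
- move=> x xy; rewrite normrN (le_trans (norm_sinB_le x))// lerXn2r// nnegrE//.
Qed.

(** The factor min (1, |y|) keeps the bound integrable under a finite second moment, and still gives
    o(c^2) when y is scaled by c. *)
Lemma sin_taylor y : `|sin y - y| <= 3 * (y ^+ 2 * Num.min 1 `|y|).
Proof.
rewrite -(sqr_abs y); have [y1|y1] := leP `|y| 1.
  rewrite (le_trans (norm_sinB_le y))// exprSr.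
  have := exprn_ge0 2 (normr_ge0 y); have := mulr_ge0 (exprn_ge0 2 (normr_ge0 y)) (normr_ge0 y); lra.
rewrite (le_trans (ler_normB _ _))//; have := norm_sin_le y; nra.
Qed.

Lemma cos_taylor y : `|cos y - 1 + y ^+ 2 / 2| <= 3 * (y ^+ 2 * Num.min 1 `|y|).
Proof.
have [y1|y1] := leP `|y| 1.
  rewrite (le_trans (norm_cosB_le y))// exprSr exprSr -(sqr_abs y).
  have h := mulr_ge0 (exprn_ge0 2 (normr_ge0 y)) (normr_ge0 y).
  have : `|y| ^+ 2 * `|y| * `|y| <= `|y| ^+ 2 * `|y| * 1 by rewrite ler_wpM2l.
  lra.
rewrite -(sqr_abs y) mulr1 (le_trans (ler_normD _ _))//.
have := cos_max y; have := ler_normB (cos y) 1; rewrite normr1.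
rewrite (ger0_norm (_ : 0 <= `|y| ^+ 2 / 2)) ?divr_ge0 ?sqr_ge0//; nra.
Qed.

(** From 1 - z <= exp (- z) <= 1 / (1 + z) <= 1 - z + z^2. *)
Lemma expRN_taylor (z : R) : 0 <= z -> `|expR (- z) - 1 + z| <= z ^+ 2.
Proof.
move=> z0; have h1 := expR_ge1Dx (- z).
have h2 : expR (- z) <= (1 + z)^-1.
  rewrite expRN lef_pV2 ?posrE ?expR_gt0//; last by lra.
  exact: expR_ge1Dx.
have h3 : (1 + z)^-1 <= 1 - z + z ^+ 2.
  rewrite -[leLHS]mul1r ler_pdivrMr; last by lra.
  have : 0 <= z ^+ 3 by rewrite exprn_ge0.
  have -> : (1 - z + z ^+ 2) * (1 + z) = 1 + z ^+ 3 by ring.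
  lra.
by rewrite ger0_norm; lra.
Qed.

End trig_taylor.

Section char_near0.
Context d (T : measurableType d) (R : realType) (P : probability T R) (X : T -> R).
Hypotheses (LX : L2 P X) (EX : Ex P X = 0) (VX : Ex P (fun w => X w ^+ 2) = 1).

Let mX : measurable_fun setT X. Proof. by case: LX. Qed.

(** Second order expansion of the characteristic function at 0: unit variance matches the real part
    with the Gaussian one, zero mean makes the imaginary part negligible. *)
Lemma char_fun_near0 (eta : R) : 0 < eta -> exists2 c0 : R, 0 < c0 &
  forall c, `|c| <= c0 ->
    `|Ex P (fun w => cos (c * X w)) - expR (- (c ^+ 2 / 2))| <= eta * c ^+ 2 /\
    `|Ex P (fun w => sin (c * X w))| <= eta * c ^+ 2.
Proof.
move=> eta0; have [_ LX2] := LX.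
pose k (c : R) w := X w ^+ 2 * Num.min 1 `|c * X w|.
have mk c : measurable_fun setT (k c).
  apply: measurable_funM; first exact: measurable_funX.
  apply: measurable_minr => //; apply: measurableT_comp => //.
  exact: measurable_funM.
have kX c w : `|k c w| <= X w ^+ 2.
  rewrite /k normrM (ger0_norm (sqr_ge0 _)) ler_piMr ?sqr_ge0//.
  by rewrite ger0_norm ?ge_min ?lexx// le_min ler01 normr_ge0.
have Lk c : L1 P (k c) by exact: L1_le (mk c) LX2 (kX c).
have kc : Ex P (k n.+1%:R^-1) @[n --> \oo] --> (0 : R).
  rewrite -(Ex_cst P (0 : R)); apply: (@Ex_dominated _ _ _ _ _ _ (fun w => X w ^+ 2)) => //.
  move=> w; rewrite -[X in _ --> X](mulr0 (X w ^+ 2)).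
  apply: cvgM; first exact: cvg_cst.
  have h : `|n.+1%:R^-1 * X w| @[n --> \oo] --> `|0 * X w|.
    by apply: cvg_norm; apply: cvgM; [exact: cvg_harmonic|exact: cvg_cst].
  rewrite mul0r normr0 in h.
  apply: (@squeeze_cvgr _ _ _ _ (fun=> 0) (fun n => `|n.+1%:R^-1 * X w|)) => //.
    apply: nearW => n; rewrite le_min ler01 normr_ge0/=.
    by rewrite ge_min lexx orbT.
  exact: cvg_cst.
have e6 : 0 < eta / 6 by rewrite divr_gt0.
have /cvgrPdist_le /(_ _ e6) [n _ /(_ n (leqnn n))] := kc.
rewrite sub0r normrN => /(le_trans (ler_norm _)) hn.
(* The first bound makes the mean of [k c] at most eta / 6; the other two give c^2 <= |c| <= eta,
   which controls the remainder c^4 / 4 of the exponential. *)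
pose c0 := Num.min n.+1%:R^-1 (Num.min 1 eta).
have c00 : 0 < c0 by rewrite !lt_min invr_gt0 ltr0n ltr01 eta0.
exists c0 => // c cc0.
have cn : `|c| <= n.+1%:R^-1 by rewrite (le_trans cc0)// ge_min lexx.
have c1 : `|c| <= 1 by rewrite (le_trans cc0)// !ge_min lexx orbT.
have ce : `|c| <= eta by rewrite (le_trans cc0)// !ge_min lexx !orbT.
have kcn : Ex P (k c) <= eta / 6.
  apply: le_trans hn; apply: Ex_le => // w; rewrite /k ler_wpM2l ?sqr_ge0//.
  rewrite le_min ge_min lexx /= ge_min; apply/orP; right.
  rewrite !normrM ler_wpM2r// (le_trans cn)// ler_norm//.
have main w : 3 * ((c * X w) ^+ 2 * Num.min 1 `|c * X w|) = 3 * c ^+ 2 * k c w.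
  by rewrite /k exprMn; ring.
have bnd : 3 * c ^+ 2 * Ex P (k c) <= eta / 2 * c ^+ 2.
  have : 3 * c ^+ 2 * Ex P (k c) <= 3 * c ^+ 2 * (eta / 6).
    by rewrite ler_wpM2l// mulr_ge0// sqr_ge0.
  lra.
have mcX : measurable_fun setT (fun w => c * X w) by exact: measurable_funM.
have mc : measurable_fun setT (fun w => cos (c * X w)).
  exact: (measurableT_comp (@measurable_cos R) mcX).
have ms : measurable_fun setT (fun w => sin (c * X w)).
  exact: (measurableT_comp (@measurable_sin R) mcX).
have Lc : L1 P (fun w => cos (c * X w)).
  by apply: (@L1_bounded _ _ _ _ _ 1) => // w; exact: cos_max.
have Ls : L1 P (fun w => sin (c * X w)).
  by apply: (@L1_bounded _ _ _ _ _ 1) => // w; exact: sin_max.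
have LX1 := L2_L1 LX.
have LkZ : L1 P (fun w => 3 * c ^+ 2 * k c w) by exact: L1Z.
have Lcx : L1 P (fun w => c ^+ 2 / 2 * X w ^+ 2) by exact: L1Z.
split.
- have h1 : `|Ex P (fun w => cos (c * X w)) - 1 + c ^+ 2 / 2| <= eta / 2 * c ^+ 2.
    apply: le_trans bnd; rewrite -ExZ//.
    have -> : Ex P (fun w => cos (c * X w)) - 1 + c ^+ 2 / 2 =
        Ex P (fun w => cos (c * X w) - 1 + c ^+ 2 / 2 * X w ^+ 2).
      rewrite ExD//; last by apply: L1B => //; exact: L1_cst.
      by rewrite ExB//; [rewrite Ex_cst ExZ// VX mulr1|exact: L1_cst].
    apply: Ex_norm_le => //.
      by apply: L1D => //; apply: L1B => //; exact: L1_cst.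
    by move=> w; rewrite -main (le_trans _ (cos_taylor _))// exprMn mulrAC.
  have h2 : `|expR (- (c ^+ 2 / 2)) - 1 + c ^+ 2 / 2| <= eta / 2 * c ^+ 2.
    rewrite (le_trans (expRN_taylor _))// ?divr_ge0 ?sqr_ge0//.
    have : `|c| ^+ 2 <= eta.
      by rewrite (le_trans _ ce)// expr2 ler_piMl.
    rewrite sqr_abs => c2e; rewrite expr_div_n.
    have : c ^+ 2 * c ^+ 2 <= eta * c ^+ 2 by rewrite ler_wpM2r ?sqr_ge0.
    have := sqr_ge0 (c ^+ 2); rewrite expr2; nra.
  have -> : Ex P (fun w => cos (c * X w)) - expR (- (c ^+ 2 / 2)) =
    (Ex P (fun w => cos (c * X w)) - 1 + c ^+ 2 / 2) -
    (expR (- (c ^+ 2 / 2)) - 1 + c ^+ 2 / 2) by ring.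
  by rewrite (le_trans (ler_normB _ _))//; lra.
- have h1 : `|Ex P (fun w => sin (c * X w))| <= eta / 2 * c ^+ 2.
    apply: le_trans bnd; rewrite -ExZ//.
    have -> : Ex P (fun w => sin (c * X w)) = Ex P (fun w => sin (c * X w) - c * X w).
      by rewrite ExB ?ExZ ?EX ?mulr0 ?subr0//; exact: L1Z.
    apply: Ex_norm_le => //; first by apply: L1B => //; exact: L1Z.
    by move=> w; rewrite -main; exact: sin_taylor.
  apply: le_trans h1 _; rewrite ler_wpM2r ?sqr_ge0//; lra.
Qed.

End char_near0.

(** * Sums of independent variables *)

Section independent_sums.
Context d (T : measurableType d) (R : realType) (P : probability T R)
  (eps : int -> {RV P >-> R}).
Hypothesis eps_indep : mutually_independent eps.

Definition lin_comb (c : int -> R) (s : seq int) (w : T) : R :=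
  \sum_(k <- s) c k * eps k w.

Definition rectangle (A : int -> set R) (s : seq int) : set T :=
  \bigcap_(t in [set` s]) (eps t @^-1` A t).

Let mpre k (A : set R) : measurable A -> measurable (eps k @^-1` A).
Proof. by move=> mA; rewrite -[X in measurable X]setTI; exact: measurable_funP. Qed.

Let mrect A s : (forall t, measurable (A t)) -> measurable (rectangle A s).
Proof.
move=> mA; apply: fin_bigcap_measurable; first exact: finite_seq.
by move=> t _; exact: mpre.
Qed.

Lemma measurable_lin_comb c s : measurable_fun setT (lin_comb c s).
Proof.
rewrite /lin_comb; elim: s => [|k s ih].
  by under eq_fun do rewrite big_nil; exact: measurable_cst.
by under eq_fun do rewrite big_cons; apply: measurable_funD => //; exact: measurable_funM.
Qed.

Let mcos c s th : measurable_fun setT (fun w => cos (lin_comb c s w + th)).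
Proof.
apply: (measurableT_comp (@measurable_cos R)).
by apply: measurable_funD => //; exact: measurable_lin_comb.
Qed.

Let rect_cons A B k s : (forall t, measurable (A t)) -> measurable B ->
  k \notin s -> uniq s ->
  P (rectangle A s `&` eps k @^-1` B) = (P (rectangle A s) * P (eps k @^-1` B))%E.
Proof.
move=> mA mB ks us.
pose A' t := if t == k then B else A t.
have mA' t : measurable (A' t) by rewrite /A'; case: ifP.
have E : rectangle A s `&` eps k @^-1` B = rectangle A' (k :: s).
  apply/seteqP; split => [w [h hk] t /=|w h].
    rewrite inE /A' => /orP[/eqP->|ts]; first by rewrite eqxx.
    by case: eqP => [->//|_]; exact: h.
  split; last first.
    by have := h k; rewrite /= mem_head /A' eqxx; apply.
  move=> t ts; have := h t; rewrite /= inE ts orbT /A' => /(_ isT).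
  by case: eqP => [tk|//]; rewrite -tk ts in ks.
have EA : rectangle A s = rectangle A' s.
  apply: eq_bigcapr => t /= ts; rewrite /A'; case: eqP => // tk.
  by rewrite -tk ts in ks.
have A'k : A' k = B by rewrite /A' eqxx.
have uks : uniq (k :: s) by rewrite /= ks.
have := eps_indep uks mA'; rewrite big_cons A'k -(eps_indep us mA') muleC => h.
by rewrite E EA; exact: h.
Qed.

(** Induction on [s], for all rectangles at once. The addition formula splits off eps k; a condition
    on eps k is first moved into the rectangle, where the induction hypothesis applies, and
    [indep_ext] then turns it into a cosine or sine factor. Independence of generated sigma-algebras
    is thus bypassed. *)
Let cos_rect c s th A s' : uniq (s ++ s') -> (forall t, measurable (A t)) ->
  Ex P (fun w => cos (lin_comb c s w + th) * \1_(rectangle A s') w) =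
  Ex P (fun w => cos (lin_comb c s w + th)) * fine (P (rectangle A s')).
Proof.
elim: s th A s' => [|k s ih] th A s' us mA.
  rewrite /lin_comb; under eq_Rintegral do rewrite big_nil.
  under [X in _ = X * _]eq_Rintegral do rewrite big_nil.
  rewrite Ex_cst ExZ; last by apply: L1_indic; exact: mrect.
  by rewrite Ex_indic//; exact: mrect.
move: us; rewrite cat_cons /= mem_cat negb_or => /andP[/andP[ks ks'] us].
have us' : uniq s' by move: us; rewrite cat_uniq => /and3P[].
have mR := mrect s' mA.
have m1 : measurable_fun setT (\1_(rectangle A s') : T -> R) by exact: measurable_indic.
have key (f : R -> R) th' : measurable_fun setT f -> (forall x, `|f x| <= 1) ->
  Ex P (fun w => cos (lin_comb c s w + th') * \1_(rectangle A s') w * f (eps k w)) =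
  Ex P (fun w => cos (lin_comb c s w + th')) * fine (P (rectangle A s')) * Ex P (fun w => f (eps k w)).
  move=> mf f1; rewrite -(ih th' A s' us mA).
  apply: (@indep_ext _ _ _ _ (fun w => cos (lin_comb c s w + th') * \1_(rectangle A s') w) (eps k) f 1 1) => //.
  - by apply: measurable_funM.
  - move=> w; rewrite normrM -[leRHS]mulr1 ler_pM// ?cos_max//.
    by rewrite indicE; case: (_ \in _); rewrite ?normr1 ?normr0.
  - move=> B mB.
    have mB' := mpre k mB.
    (* The condition on eps k joins the rectangle without clash, as [k] is not in s'. *)
    pose A' t := if t == k then B else A t.
    have mA' t : measurable (A' t) by rewrite /A'; case: ifP.
    have EA' : rectangle A' (k :: s') = rectangle A s' `&` eps k @^-1` B.
      apply/seteqP; split => [w h|w [h hk] t /=]; last first.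
        rewrite inE /A' => /orP[/eqP->|ts]; first by rewrite eqxx.
        by case: eqP => [->//|_]; exact: h.
      split; last first.
        by have := h k; rewrite /= mem_head /A' eqxx; apply.
      move=> t ts; have := h t; rewrite /= inE ts orbT /A' => /(_ isT).
      by case: eqP => [tk|//]; rewrite -tk ts in ks'.
    transitivity (Ex P (fun w => cos (lin_comb c s w + th') * \1_(rectangle A' (k :: s')) w)).
      apply: eq_Rintegral => w _; rewrite EA' !indicE in_setI.
      rewrite -[(eps k w \in B)]/(w \in eps k @^-1` B).
      by case: (w \in rectangle A s'); case: (w \in eps k @^-1` B); rewrite ?mulr1 ?mulr0.
    rewrite ih//; last first.
      have pe : perm_eq (s ++ k :: s') (k :: s ++ s') by rewrite perm_catC /= perm_cons perm_catC.
      by rewrite (perm_uniq pe) /= mem_cat negb_or ks ks' us.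
    rewrite (ih th' A s' us mA) EA' rect_cons// fineM ?fin_num_measure//.
    by rewrite mulrA.
pose fc (x : R) := cos (c k * x).
pose fs (x : R) := sin (c k * x).
(* Writing the sine as a cosine of shifted phase keeps the induction within one family. *)
have dec w th' : cos (lin_comb c (k :: s) w + th') =
    cos (lin_comb c s w + th') * fc (eps k w) -
    cos (lin_comb c s w + (th' - pi / 2)) * fs (eps k w).
  rewrite addrA cosBpihalf /lin_comb big_cons -cosD; congr cos; ring.
have mfc : measurable_fun setT fc.
  by apply: (measurableT_comp (@measurable_cos R)); exact: measurable_funM.
have mfs : measurable_fun setT fs.
  by apply: (measurableT_comp (@measurable_sin R)); exact: measurable_funM.
have fc1 x : `|fc x| <= 1 by exact: cos_max.
have fs1 x : `|fs x| <= 1 by exact: sin_max.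
have mfce : measurable_fun setT (fun w => fc (eps k w)) by exact: (measurableT_comp mfc).
have mfse : measurable_fun setT (fun w => fs (eps k w)) by exact: (measurableT_comp mfs).
have LcR th' (g : T -> R) : measurable_fun setT g -> (forall w, `|g w| <= 1) ->
    L1 P (fun w => cos (lin_comb c s w + th') * \1_(rectangle A s') w * g w).
  move=> mg g1; apply: (@L1_bounded _ _ _ _ _ 1).
    by apply: measurable_funM => //; apply: measurable_funM.
  move=> w; rewrite !normrM -[leRHS]mulr1 ler_pM// -[leRHS]mulr1 ler_pM// ?cos_max//.
  by rewrite indicE; case: (_ \in _); rewrite ?normr1 ?normr0.
have Lc th' (g : T -> R) : measurable_fun setT g -> (forall w, `|g w| <= 1) ->
    L1 P (fun w => cos (lin_comb c s w + th') * g w).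
  move=> mg g1; apply: (@L1_bounded _ _ _ _ _ 1).
    by apply: measurable_funM.
  by move=> w; rewrite !normrM -[leRHS]mulr1 ler_pM// cos_max.
have keyT (f : R -> R) th' : measurable_fun setT f -> (forall x, `|f x| <= 1) ->
  Ex P (fun w => cos (lin_comb c s w + th') * f (eps k w)) =
  Ex P (fun w => cos (lin_comb c s w + th')) * Ex P (fun w => f (eps k w)).
  move=> mf f1; apply: (@indep_ext _ _ _ _ (fun w => cos (lin_comb c s w + th')) (eps k) f 1 1) => //.
    by move=> w; exact: cos_max.
  move=> B mB.
  have -> : eps k @^-1` B = rectangle (fun=> B) [:: k].
    by rewrite /rectangle set_cons1 bigcap_set1.
  rewrite -ih//; last first.
    have us1 : uniq s by move: us; rewrite cat_uniq => /and3P[].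
    by rewrite cats1 rcons_uniq ks.
  apply: eq_Rintegral => w _; congr (_ * _).
  by rewrite /rectangle set_cons1 bigcap_set1 !indicE.
transitivity (Ex P (fun w =>
    cos (lin_comb c s w + th) * \1_(rectangle A s') w * fc (eps k w) -
    cos (lin_comb c s w + (th - pi / 2)) * \1_(rectangle A s') w * fs (eps k w))).
  by apply: eq_Rintegral => w _; rewrite dec; ring.
rewrite (ExB (LcR _ _ mfce (fun w => fc1 _)) (LcR _ _ mfse (fun w => fs1 _))).
have -> : Ex P (fun w => cos (lin_comb c (k :: s) w + th)) = Ex P (fun w =>
    cos (lin_comb c s w + th) * fc (eps k w) -
    cos (lin_comb c s w + (th - pi / 2)) * fs (eps k w)).
  by apply: eq_Rintegral => w _; rewrite dec.
rewrite (ExB (Lc _ _ mfce (fun w => fc1 _)) (Lc _ _ mfse (fun w => fs1 _))).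
rewrite (key fc)// (key fs)// (keyT fc)// (keyT fs)//.
ring.
Qed.

Lemma Ex_cos_lin_combM c k s th (f : R -> R) : uniq (k :: s) ->
  measurable_fun setT f -> (forall x, `|f x| <= 1) ->
  Ex P (fun w => cos (lin_comb c s w + th) * f (eps k w)) =
  Ex P (fun w => cos (lin_comb c s w + th)) * Ex P (fun w => f (eps k w)).
Proof.
move=> /= /andP[ks us] mf f1.
apply: (@indep_ext _ _ _ _ (fun w => cos (lin_comb c s w + th)) (eps k) f 1 1) => //.
  by move=> w; exact: cos_max.
move=> B mB.
have -> : eps k @^-1` B = rectangle (fun=> B) [:: k].
  by rewrite /rectangle set_cons1 bigcap_set1.
rewrite -cos_rect//; last by rewrite cats1 rcons_uniq ks.
apply: eq_Rintegral => w _; congr (_ * _).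
by rewrite /rectangle set_cons1 bigcap_set1 !indicE.
Qed.

End independent_sums.

(** * Independent identically distributed noise *)

Section iid_noise.
Context d (T : measurableType d) (R : realType) (P : probability T R)
  (eps : int -> {RV P >-> R}).
Hypothesis eps_iid : iid eps.
Hypothesis eps_mean : forall t, 'E_P[eps t]%E = 0%E.
Hypothesis eps_var : forall t, 'V_P[eps t]%E = 1%E.

Lemma Ex_noise t : Ex P (eps t) = 0.
Proof. by have := fine_expectation P (eps t); rewrite eps_mean /= => <-. Qed.

Let int_sqr t : (\int[P]_w ((eps t w) ^+ 2)%:E = 1)%E.
Proof.
rewrite -(eps_var t) /variance unlock eps_mean unlock.
by apply: eq_integral => w _; rewrite !fctE /= subr0 expr2.
Qed.

Lemma L2_noise t : L2 P (eps t).
Proof.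
split; first exact: measurable_funP.
apply/integrableP; split.
  by apply/measurable_EFinP; exact: measurable_funX.
under eq_integral do rewrite /= ger0_norm ?sqr_ge0//.
by rewrite int_sqr ltry.
Qed.

Lemma Ex_noise_sqr t : Ex P (fun w => eps t w ^+ 2) = 1.
Proof. by rewrite /Rintegral int_sqr. Qed.

Lemma Ex_noiseM s t : Ex P (fun w => eps s w * eps t w) = (s == t)%:R.
Proof.
have [->|st] := eqVneq s t.
  by under eq_Rintegral do rewrite -expr2; exact: Ex_noise_sqr.
have [] := indep_L1M (L2_L1 (L2_noise s)) (L2_L1 (L2_noise t)).
  move=> A B mA mB; case: eps_iid => ind _.
  pose A' k := if k == s then A else B.
  have mA' k : measurable (A' k) by rewrite /A'; case: ifP.
  have us : uniq [:: s; t] by rewrite /= inE st.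
  have := ind _ _ us mA'; rewrite big_cons big_seq1 /A' eqxx.
  rewrite eq_sym (negbTE st) => <-; congr (P _).
  apply/seteqP; split => [w [wA wB] k /=|w h]; last first.
    split; first by have := h s; rewrite /= mem_head eqxx; apply.
    by have := h t; rewrite /= !inE eqxx orbT eq_sym (negbTE st); apply.
  rewrite !inE => /orP[|] /eqP ->; first by rewrite eqxx.
  by rewrite eq_sym (negbTE st).
by move=> _ ->; rewrite !Ex_noise mul0r.
Qed.

Lemma Ex_lin_comb_sqr c s : uniq s ->
  Ex P (fun w => lin_comb eps c s w ^+ 2) = \sum_(k <- s) c k ^+ 2.
Proof.
move=> us; under eq_Rintegral do rewrite expr2 /lin_comb big_distrlr /=.
have L (i j : int) : L1 P (fun w => (c i * eps i w) * (c j * eps j w)).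
  by apply: L1M; apply: L2Z; exact: L2_noise.
rewrite Ex_sum => [|i]; last exact: L1_sum.
rewrite big_seq [RHS]big_seq; apply: eq_bigr => i si; rewrite Ex_sum//.
rewrite (bigD1_seq i) //= big1 => [|j ji].
  rewrite addr0 (_ : (fun w => _) = fun w => c i ^+ 2 * (eps i w * eps i w)).
    by rewrite ExZ ?Ex_noiseM ?eqxx ?mulr1//; apply: L1M; exact: L2_noise.
  by apply/funext => w; ring.
rewrite (_ : (fun w => _) = fun w => c i * c j * (eps i w * eps j w)).
  rewrite ExZ ?Ex_noiseM; last by apply: L1M; exact: L2_noise.
  by rewrite eq_sym (negbTE ji) mulr0.
by apply/funext => w; ring.
Qed.

(* Telescoping form of the Lindeberg argument: peeling off one summand costs
   at most 2 * eta * (c k) ^ 2. *)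
Lemma clt_lin_comb (eta : R) : 0 < eta -> exists2 c0 : R, 0 < c0 &
  forall c s th, uniq s -> (forall k, `|c k| <= c0) ->
    `|Ex P (fun w => cos (lin_comb eps c s w + th)) -
      cos th * expR (- (\sum_(k <- s) c k ^+ 2 / 2))| <=
    2 * eta * \sum_(k <- s) c k ^+ 2.
Proof.
move=> eta0.
have [c0 c00 hc0] := char_fun_near0 (L2_noise 0) (Ex_noise 0) (Ex_noise_sqr 0) eta0.
exists c0 => // c s th us cc0; elim: s us th => [_ th|k s ih /[dup] uks /= /andP[ks us] th].
  rewrite !big_nil oppr0 expR0 mulr1 mulr0 /lin_comb.
  under eq_Rintegral do rewrite big_nil add0r.
  by rewrite Ex_cst subrr normr0.
have same (f : R -> R) : measurable_fun setT f ->
    Ex P (fun w => f (eps k w)) = Ex P (fun w => f (eps 0 w)).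
  move=> mf; exact: (same_law_Ex (measurable_funP (eps k))
    (measurable_funP (eps 0)) (eps_iid.2 k 0) mf).
pose fc (x : R) := cos (c k * x).
pose fs (x : R) := sin (c k * x).
have mfc : measurable_fun setT fc.
  by apply: (measurableT_comp (@measurable_cos R)); exact: measurable_funM.
have mfs : measurable_fun setT fs.
  by apply: (measurableT_comp (@measurable_sin R)); exact: measurable_funM.
have [hc hs] := hc0 (c k) (cc0 k).
rewrite -[Ex P (fun w => cos (c k * eps 0 w))](same fc mfc) in hc.
rewrite -[Ex P (fun w => sin (c k * eps 0 w))](same fs mfs) in hs.
have L (g : R -> R) th' : measurable_fun setT g -> (forall x, `|g x| <= 1) ->
    L1 P (fun w => cos (lin_comb eps c s w + th') * g (eps k w)).
  move=> mg g1; apply: (@L1_bounded _ _ _ _ _ 1).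
    apply: measurable_funM; last exact: (measurableT_comp mg).
    apply: (measurableT_comp (@measurable_cos R)).
    by apply: measurable_funD => //; exact: measurable_lin_comb.
  by move=> w; rewrite normrM -[leRHS]mulr1 ler_pM// cos_max.
have fc1 x : `|fc x| <= 1 by exact: cos_max.
have fs1 x : `|fs x| <= 1 by exact: sin_max.
have -> : Ex P (fun w => cos (lin_comb eps c (k :: s) w + th)) =
   Ex P (fun w => cos (lin_comb eps c s w + th)) * Ex P (fun w => fc (eps k w)) -
   Ex P (fun w => cos (lin_comb eps c s w + (th - pi / 2))) * Ex P (fun w => fs (eps k w)).
  rewrite -(Ex_cos_lin_combM eps_iid.1 c th uks mfc fc1).
  rewrite -(Ex_cos_lin_combM eps_iid.1 c (th - pi / 2) uks mfs fs1).
  rewrite -ExB; [|exact: L|exact: L]; apply: eq_Rintegral => w _.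
  rewrite addrA cosBpihalf /lin_comb big_cons -cosD; congr cos; ring.
have bnd th' : `|Ex P (fun w => cos (lin_comb eps c s w + th'))| <= 1.
  apply: Ex_bounded => [|w]; last exact: cos_max.
  apply: (measurableT_comp (@measurable_cos R)).
  by apply: measurable_funD => //; exact: measurable_lin_comb.
move: (ih us th) (bnd th) (bnd (th - pi / 2)).
set Ec := Ex P (fun w => cos (lin_comb eps c s w + th)).
set Es := Ex P (fun w => cos (lin_comb eps c s w + (th - pi / 2))).
rewrite -/Ec -/Es in hc hs *.
move: hc hs; set phic := Ex P (fun w => fc (eps k w)); set phis := Ex P (fun w => fs (eps k w)).
rewrite !big_cons.
set v := \sum_(j <- s) c j ^+ 2; set vh := \sum_(j <- s) c j ^+ 2 / 2.
move=> hc hs hih hEc hEs.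
rewrite opprD expRD.
set e1 := expR (- (c k ^+ 2 / 2)) in hc *; set e2 := expR (- vh) in hih *.
have e11 : `|e1| <= 1.
  rewrite ger0_norm ?expR_ge0// -expR0 ler_expR oppr_le0 divr_ge0 ?sqr_ge0//.
(* Only the cosine factor is compared with the Gaussian one; the sine factor is at most eta * c k ^+
   2 by itself. *)
have -> : Ec * phic - Es * phis - cos th * (e1 * e2) =
  Ec * (phic - e1) + (Ec - cos th * e2) * e1 - Es * phis by ring.
have a1 : `|Ec * (phic - e1)| <= eta * c k ^+ 2.
  by rewrite normrM (le_trans _ hc)// ler_piMl.
have a2 : `|(Ec - cos th * e2) * e1| <= 2 * eta * v.
  by rewrite normrM (le_trans _ hih)// ler_piMr.
have a3 : `|Es * phis| <= eta * c k ^+ 2.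
  by rewrite normrM (le_trans _ hs)// ler_piMl.
rewrite (le_trans (ler_normB _ _))// (le_trans (lerD (ler_normD _ _) (lexx _)))//.
lra.
Qed.

(** One innovation occurs in several of the [u t]; collecting its coefficients gives a combination
    over distinct indices, as independence requires. *)
Lemma regroup (I : Type) (r : seq I) (f : I -> int) (x : I -> R) w :
  \sum_(i <- r) x i * eps (f i) w =
  lin_comb eps (fun k => \sum_(i <- r | f i == k) x i) (undup (map f r)) w.
Proof.
rewrite /lin_comb; under [RHS]eq_bigr do rewrite mulr_suml big_mkcond /=.
rewrite exchange_big /=.
have : {subset map f r <= undup (map f r)} by move=> k; rewrite mem_undup.
move: (undup_uniq (map f r)); move: (undup _) => s us.
elim: r => [|i r ih] sub; first by rewrite !big_nil.
rewrite !big_cons ih; last by move=> k kr; apply: sub; rewrite inE kr orbT.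
congr (_ + _).
rewrite (bigD1_seq (f i)) /=; [|by apply: sub; rewrite inE eqxx|exact: us].
rewrite eqxx big1 ?addr0// => k kfi.
by rewrite eq_sym (negbTE kfi).
Qed.

End iid_noise.

(** * Mean-square convergence *)

Definition L2cvg {d} {T : measurableType d} {R : realType} (P : probability T R)
    (f_ : nat -> T -> R) (f : T -> R) : Prop :=
  [/\ forall n, L2 P (f_ n), L2 P f &
      Ex P (fun w => (f_ n w - f w) ^+ 2) @[n --> \oo] --> (0 : R)].

Section L2cvg.
Context d (T : measurableType d) (R : realType) (P : probability T R).

Lemma cvg0_le (x y : nat -> R) : (forall n, 0 <= x n <= y n) ->
  y @ \oo --> (0 : R) -> x @ \oo --> (0 : R).
Proof.
move=> xy y0; apply: (@squeeze_cvgr _ _ _ _ (fun=> 0) y) => //; last exact: cvg_cst.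
exact: nearW.
Qed.

Lemma L2cvg_cst f : L2 P f -> L2cvg P (fun=> f) f.
Proof.
move=> Lf; split => //.
rewrite (_ : (fun n : nat => _) = fun=> 0); first exact: cvg_cst.
apply/funext => n; under eq_Rintegral do rewrite subrr expr0n.
by rewrite Ex_cst.
Qed.

Lemma L2cvgZ c f_ f : L2cvg P f_ f -> L2cvg P (fun n w => c * f_ n w) (fun w => c * f w).
Proof.
move=> [Lf_ Lf h]; split => [n||]; [exact: L2Z|exact: L2Z|].
rewrite -[X in _ --> X](mulr0 (c ^+ 2)).
rewrite (_ : (fun n : nat => _) = fun n => c ^+ 2 * Ex P (fun w => (f_ n w - f w) ^+ 2)).
  by apply: cvgM => //; exact: cvg_cst.
apply/funext => n; rewrite -ExZ; last by case: (L2B (Lf_ n) Lf).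
by apply: eq_Rintegral => w _; ring.
Qed.

Lemma L2cvgD f_ f g_ g : L2cvg P f_ f -> L2cvg P g_ g ->
  L2cvg P (fun n w => f_ n w + g_ n w) (fun w => f w + g w).
Proof.
move=> [Lf_ Lf hf] [Lg_ Lg hg]; split => [n||]; [exact: L2D|exact: L2D|].
apply: (@cvg0_le _ (fun n => 2 * Ex P (fun w => (f_ n w - f w) ^+ 2) +
   2 * Ex P (fun w => (g_ n w - g w) ^+ 2))) => [n|]; last first.
  rewrite -[X in _ --> X](addr0 (0 : R)) -[in X in _ --> X](mulr0 (2 : R)).
  by apply: cvgD; apply: cvgM => //; exact: cvg_cst.
have [_ i1] := L2B (Lf_ n) Lf; have [_ i2] := L2B (Lg_ n) Lg.
have [_ i3] := L2B (L2D (Lf_ n) (Lg_ n)) (L2D Lf Lg).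
rewrite Ex_ge0 /=; last by move=> w; exact: sqr_ge0.
rewrite -!ExZ// -ExD; [|exact: L1Z|exact: L1Z].
apply: Ex_le => //; first by apply: L1D; exact: L1Z.
by move=> w; have := sqr_ge0 ((f_ n w - f w) - (g_ n w - g w)); nra.
Qed.

Lemma L2cvg_sum (I : Type) (s : seq I) (f_ : I -> nat -> T -> R) (f : I -> T -> R) :
  (forall i, L2cvg P (f_ i) (f i)) ->
  L2cvg P (fun n w => \sum_(i <- s) f_ i n w) (fun w => \sum_(i <- s) f i w).
Proof.
move=> h; elim: s => [|i s ih].
  have := L2cvg_cst (L2_cst P 0); congr (L2cvg P _ _).
    by apply/funext => n; apply/funext => w; rewrite big_nil.
  by apply/funext => w; rewrite big_nil.
have := L2cvgD (h i) ih; congr (L2cvg P _ _).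
  by apply/funext => n; apply/funext => w; rewrite big_cons.
by apply/funext => w; rewrite big_cons.
Qed.

Lemma cvg_sqrt0 (x : nat -> R) : x @ \oo --> (0 : R) -> Num.sqrt (x n) @[n --> \oo] --> (0 : R).
Proof.
move=> h; rewrite -[X in _ --> X]sqrtr0.
by apply: (@cvg_comp _ _ _ x Num.sqrt _ _ _ h); exact: sqrt_continuous.
Qed.

Lemma L2cvg_norm f_ f : L2cvg P f_ f ->
  Ex P (fun w => `|f_ n w - f w|) @[n --> \oo] --> (0 : R).
Proof.
move=> [Lf_ Lf h]; apply: cvg0_le (cvg_sqrt0 h) => n.
by rewrite Ex_ge0//= Ex_norm_sqrt//; exact: L2B.
Qed.

Lemma L2cvg_ExM f_ f g : L2cvg P f_ f -> L2 P g ->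
  Ex P (fun w => f_ n w * g w) @[n --> \oo] --> Ex P (fun w => f w * g w).
Proof.
move=> [Lf_ Lf h] Lg; apply/subr_cvg0; apply: norm_cvg0.
apply: (@cvg0_le _ (fun n => Num.sqrt (Ex P (fun w => (f_ n w - f w) ^+ 2)) *
   Num.sqrt (Ex P (fun w => g w ^+ 2)))) => [n|]; last first.
  rewrite -[X in _ --> X](mul0r (Num.sqrt (Ex P (fun w => g w ^+ 2)))).
  by apply: cvgM; [exact: cvg_sqrt0|exact: cvg_cst].
rewrite normr_ge0 /= -ExB; [|exact: L1M|exact: L1M].
have Ld := L2B (Lf_ n) Lf.
under eq_Rintegral do rewrite -mulrBl.
exact: le_trans (Ex_norm (L1M Ld Lg)) (cauchy_schwarz_norm Ld Lg).
Qed.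

Lemma L2cvg_Ex_sqr f_ f : L2cvg P f_ f ->
  Ex P (fun w => f_ n w ^+ 2) @[n --> \oo] --> Ex P (fun w => f w ^+ 2).
Proof.
move=> /[dup] Lc [Lf_ Lf h].
have E n : Ex P (fun w => f_ n w ^+ 2) = Ex P (fun w => (f_ n w - f w) ^+ 2) +
    2 * Ex P (fun w => f_ n w * f w) - Ex P (fun w => f w * f w).
  have [_ i1] := L2B (Lf_ n) Lf; have i2 := L1M (Lf_ n) Lf; have i3 := L1M Lf Lf.
  rewrite -ExZ// -ExD//; last exact: L1Z.
  rewrite -ExB//; last by apply: L1D => //; exact: L1Z.
  by apply: eq_Rintegral => w _; ring.
have h2 := L2cvg_ExM Lc Lf.
have c : Ex P (fun w => (f_ n w - f w) ^+ 2) + 2 * Ex P (fun w => f_ n w * f w) -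
    Ex P (fun w => f w * f w) @[n --> \oo] -->
    0 + 2 * Ex P (fun w => f w * f w) - Ex P (fun w => f w * f w).
  apply: cvgB; last exact: cvg_cst.
  by apply: cvgD; [exact: h|apply: cvgM; [exact: cvg_cst|exact: h2]].
have e : 0 + 2 * Ex P (fun w => f w * f w) - Ex P (fun w => f w * f w) =
    Ex P (fun w => f w ^+ 2).
  by under [RHS]eq_Rintegral do rewrite expr2; ring.
by rewrite e in c; under eq_fun do rewrite E; exact: c.
Qed.

(** Polarisation reduces products to convergence of second moments. *)
Lemma L2cvg_Ex_mul f_ f g_ g : L2cvg P f_ f -> L2cvg P g_ g ->
  Ex P (fun w => f_ n w * g_ n w) @[n --> \oo] --> Ex P (fun w => f w * g w).
Proof.
move=> cf cg.
have c1 := L2cvg_Ex_sqr (L2cvgD cf cg).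
have c2 := L2cvg_Ex_sqr (L2cvgD cf (L2cvgZ (-1) cg)).
have pol (a c : T -> R) : L2 P a -> L2 P c -> Ex P (fun w => a w * c w) =
   (Ex P (fun w => (a w + c w) ^+ 2) - Ex P (fun w => (a w + -1 * c w) ^+ 2)) / 4.
  move=> La Lc; have [_ i1] := L2D La Lc; have [_ i2] := L2D La (L2Z (-1) Lc).
  rewrite -ExB// mulrC -ExZ; last exact: L1B.
  by apply: eq_Rintegral => w _; field.
have [Lf_ Lf _] := cf; have [Lg_ Lg _] := cg.
under eq_fun do rewrite (pol _ _ (Lf_ _) (Lg_ _)).
rewrite (pol _ _ Lf Lg); apply: cvgM; last exact: cvg_cst.
by apply: cvgB.
Qed.

Lemma cos_lipschitz (x y : R) : `|cos x - cos y| <= `|x - y|.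
Proof.
have := norm_sin_le ((x - y) / 2).
have -> : cos x - cos y = - 2 * (sin ((x + y) / 2) * sin ((x - y) / 2)).
  have h a c : cos (a + c) - cos (a - c) = - 2 * (sin a * sin c) :> R.
    by rewrite cosD cosB; ring.
  by rewrite -h; congr (cos _ - cos _); field.
have n2 : `|2 : R| = 2 by rewrite ger0_norm.
rewrite !normrM normrN normfV n2 => h.
have := sin_max ((x + y) / 2) => h2.
have := ler_pM (normr_ge0 _) (normr_ge0 _) h2 h.
lra.
Qed.

Lemma L2cvg_cos f_ f th : L2cvg P f_ f ->
  Ex P (fun w => cos (f_ n w + th)) @[n --> \oo] --> Ex P (fun w => cos (f w + th)).
Proof.
move=> /[dup] cf [Lf_ Lf _]; apply/subr_cvg0; apply: norm_cvg0.
have mcos g : L2 P g -> L1 P (fun w => cos (g w + th)).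
  move=> [mg _]; apply: (@L1_bounded _ _ _ _ _ 1) => [|w]; last exact: cos_max.
  by apply: (measurableT_comp (@measurable_cos R)); exact: measurable_funD.
apply: cvg0_le (L2cvg_norm cf) => n.
rewrite normr_ge0 /= -ExB; [|exact: mcos|exact: mcos].
apply: Ex_norm_le.
- by apply: L1B; exact: mcos.
- exact/L1_norm/L2_L1/L2B.
- move=> w; rewrite (le_trans (cos_lipschitz _ _))//.
  by rewrite opprD addrACA subrr addr0.
Qed.

End L2cvg.

Lemma sum1_le1 (R : numDomainType) (I : eqType) (s : seq I) (Q : pred I) :
  uniq s -> (forall x y, Q x -> Q y -> x = y) ->
  \sum_(x <- s | Q x) (1 : R) <= 1.
Proof.
move=> us QQ; elim: s us => [_|x s ih /= /andP[xs us]]; first by rewrite big_nil.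
rewrite big_cons; case: ifP => Qx; last exact: ih.
rewrite big_seq_cond big1 ?addr0// => y /andP[ys Qy].
by rewrite (QQ _ _ Qx Qy) ys in xs.
Qed.

Definition scaled_sum (T : Type) (R : nzRingType) (u : int -> T -> R) (a : R) (n : nat) (w : T) : R :=
  \sum_(1 <= t < n.+1) a * u t%:Z w.

(** * Moving averages as limits of finite averages *)

Section moving_average.
Context d (T : measurableType d) (R : realType) (P : probability T R)
  (eps u : int -> {RV P >-> R}) (b : nat -> R).
Hypothesis eps_iid : iid eps.
Hypothesis eps_mean : forall t, 'E_P[eps t]%E = 0%E.
Hypothesis eps_var : forall t, 'V_P[eps t]%E = 1%E.
Hypothesis u_ma : moving_average b eps u.
Hypothesis b_sum : \sum_(0 <= j < N) b j ^+ 2 @[N --> \oo] --> (1 : R).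

Definition ma_sum (N : nat) (t : int) (w : T) : R :=
  \sum_(0 <= j < N) b j * eps (t - j%:Z) w.

Lemma L2_ma_sum N t : L2 P (ma_sum N t).
Proof. by apply: L2_sum => j; apply: L2Z; exact: L2_noise. Qed.

(** Extended-real expectations that tend to 0 are finite for large N, which is what makes [u t]
    square integrable. *)
Lemma L2cvg_ma t : L2cvg P (ma_sum^~ t) (u t).
Proof.
have mu_ : measurable_fun setT (u t) by exact: measurable_funP.
have md N : measurable_fun setT (fun w => (u t w - ma_sum N t w) ^+ 2).
  by apply: measurable_funX; apply: measurable_funB => //; case: (L2_ma_sum N t).
have h := u_ma t; rewrite unlock in h.
have fin : \forall N \near \oo, L1 P (fun w => (u t w - ma_sum N t w) ^+ 2).
  have /fine_cvgP[+ _] := h; apply: filterS => N hN.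
  apply/integrableP; split; first exact/measurable_EFinP.
  under eq_integral do rewrite /= ger0_norm ?sqr_ge0//.
  by move: hN; rewrite fin_numElt => /andP[].
have Lu : L2 P (u t).
  case: fin => N _ /(_ N (leqnn N)) hN.
  have : L2 P (fun w => (u t w - ma_sum N t w) + ma_sum N t w).
    apply: L2D; last exact: L2_ma_sum.
    by split => //; apply: measurable_funB => //; case: (L2_ma_sum N t).
  by under eq_fun do rewrite subrK.
split => [N||]; [exact: L2_ma_sum|exact: Lu|].
have /fine_cvgP[_] := h; apply: cvg_trans; apply: near_eq_cvg; near=> N.
by congr fine; apply: eq_integral => w _; rewrite -sqrrN opprB.
Unshelve. all: by end_near. Qed.

Lemma L2_ma t : L2 P (u t).
Proof. by case: (L2cvg_ma t). Qed.

Let Ex_ma_sumM N s t : Ex P (fun w => ma_sum N s w * ma_sum N t w) =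
  \sum_(0 <= i < N) \sum_(0 <= j < N) b i * b j * (s - i%:Z == t - j%:Z)%:R.
Proof.
rewrite /ma_sum; under eq_Rintegral do rewrite big_distrlr /=.
have L (i j : nat) : L1 P (fun w => (b i * eps (s - i%:Z) w) * (b j * eps (t - j%:Z) w)).
  by apply: L1M; apply: L2Z; exact: L2_noise.
rewrite Ex_sum => [|i]; last exact: L1_sum.
apply: eq_bigr => i _; rewrite Ex_sum//; apply: eq_bigr => j _.
rewrite -(Ex_noiseM eps_iid eps_mean eps_var) -ExZ; last by apply: L1M; exact: L2_noise.
by apply: eq_Rintegral => w _; ring.
Qed.

(** Both sides are limits of double sums over the coefficients in which only the lag enters;
    exchanging the two summation indices accounts for its sign. *)
Lemma ma_stationary s t : Ex P (fun w => u s w * u t w) = second_moment u `|s - t|%N%:Z.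
Proof.
rewrite /second_moment fine_expectation.
have c1 := L2cvg_Ex_mul (L2cvg_ma s) (L2cvg_ma t).
have c2 := L2cvg_Ex_mul (L2cvg_ma 0) (L2cvg_ma `|s - t|%N%:Z).
apply: (cvg_unique _ c1) => //.
apply: cvg_trans c2; apply: near_eq_cvg; apply: nearW => N.
rewrite !Ex_ma_sumM; have [st|st] := leP t s.
  rewrite exchange_big /=; apply: eq_bigr => i _; apply: eq_bigr => j _.
  rewrite [b j * b i]mulrC; congr (_ * (nat_of_bool _)%:R).
  apply/eqP/eqP; lia.
apply: eq_bigr => i _; apply: eq_bigr => j _; congr (_ * (nat_of_bool _)%:R).
apply/eqP/eqP; lia.
Qed.

Lemma Ex_ma_lin (a : int -> R) (n : nat) :
  Ex P (fun w => (\sum_(1 <= t < n.+1) a t%:Z * u t%:Z w) ^+ 2) =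
  \sum_(1 <= s < n.+1) \sum_(1 <= t < n.+1)
    a s%:Z * a t%:Z * second_moment u `|s%:Z - t%:Z|%N%:Z.
Proof.
under eq_Rintegral do rewrite expr2 big_distrlr /=.
have L (i j : nat) : L1 P (fun w => (a i%:Z * u i%:Z w) * (a j%:Z * u j%:Z w)).
  by apply: L1M; apply: L2Z; exact: L2_ma.
rewrite Ex_sum => [|i]; last exact: L1_sum.
apply: eq_bigr => i _; rewrite Ex_sum//; apply: eq_bigr => j _.
rewrite -ma_stationary -ExZ; last by apply: L1M; exact: L2_ma.
by apply: eq_Rintegral => w _; ring.
Qed.

Let b_sum_le N : \sum_(0 <= j < N) b j ^+ 2 <= 1.
Proof.
rewrite -(cvg_lim _ b_sum)//.
apply: (@nondecreasing_cvgn_le _ (fun N => \sum_(0 <= j < N) b j ^+ 2)).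
  apply/nondecreasing_seqP => n; rewrite big_nat_recr //= lerDl; exact: sqr_ge0.
by apply/cvg_ex; eexists; exact: b_sum.
Qed.

Let index n N := [seq (t, j) | t <- index_iota 1 n.+1, j <- index_iota 0 N].

(* By AM-GM, |b_j| <= (sqrt n * b_j ^ 2 + 1 / sqrt n) / 2, and a given lag k
   occurs at most once for each t and for each j. *)
Let coef_le n N (a : R) k :
  `|\sum_(i <- index n N | (i.1%:Z - i.2%:Z == k)%R) a * b i.2| <=
  `|a| * Num.sqrt n%:R.
Proof.
rewrite -mulr_sumr normrM ler_wpM2l//.
have [->|n0] := posnP n; first by rewrite /index /= big_nil normr0.
have q0 : 0 < Num.sqrt n%:R :> R by rewrite sqrtr_gt0 ltr0n.
set q := Num.sqrt n%:R in q0 *.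
have qq : q ^+ 2 = n%:R by rewrite sqr_sqrtr.
apply: le_trans (ler_norm_sum _ _ _) _.
apply: (@le_trans _ _ (\sum_(i <- index n N | (i.1%:Z - i.2%:Z == k)%R)
    (q / 2 * b i.2 ^+ 2 + (2 * q)^-1))).
  apply: ler_sum => i _.
  rewrite -(ler_pM2l (_ : 0 < 2 * q)) ?mulr_gt0//.
  rewrite mulrDr mulfV ?gt_eqF ?mulr_gt0// -(sqr_abs (b i.2)).
  have := sqr_ge0 (q * `|b i.2| - 1); nra.
rewrite big_split /=.
have h1 : \sum_(i <- index n N | (i.1%:Z - i.2%:Z == k)%R) q / 2 * b i.2 ^+ 2 <= q / 2.
  rewrite -mulr_sumr ler_piMr ?divr_ge0 ?(ltW q0)//.
  rewrite big_mkcond big_allpairs exchange_big /=.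
  apply: le_trans (b_sum_le N); apply: ler_sum => j _.
  rewrite -big_mkcond /=.
  rewrite (eq_bigr (fun=> b j ^+ 2 * 1)) => [|i _]; last by rewrite mulr1.
  rewrite -mulr_sumr ler_piMr ?sqr_ge0//; apply: sum1_le1; first exact: iota_uniq.
  by move=> x y /eqP h1 /eqP h2; lia.
have h2 : \sum_(i <- index n N | (i.1%:Z - i.2%:Z == k)%R) (2 * q)^-1 <= q / 2.
  rewrite big_mkcond big_allpairs /=.
  apply: (@le_trans _ _ (\sum_(1 <= t < n.+1) (2 * q)^-1)).
    apply: ler_sum => t _; rewrite -big_mkcond /=.
    rewrite (eq_bigr (fun=> (2 * q)^-1 * 1)) => [|i _]; last by rewrite mulr1.
    rewrite -mulr_sumr ler_piMr ?invr_ge0 ?mulr_ge0 ?(ltW q0)//.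
    apply: sum1_le1; first exact: iota_uniq.
    by move=> x y /eqP h3 /eqP h4; lia.
  rewrite sumr_const_nat subSS subn0 -[_ *+ n]mulr_natr -qq le_eqVlt; apply/orP; left; apply/eqP.
  by field; rewrite gt_eqF.
lra.
Qed.

(** [coef_le] gives the smallness condition of [clt_lin_comb] uniformly in the truncation level N,
    so the bound survives N tending to infinity. *)
Lemma ma_clt_bound (eta : R) : 0 < eta -> exists2 c0 : R, 0 < c0 &
  forall n (a th : R), `|a| * Num.sqrt n%:R <= c0 ->
    `|Ex P (fun w => cos (scaled_sum u a n w + th)) -
      cos th * expR (- (Ex P (fun w => scaled_sum u a n w ^+ 2) / 2))|
    <= 2 * eta * Ex P (fun w => scaled_sum u a n w ^+ 2).
Proof.
move=> eta0.
have [c0 c00 hc0] := clt_lin_comb eps_iid eps_mean eps_var eta0.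
exists c0 => // n a th ac0; set S := scaled_sum u a n.
pose S_ N w := \sum_(1 <= t < n.+1) a * ma_sum N t%:Z w.
have cS : L2cvg P S_ S.
  by apply: L2cvg_sum => t; apply: L2cvgZ; exact: L2cvg_ma.
pose c N k := \sum_(i <- index n N | (i.1%:Z - i.2%:Z == k)%R) a * b i.2.
pose ks N := undup (map (fun i : nat * nat => i.1%:Z - i.2%:Z) (index n N)).
have S_E N w : S_ N w = lin_comb eps (c N) (ks N) w.
  rewrite -(regroup eps (index n N) (fun i => i.1%:Z - i.2%:Z) (fun i => a * b i.2)).
  rewrite /index big_allpairs; apply: eq_bigr => t _; rewrite /ma_sum mulr_sumr.
  by apply: eq_bigr => j _; rewrite mulrA.
have bnd N : `|Ex P (fun w => cos (S_ N w + th)) -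
    cos th * expR (- (Ex P (fun w => S_ N w ^+ 2) / 2))| <=
    2 * eta * Ex P (fun w => S_ N w ^+ 2).
  have E2 : Ex P (fun w => S_ N w ^+ 2) = \sum_(k <- ks N) c N k ^+ 2.
    rewrite -(Ex_lin_comb_sqr eps_iid eps_mean eps_var _ (undup_uniq _)).
    by apply: eq_Rintegral => w _; rewrite S_E.
  have -> : Ex P (fun w => cos (S_ N w + th)) =
      Ex P (fun w => cos (lin_comb eps (c N) (ks N) w + th)).
    by apply: eq_Rintegral => w _; rewrite S_E.
  rewrite E2 mulr_suml; apply: hc0; first exact: undup_uniq.
  by move=> k; apply: le_trans ac0; exact: coef_le.
have v := L2cvg_Ex_sqr cS.
have l1 : `|Ex P (fun w => cos (S_ N w + th)) -
    cos th * expR (- (Ex P (fun w => S_ N w ^+ 2) / 2))| @[N --> \oo] -->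
  `|Ex P (fun w => cos (S w + th)) - cos th * expR (- (Ex P (fun w => S w ^+ 2) / 2))|.
  apply: cvg_norm; apply: cvgB; first exact: L2cvg_cos.
  apply: cvgM; first exact: cvg_cst.
  apply: (@cvg_comp _ _ _ (fun N => - (Ex P (fun w => S_ N w ^+ 2) / 2)) expR); last exact: continuous_expR.
  by apply: cvgN; apply: cvgM => //; exact: cvg_cst.
have l2 : 2 * eta * Ex P (fun w => S_ N w ^+ 2) @[N --> \oo] -->
   2 * eta * Ex P (fun w => S w ^+ 2).
  by apply: cvgM => //; exact: cvg_cst.
rewrite -(cvg_lim _ l1)// -(cvg_lim _ l2)//; apply: ler_lim.
- by apply/cvg_ex; eexists; exact: l1.
- by apply/cvg_ex; eexists; exact: l2.
- by apply: nearW => N; exact: bnd.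
Qed.

End moving_average.

(** * Convergence in law from convergence of cosines *)

Section trig_cvg_in_law.
Context d d' (T : measurableType d) (T' : measurableType d') (R : realType)
  (P : probability T R) (P' : probability T' R).
Variables (W : nat -> T -> R) (Z : T' -> R) (V : R).
Hypothesis LW : forall n, L2 P (W n).
Hypothesis LZ : L2 P' Z.
Hypothesis WV : Ex P (fun w => W n w ^+ 2) @[n --> \oo] --> V.
Hypothesis W_cos : forall a th,
  Ex P (fun w => cos (a * W n w + th)) @[n --> \oo] --> Ex P' (fun w => cos (a * Z w + th)).

Let mcomp (f : R -> R) : continuous f -> (forall n, measurable_fun setT (fun w => f (W n w))) *
  measurable_fun setT (fun w => f (Z w)).
Proof.
move=> cf; have mf := continuous_measurable_fun cf.
by split => [n|]; apply: measurableT_comp => //; [case: (LW n)|case: LZ].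
Qed.

Let trig_cvg (p : R -> R) : trig_poly p ->
  Ex P (fun w => p (W n w)) @[n --> \oo] --> Ex P' (fun w => p (Z w)).
Proof.
move=> [s ->]; rewrite /trig_sum.
have mc (i : R * R * R) : continuous (fun x => i.1.1 * cos (i.1.2 * x + i.2)).
  move=> x; apply: cvgM; first exact: cvg_cst.
  apply: (@cvg_comp _ _ _ (fun y => i.1.2 * y + i.2) cos); last exact: continuous_cos.
  by apply: cvgD; [apply: cvgM => //; exact: cvg_cst|exact: cvg_cst].
have bc (i : R * R * R) x : `|i.1.1 * cos (i.1.2 * x + i.2)| <= `|i.1.1|.
  by rewrite normrM ler_piMr// ler_norml cos_le1 cos_geN1.
have LWi n (i : R * R * R) : L1 P (fun w => i.1.1 * cos (i.1.2 * W n w + i.2)).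
  by apply: L1_bounded => [|w]; [exact: ((mcomp (mc i)).1 n)|exact: bc].
have LZi (i : R * R * R) : L1 P' (fun w => i.1.1 * cos (i.1.2 * Z w + i.2)).
  by apply: L1_bounded => [|w]; [exact: (mcomp (mc i)).2|exact: bc].
have mc1 (a b : R) : continuous (fun x => cos (a * x + b)).
  have -> : (fun x => cos (a * x + b)) = (fun x => 1 * cos (a * x + b)).
    by apply/funext => x; rewrite mul1r.
  exact: mc (1, a, b).
have bc1 (a b x : R) : `|cos (a * x + b)| <= 1 by rewrite ler_norml cos_le1 cos_geN1.
elim: s => [|i s ih].
  under eq_Rintegral do rewrite big_nil; rewrite Ex_cst.
  by under eq_fun do (under eq_Rintegral do rewrite big_nil); under eq_fun do rewrite Ex_cst; exact: cvg_cst.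
have -> : Ex P' (fun w => \sum_(j <- i :: s) j.1.1 * cos (j.1.2 * Z w + j.2)) =
    Ex P' (fun w => i.1.1 * cos (i.1.2 * Z w + i.2)) +
    Ex P' (fun w => \sum_(j <- s) j.1.1 * cos (j.1.2 * Z w + j.2)).
  by under eq_Rintegral do rewrite big_cons; rewrite ExD//; exact: L1_sum.
rewrite (_ : (fun n => _) = (fun n => Ex P (fun w => i.1.1 * cos (i.1.2 * W n w + i.2)) +
    Ex P (fun w => \sum_(j <- s) j.1.1 * cos (j.1.2 * W n w + j.2)))); last first.
  by apply/funext => n; under eq_Rintegral do rewrite big_cons; rewrite ExD//; exact: L1_sum.
apply: cvgD => //; clear ih.
rewrite (_ : (fun n => _) = (fun n => i.1.1 * Ex P (fun w => cos (i.1.2 * W n w + i.2)))); last first.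
  apply/funext => n; rewrite ExZ//.
  by apply: L1_bounded => [|w]; [exact: ((mcomp (mc1 _ _)).1 _)|exact: bc1].
rewrite ExZ; last by apply: L1_bounded => [|w]; [exact: (mcomp (mc1 _ _)).2|exact: bc1].
by apply: cvgM => //; exact: cvg_cst.
Qed.

(** Bounded second moments replace a separate tightness argument: outside [-L, L] the difference
    between [f] and its approximation is at most 2 M, hence at most 2 M x^2 / L^2. *)
Lemma cvg_in_law_of_cos (f : R -> R) M : continuous f -> (forall x, `|f x| <= M) ->
  Ex P (fun w => f (W n w)) @[n --> \oo] --> Ex P' (fun w => f (Z w)).
Proof.
move=> cf fM; have M0 : 0 <= M by rewrite (le_trans _ (fM 0)).
apply/cvgrPdist_le => e e0.
have V0 : 0 <= V.
  rewrite -(cvg_lim _ WV)//; apply: limr_ge; first by apply/cvg_ex; eexists; exact: WV.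
  by apply: nearW => n; apply: Ex_ge0 => w; exact: sqr_ge0.
set q := Ex P' (fun w => Z w ^+ 2).
have q0 : 0 <= q by apply: Ex_ge0 => w; exact: sqr_ge0.
pose K := 1 + V + q.
have K0 : 0 < K by rewrite /K; lra.
(* Then 2 M K / L^2 <= e / 8, where [K] bounds both second moments for large n; [M + 1] keeps L
   positive when M = 0. *)
pose L := Num.sqrt (16 * (M + 1) * K / e).
have L2E : L ^+ 2 = 16 * (M + 1) * K / e.
  by rewrite sqr_sqrtr// divr_ge0 ?(ltW e0)// !mulr_ge0 ?(ltW K0)//; lra.
have L0 : 0 < L.
  by rewrite sqrtr_gt0 divr_gt0// !mulr_gt0//; lra.
have e8 : 0 < e / 8 by lra.
have [p [tp pM pf]] := trig_poly_approx cf fM L0 e8.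
have cp := continuous_trig_poly tp.
have ptw x : `|f x - p x| <= e / 8 + 2 * M / L ^+ 2 * x ^+ 2.
  have [xL|xL] := lerP `|x| L.
    rewrite distrC (le_trans (pf _ xL))// lerDl mulr_ge0 ?sqr_ge0//.
    by rewrite divr_ge0 ?sqr_ge0// mulr_ge0.
  apply: (@le_trans _ _ (2 * M)).
    by rewrite (le_trans (ler_normB _ _))// mulr_natl mulr2n lerD.
  apply: (@le_trans _ _ (2 * M / L ^+ 2 * x ^+ 2)); last by rewrite lerDr ltW.
  rewrite -mulrA ler_peMr ?mulr_ge0// mulrC ler_pdivlMr ?exprn_gt0// mul1r.
  by rewrite -[leRHS]sqr_abs; apply: lerXn2r; rewrite ?nnegrE ?(ltW L0) ?(ltW xL) ?normr_ge0.
have Lbd d1 (T1 : measurableType d1) (P1 : probability T1 R) (X : T1 -> R) : L2 P1 X ->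
    `|Ex P1 (fun w => f (X w)) - Ex P1 (fun w => p (X w))| <=
    e / 8 + 2 * M / L ^+ 2 * Ex P1 (fun w => X w ^+ 2).
  move=> [mX LX].
  have Lf : L1 P1 (fun w => f (X w)).
    apply: (@L1_bounded _ _ _ _ _ M) => // ; apply: measurableT_comp => //.
    exact: continuous_measurable_fun.
  have Lp : L1 P1 (fun w => p (X w)).
    apply: (@L1_bounded _ _ _ _ _ M) => // ; apply: measurableT_comp => //.
    exact: continuous_measurable_fun.
  rewrite -ExB// -[X in X + _](Ex_cst P1) -ExZ// -ExD; [|exact: L1_cst|exact: L1Z].
  by apply: Ex_norm_le => [||w]; [exact: L1B|apply: L1D; [exact: L1_cst|exact: L1Z]|exact: ptw].
have small x : 0 <= x -> x <= K -> 2 * M / L ^+ 2 * x <= e / 8.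
  move=> x0 xK; rewrite L2E.
  have -> : 2 * M / (16 * (M + 1) * K / e) * x = e / 8 * (M / (M + 1) * (x / K)).
    have M1 : M + 1 != 0 by lra.
    by have := lt0r_neq0 e0; have := lt0r_neq0 K0 => K1 e1; field; rewrite K1 M1 e1.
  have M1 : 0 < M + 1 by lra.
  rewrite ler_piMr ?(ltW e8)// mulr_ile1 ?(divr_ge0 M0 (ltW M1)) ?(divr_ge0 x0 (ltW K0))//.
    by rewrite ler_pdivrMr// mul1r; lra.
  by rewrite ler_pdivrMr// mul1r.
have Wq : \forall n \near \oo, Ex P (fun w => W n w ^+ 2) <= K.
  move/cvgrPdist_le : WV => /(_ 1 ltr01); apply: filterS => n.
  by rewrite ler_distl /K => /andP[+ _]; lra.
have e4 : 0 < e / 4 by lra.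
have := trig_cvg tp => /cvgrPdist_le/(_ _ e4).
apply: filterS2 Wq => n Wn pn.
have h1 := Lbd _ _ _ _ (LW n).
have h2 := Lbd _ _ _ _ LZ.
have s1 := small _ (Ex_ge0 P (fun w => sqr_ge0 (W n w))) Wn.
have s2 : 2 * M / L ^+ 2 * q <= e / 8 by apply: small => //; rewrite /K; lra.
rewrite -/q in h2.
move: h1 h2 pn; rewrite !ler_distl => /andP[? ?] /andP[? ?] /andP[? ?].
by apply/andP; split; lra.
Qed.

End trig_cvg_in_law.

(** * Partial sums with power-law autocovariance *)

Section moving_average_clt.
Context d (T : measurableType d) (R : realType) (P : probability T R)
  (eps u : int -> {RV P >-> R}) (b : nat -> R) (H c : R).
Hypothesis eps_iid : iid eps.
Hypothesis eps_mean : forall t, 'E_P[eps t]%E = 0%E.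
Hypothesis eps_var : forall t, 'V_P[eps t]%E = 1%E.
Hypothesis u_ma : moving_average b eps u.
Hypothesis b_sum : \sum_(0 <= j < N) b j ^+ 2 @[N --> \oo] --> (1 : R).
Hypothesis H_range : 2^-1 < H < 1.
Hypothesis gamma_cvg : second_moment u n%:Z * n%:R `^ (2 * (1 - H)) @[n --> \oo] --> c.

Let W n := scaled_sum u (n%:R `^ (- H)) n.

Lemma Ex_scaled_sum_sqr a n : Ex P (fun w => scaled_sum u a n w ^+ 2) =
  a ^+ 2 * toeplitz_sum (fun k => second_moment u k%:Z) n.
Proof.
have := Ex_ma_lin eps_iid eps_mean eps_var u_ma (fun=> a) n => /= ->.
rewrite /toeplitz_sum mulr_sumr; apply: eq_bigr => s _.
by rewrite mulr_sumr; apply: eq_bigr => t _; rewrite expr2.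
Qed.

Lemma L2_scaled_sum a n : L2 P (scaled_sum u a n).
Proof. by apply: L2_sum => t; apply: L2Z; exact: (L2_ma eps_mean eps_var u_ma). Qed.

(** [toeplitz_sum_cvg] at exponent 2 (1 - H): the constant 2 c / ((2 H - 1) 2 H) is the limit
    variance. *)
Lemma ma_sum_var_cvg : Ex P (fun w => W n w ^+ 2) @[n --> \oo] --> c / (H * (2 * H - 1)).
Proof.
have /andP[H1 H2] := H_range.
have b01 : 0 < 2 * (1 - H) < 1 by apply/andP; split; lra.
have := toeplitz_sum_cvg b01 gamma_cvg.
have -> : 2 - 2 * (1 - H) = 2 * H by ring.
have -> : 2 * c / ((1 - 2 * (1 - H)) * (2 * H)) = c / (H * (2 * H - 1)).
  by field; do ?[apply/andP; split]; lra.
apply: cvg_trans; apply: near_eq_cvg; apply: nearW => n.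
rewrite Ex_scaled_sum_sqr mulrC; congr (_ * _).
by rewrite -powR_mulrn ?powR_ge0// -powRrM mulNr powRN mulrC.
Qed.

(** Since H > 1/2, |a| n^(-H) sqrt n tends to 0, so the smallness condition of [ma_clt_bound]
    eventually holds for every eta. *)
Lemma ma_sum_cos_cvg a th : Ex P (fun w => cos (a * W n w + th)) @[n --> \oo] -->
  cos th * expR (- (a ^+ 2 * (c / (H * (2 * H - 1))) / 2)).
Proof.
have /andP[H1 H2] := H_range.
set V := c / _.
have E n w : a * W n w = scaled_sum u (a * n%:R `^ (- H)) n w.
  by rewrite /W /scaled_sum mulr_sumr; apply: eq_bigr => t _; rewrite mulrA.
have qE n : Ex P (fun w => scaled_sum u (a * n%:R `^ (- H)) n w ^+ 2) =
    a ^+ 2 * Ex P (fun w => W n w ^+ 2).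
  by rewrite !Ex_scaled_sum_sqr exprMn mulrA.
have cV := ma_sum_var_cvg; rewrite -/V in cV.
have caV : a ^+ 2 * Ex P (fun w => W n w ^+ 2) @[n --> \oo] --> a ^+ 2 * V.
  by apply: cvgM => //; exact: cvg_cst.
have g_cvg : cos th * expR (- (a ^+ 2 * Ex P (fun w => W n w ^+ 2) / 2)) @[n --> \oo]
    --> cos th * expR (- (a ^+ 2 * V / 2)).
  apply: cvgM; first exact: cvg_cst.
  apply: (@cvg_comp _ _ _ (fun N => - (a ^+ 2 * Ex P (fun w => W N w ^+ 2) / 2)) expR); last exact: continuous_expR.
  by apply: cvgN; apply: cvgM => //; exact: cvg_cst.
suff d_cvg : Ex P (fun w => cos (a * W n w + th)) -
    cos th * expR (- (a ^+ 2 * Ex P (fun w => W n w ^+ 2) / 2)) @[n --> \oo] --> (0 : R).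
  rewrite -[X in _ --> X]add0r (_ : (fun n => _) = (fun n =>
      (Ex P (fun w => cos (a * W n w + th)) -
       cos th * expR (- (a ^+ 2 * Ex P (fun w => W n w ^+ 2) / 2))) +
      cos th * expR (- (a ^+ 2 * Ex P (fun w => W n w ^+ 2) / 2)))); first exact: cvgD.
  by apply/funext => n; rewrite subrK.
apply/cvgrPdist_le => e e0.
pose K := a ^+ 2 * V + 1.
have K0 : 0 < `|K| + 1 by rewrite ltr_wpDl.
pose eta := e / (2 * (`|K| + 1)).
have eta0 : 0 < eta by rewrite divr_gt0// mulr_gt0.
have [c0 c00 hc] := ma_clt_bound eps_iid eps_mean eps_var u_ma b_sum eta0.
have small : `|a| * n%:R `^ (- (H - 2^-1)) @[n --> \oo] --> (0 : R).
  rewrite -[X in _ --> X](mulr0 `|a|); apply: cvgM; first exact: cvg_cst.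
  by apply: cvg_powRN; lra.
have N1 : \forall n \near \oo, `|a * n%:R `^ (- H)| * Num.sqrt n%:R <= c0.
  move/cvgrPdist_le : small => /(_ _ c00); apply: filterS2 (nbhs_infty_gt 0%N) => n n0.
  rewrite sub0r normrN; apply: le_trans; apply: le_trans (ler_norm _).
  rewrite normrM (ger0_norm (powR_ge0 _ _)) -mulrA -powR12_sqrt ?ler0n//.
  rewrite -powRD; last by rewrite pnatr_eq0 -lt0n n0 implybT.
  by rewrite (_ : - H + 2^-1 = - (H - 2^-1))//; lra.
have N2 : \forall n \near \oo, a ^+ 2 * Ex P (fun w => W n w ^+ 2) <= K.
  move/cvgrPdist_le : caV => /(_ 1 ltr01); apply: filterS => n.
  by rewrite ler_distl /K => /andP[+ _]; lra.
apply: filterS2 N1 N2 => n n1 n2.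
rewrite sub0r normrN.
have := hc n _ th n1; rewrite qE => h.
under eq_Rintegral do rewrite E.
apply: (le_trans h).
apply: (@le_trans _ _ (2 * eta * (`|K| + 1))).
  rewrite ler_pM2l ?mulr_gt0//; have := ler_norm K; lra.
by rewrite /eta le_eqVlt; apply/orP; left; apply/eqP; field; lra.
Qed.

Lemma ma_clt d' (T' : measurableType d') (P' : probability T' R) (Z : {RV P' >-> R})
    (f : R -> R) (M : R) : normal_rv P' Z 0 (c / (H * (2 * H - 1))) ->
  continuous f -> (forall x, `|f x| <= M) ->
  Ex P (fun w => f (W n w)) @[n --> \oo] --> Ex P' (fun w => f (Z w)).
Proof.
move=> ZN cf fM.
have mZ : measurable_fun setT Z by exact: measurable_funP.
apply: (cvg_in_law_of_cos (V := c / (H * (2 * H - 1))) _ _ _ _ cf fM).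
- by move=> n; exact: L2_scaled_sum.
- exact: (normal_rv_L2 mZ ZN).
- exact: ma_sum_var_cvg.
- move=> a th; rewrite (normal_rv_cos mZ ZN) mulr0 add0r.
  exact: ma_sum_cos_cvg.
Qed.

End moving_average_clt.

(** * Sums over the design *)

Section gaussian_design.
Context d (T : measurableType d) (R : realType) (P : probability T R)
  (X Y : int -> {RV P >-> R}) (mu gamma : R).
Hypothesis XY_stationary : strictly_stationary X Y.
Hypothesis X_gauss : gaussian_process X.
Hypothesis X_mean : forall t, 'E_P[X t]%E = mu%:E.
Hypothesis X_variance : forall t, 'V_P[X t]%E = (gamma ^+ 2)%:E.
Hypothesis gamma0 : 0 < gamma ^+ 2.

Let mX t : measurable_fun setT (X t). Proof. exact: measurable_funP. Qed.

Let ExX t : Ex P (X t) = mu.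
Proof. by rewrite -fine_expectation X_mean. Qed.

Let VarX t : Ex P (fun w => (X t w - mu) ^+ 2) = gamma ^+ 2.
Proof.
have := X_variance t; rewrite /variance unlock X_mean => /(congr1 fine).
by rewrite fine_expectation.
Qed.

Lemma design_normal t : normal_rv P (X t) mu (gamma ^+ 2).
Proof.
have [m [v h]] := X_gauss (n := 1%N) (fun=> t) (fun=> 1).
rewrite (_ : (fun w => _) = X t) in h; last first.
  by apply/funext => w; rewrite big_ord1 mul1r.
have mm := normal_rv_mean (mX t) h; rewrite ExX in mm.
have := normal_rv_var (mX t) h; rewrite -mm VarX => vv.
by rewrite mm vv.
Qed.

Lemma L2_design t : L2 P (X t).
Proof. exact: (normal_rv_L2 (mX t) (design_normal t)). Qed.

Lemma same_law_design s t (A : set R) : measurable A ->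
  P (X s @^-1` A) = P (X t @^-1` A).
Proof. by move=> mA; rewrite !(design_normal _).2. Qed.

Lemma Ex_design (f : R -> R) t : measurable_fun setT f ->
  Ex P (fun w => f (X t w)) = Ex P (fun w => f (X 0 w)).
Proof.
by move=> mf; apply: (same_law_Ex (f := f) (mX t) (mX 0)) => // A mA; exact: same_law_design.
Qed.

Lemma L1_design (f : R -> R) t : measurable_fun setT f ->
  L1 P (fun w => f (X 0 w)) -> L1 P (fun w => f (X t w)).
Proof.
move=> mf; apply: (same_law_L1 (f := f) (mX t) (mX 0)) => // A mA; exact: same_law_design.
Qed.

Lemma L2_design_comp (f : R -> R) t : measurable_fun setT f ->
  L2 P (fun w => f (X 0 w)) -> L2 P (fun w => f (X t w)).
Proof.
move=> mf [_ h]; split; first exact: (measurableT_comp mf (mX t)).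
apply: (L1_design (f := fun x => f x ^+ 2)) => //.
exact: measurable_funX.
Qed.

(** Stationarity at the times 0 and t - s, shifted by s, applied to a function that reads only the
    first component of each pair. *)
Let center_mul s t : Ex P (fun w => (X s w - mu) * (X t w - mu)) =
  Ex P (fun w => (X 0 w - mu) * (X (t - s) w - mu)).
Proof.
pose tt (i : 'I_2) : int := if val i == 0%N then 0 else t - s.
pose f (p : 2.-tuple (R * R)) : R := ((tnth p ord0).1 - mu) * ((tnth p ord_max).1 - mu).
have mt (v : 'I_2 -> int) : measurable_fun setT
    (fun w => [tuple (X (v i) w, Y (v i) w) | i < 2]).
  apply/measurable_fun_tnthP => i; rewrite (_ : _ \o _ = fun w => (X (v i) w, Y (v i) w)); last first.
    by apply/funext => w /=; rewrite tnth_mktuple.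
  exact/measurable_fun_pairP.
have mf : measurable_fun setT f.
  apply: measurable_funM; apply: measurable_funB => //.
  - by apply: (@measurableT_comp _ _ _ _ _ _ fst) => //; exact: measurable_tnth.
  - by apply: (@measurableT_comp _ _ _ _ _ _ fst) => //; exact: measurable_tnth.
have := same_law_Ex (mt _) (mt _) (XY_stationary tt s) mf.
rewrite /f /comp; under eq_Rintegral do rewrite !tnth_mktuple.
under [in RHS]eq_Rintegral do rewrite !tnth_mktuple.
by rewrite /tt /= add0r subrK => <-.
Qed.

Lemma design_autocov s t : Ex P (fun w => (X s w - mu) * (X t w - mu)) =
  autocov X `|s - t|%N%:Z.
Proof.
have E k : autocov X k = Ex P (fun w => (X 0 w - mu) * (X k w - mu)).
  by rewrite /autocov unlock !X_mean fine_expectation.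
rewrite E; have [st|st] := leP s t.
  by rewrite center_mul (_ : t - s = `|s - t|%N%:Z)//; lia.
rewrite (_ : (fun w => _) = (fun w => (X t w - mu) * (X s w - mu))); last first.
  by apply/funext => w; rewrite mulrC.
by rewrite (center_mul t s) (_ : s - t = `|s - t|%N%:Z)//; lia.
Qed.

Definition design_corr (k : nat) : R := autocov X k%:Z / gamma ^+ 2.

Let L2c t : L2 P (fun w => X t w - mu).
Proof. by apply: L2B; [exact: L2_design|exact: L2_cst]. Qed.

Lemma design_corr_le1 k : `|design_corr k| <= 1.
Proof.
have := cauchy_schwarz (L2c k%:Z) (L2c 0).
rewrite design_autocov subr0 absz_nat !VarX -expr2 -[X in X <= _]sqr_abs => h.
have g0 : 0 <= gamma ^+ 2 := ltW gamma0.
rewrite /design_corr normrM normfV (ger0_norm g0) ler_pdivrMr// mul1r.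
by rewrite -(ler_pXn2r (n := 2))// nnegrE.
Qed.

(** The normality hypothesis of [gebelein]: the Gaussian process supplies some mean and variance,
    which are identified by computing the first two moments. *)
Lemma design_pair s t (a b : R) : normal_rv P (fun w => a * X s w + b * X t w)
  (a * mu + b * mu)
  (gamma ^+ 2 * (a ^+ 2 + b ^+ 2 + 2 * a * b * design_corr `|s - t|%N)).
Proof.
have [m [v h]] := X_gauss (n := 2%N) (fun i => if val i == 0%N then s else t)
  (fun i => if val i == 0%N then a else b).
rewrite (_ : (fun w => _) = (fun w => a * X s w + b * X t w)) in h; last first.
  by apply/funext => w; rewrite !big_ord_recl big_ord0 /= addr0.
have mZ : measurable_fun setT (fun w => a * X s w + b * X t w).
  by apply: measurable_funD; exact: measurable_funM.
have L r : L1 P (X r) by exact/L2_L1/L2_design.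
have mm := normal_rv_mean mZ h.
rewrite ExD ?ExZ ?ExX in mm; [|exact: L..|exact: L1Z|exact: L1Z].
have := normal_rv_var mZ h; rewrite -mm => vv.
suff <- : v = gamma ^+ 2 * (a ^+ 2 + b ^+ 2 + 2 * a * b * design_corr `|s - t|%N) by rewrite mm.
rewrite -vv.
have Lp r r' c : L1 P (fun w => c * ((X r w - mu) * (X r' w - mu))).
  by apply/L1Z/L1M.
rewrite (_ : (fun w => _) = (fun w => a ^+ 2 * ((X s w - mu) * (X s w - mu)) +
   b ^+ 2 * ((X t w - mu) * (X t w - mu)) + 2 * a * b * ((X s w - mu) * (X t w - mu)))); last first.
  by apply/funext => w; ring.
have S r : Ex P (fun w => (X r w - mu) * (X r w - mu)) = gamma ^+ 2.
  by rewrite -(VarX r); apply: eq_Rintegral => w _; rewrite expr2.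
have Lq r r' : L1 P (fun w => (X r w - mu) * (X r' w - mu)) by exact: L1M.
rewrite ExD; [|exact: L1D|exact: Lp].
rewrite ExD; [|exact: Lp..].
rewrite !ExZ // !S design_autocov /design_corr.
by field; rewrite -sqrf_eq0 gt_eqF.
Qed.

Lemma design_gebelein (f : R -> R) s t : measurable_fun setT f ->
  L2 P (fun w => f (X 0 w)) ->
  `|Ex P (fun w => f (X s w) * f (X t w)) - Ex P (fun w => f (X 0 w)) ^+ 2| <=
  `|design_corr `|s - t|%N| * Ex P (fun w => f (X 0 w) ^+ 2).
Proof.
move=> mf Lf.
rewrite -(Ex_design s mf) -(Ex_design (f := fun x => f x ^+ 2) s); last exact: measurable_funX.
apply: (gebelein (mX s) (mX t) gamma0 (design_corr_le1 _) (design_normal s) (design_normal t) (design_pair s t)) => //.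
exact: L2_design_comp.
Qed.

Lemma design_center_gebelein (f : R -> R) s t : measurable_fun setT f ->
  L2 P (fun w => f (X 0 w)) ->
  `|Ex P (fun w => (f (X s w) - Ex P (fun w => f (X 0 w))) *
                   (f (X t w) - Ex P (fun w => f (X 0 w))))| <=
  `|design_corr `|s - t|%N| * Ex P (fun w => f (X 0 w) ^+ 2).
Proof.
move=> mf Lf; set m := Ex P (fun w => f (X 0 w)).
have Ls r : L2 P (fun w => f (X r w)) by exact: L2_design_comp.
suff -> : Ex P (fun w => (f (X s w) - m) * (f (X t w) - m)) =
    Ex P (fun w => f (X s w) * f (X t w)) - m ^+ 2 by exact: design_gebelein.
rewrite (_ : (fun w => _) = (fun w => f (X s w) * f (X t w) - (m * f (X s w) + m * f (X t w) - m ^+ 2))); last first.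
  by apply/funext => w; ring.
have L r : L1 P (fun w => f (X r w)) by exact: L2_L1.
have Lz r : L1 P (fun w => m * f (X r w)) by exact: L1Z.
rewrite ExB; [|exact: L1M|]; last by apply: L1B; [exact: L1D|exact: L1_cst].
rewrite ExB; [|exact: L1D|exact: L1_cst].
rewrite Ex_cst ExD// !ExZ// (Ex_design s mf) (Ex_design t mf) -/m.
by ring.
Qed.

End gaussian_design.

(** * Independence of two processes *)

Notation process_sigma_type X :=
  (g_sigma_algebraType (\bigcup_t preimage_set_system setT (X t) measurable)).

Lemma cvg_sumr (R : realType) (I : Type) (s : seq I) (f : I -> nat -> R) (l : I -> R) :
  (forall i, f i n @[n --> \oo] --> l i) ->
  \sum_(i <- s) f i n @[n --> \oo] --> \sum_(i <- s) l i.
Proof.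
move=> fl; elim: s => [|i s ih].
  by rewrite big_nil; under eq_fun do rewrite big_nil; exact: cvg_cst.
by rewrite big_cons; under eq_fun do rewrite big_cons; exact: cvgD.
Qed.

Section independent_processes.
Context d (T : measurableType d) (R : realType) (P : probability T R).

Lemma measurable_process_sigma (X : int -> {RV P >-> R}) t :
  measurable_fun (setT : set (process_sigma_type X)) (X t : process_sigma_type X -> R).
Proof. by move=> _ A mA; apply: sub_sigma_algebra; exists t => //; exists A. Qed.

(** Giving the sample space the sigma-algebra of a process lets the usual closure lemmas show that a
    variable depends on that process only. *)
Lemma independent_processes_L1M (X Y : int -> {RV P >-> R}) (V W : T -> R) :
  independent_processes X Y ->
  measurable_fun (setT : set (process_sigma_type X)) V ->
  measurable_fun (setT : set (process_sigma_type Y)) W ->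
  L1 P V -> L1 P W ->
  L1 P (fun w => V w * W w) /\ Ex P (fun w => V w * W w) = Ex P V * Ex P W.
Proof.
move=> XY mV mW LV LW; apply: indep_L1M => // A B mA mB.
apply: XY.
- by rewrite -[X in sigma_process _ X]setTI; exact: mV.
- by rewrite -[X in sigma_process _ X]setTI; exact: mW.
Qed.

End independent_processes.

(** * Weighted sums of the errors *)

Section long_memory_sums.
Context d (T : measurableType d) (R : realType) (P : probability T R)
  (X Y u eps : int -> {RV P >-> R}) (b : nat -> R) (mu gamma : R).
Hypothesis XY_stationary : strictly_stationary X Y.
Hypothesis eps_iid : iid eps.
Hypothesis eps_mean : forall t, 'E_P[eps t]%E = 0%E.
Hypothesis eps_var : forall t, 'V_P[eps t]%E = 1%E.
Hypothesis eps_X_indep : independent_processes eps X.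
Hypothesis u_ma : moving_average b eps u.
Hypothesis X_gauss : gaussian_process X.
Hypothesis X_mean : forall t, 'E_P[X t]%E = mu%:E.
Hypothesis X_variance : forall t, 'V_P[X t]%E = (gamma ^+ 2)%:E.
Hypothesis gamma0 : 0 < gamma ^+ 2.

Let mX t : measurable_fun setT (X t). Proof. exact: measurable_funP. Qed.
Let m_ma N t : measurable_fun (setT : set (process_sigma_type eps)) (ma_sum eps b N t).
Proof.
apply: measurable_sum => j; apply: measurable_funM => //.
exact: measurable_process_sigma.
Qed.
Let L2g (g : R -> R) t : measurable_fun setT g -> L2 P (fun w => g (X 0 w)) ->
  L2 P (fun w => g (X t w)).
Proof. exact: (L2_design_comp X_gauss X_mean X_variance). Qed.
Let rho := design_corr X gamma.

(** Independence is between [eps] and [X], and a finite average is measurable for [eps], whereas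
    [u t] is only a mean-square limit. *)
Lemma Ex_design_ma (g : R -> R) N s t : measurable_fun setT g ->
  L2 P (fun w => g (X 0 w)) ->
  L1 P (fun w => (g (X s w) * ma_sum eps b N s w) * (g (X t w) * ma_sum eps b N t w)) /\
  Ex P (fun w => (g (X s w) * ma_sum eps b N s w) * (g (X t w) * ma_sum eps b N t w)) =
  Ex P (fun w => g (X s w) * g (X t w)) *
  Ex P (fun w => ma_sum eps b N s w * ma_sum eps b N t w).
Proof.
move=> mg Lg.
have Lr r : L2 P (fun w => g (X r w)) by exact: L2g.
have [] := @independent_processes_L1M _ _ _ _ _ _
  (fun w => ma_sum eps b N s w * ma_sum eps b N t w)
  (fun w => g (X s w) * g (X t w)) eps_X_indep.
- by apply: measurable_funM; exact: m_ma.
- apply: measurable_funM; (apply: (measurableT_comp mg); exact: measurable_process_sigma).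
- by apply: L1M; exact: L2_ma_sum.
- by apply: L1M; exact: Lr.
have -> : (fun w => ma_sum eps b N s w * ma_sum eps b N t w * (g (X s w) * g (X t w))) =
   (fun w => (g (X s w) * ma_sum eps b N s w) * (g (X t w) * ma_sum eps b N t w)).
  by apply/funext => w; ring.
by move=> ? ->; rewrite mulrC.
Qed.

Definition weighted_sum (g : R -> R) (a : R) (n : nat) (w : T) : R :=
  \sum_(1 <= t < n.+1) a * (g (X t%:Z w) * u t%:Z w).

(** Up to E g^2 and the scaling, the majorant of the second moment of a centred weighted sum. *)
Definition corr_sum (n : nat) : R :=
  toeplitz_sum (fun k => `|rho k * second_moment u k%:Z|) n.

Lemma L1_weighted_sum g a n : measurable_fun setT g ->
  L2 P (fun w => g (X 0 w)) -> L1 P (weighted_sum g a n).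
Proof.
move=> mg Lg; apply: L1_sum => t; apply: L1Z; apply: L1M.
  exact: L2g.
exact: (L2_ma eps_mean eps_var u_ma).
Qed.

(** The second moment is bounded for finite averages. Replacing them by [u] is controlled only in
    mean, because the product of g(X_t) with a mean-square null sequence vanishes in L1 by
    Cauchy-Schwarz; hence the first moment on the left. *)
Theorem centered_weighted_sum_le (g : R -> R) a n : measurable_fun setT g ->
  L2 P (fun w => g (X 0 w)) ->
  Ex P (fun w => `|weighted_sum (fun x => g x - Ex P (fun w => g (X 0 w))) a n w|) <=
  Num.sqrt (a ^+ 2 * (Ex P (fun w => g (X 0 w) ^+ 2) * corr_sum n)).
Proof.
move=> mg Lg; set m := Ex P (fun w => g (X 0 w)); set M := Ex P (fun w => g (X 0 w) ^+ 2).
pose g0 x := g x - m.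
have mg0 : measurable_fun setT g0 by exact: measurable_funB.
have Lg0 : L2 P (fun w => g0 (X 0 w)) by apply: L2B => //; exact: L2_cst.
have Lg0r r : L2 P (fun w => g0 (X r w)) by exact: L2g.
pose D_ N w := \sum_(1 <= t < n.+1) a * (g0 (X t%:Z w) * ma_sum eps b N t%:Z w).
have LD1 N t : L2 P (fun w => g0 (X t w) * ma_sum eps b N t w).
  split; first by apply: measurable_funM; [case: (Lg0r t)|case: (L2_ma_sum b eps_mean eps_var N t)].
  by under eq_fun do rewrite expr2; case: (Ex_design_ma N t t mg0 Lg0).
have LD N : L2 P (D_ N) by apply: L2_sum => t; exact: L2Z.
have gam s t := L2cvg_Ex_mul (L2cvg_ma eps_mean eps_var u_ma s) (L2cvg_ma eps_mean eps_var u_ma t).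
(* Gebelein's bound for the design correlations times the moments of the finite averages. *)
pose V_ N := \sum_(1 <= s < n.+1) \sum_(1 <= t < n.+1) a ^+ 2 *
  (`|rho `|s%:Z - t%:Z|%N| * M * `|Ex P (fun w => ma_sum eps b N s%:Z w * ma_sum eps b N t%:Z w)|).
have DV N : Ex P (fun w => D_ N w ^+ 2) <= V_ N.
  have L1D s t : L1 P (fun w => (a * (g0 (X s w) * ma_sum eps b N s w)) *
     (a * (g0 (X t w) * ma_sum eps b N t w))).
    by apply: L1M; exact: L2Z.
  rewrite (_ : (fun w => _) = (fun w => \sum_(1 <= s < n.+1) \sum_(1 <= t < n.+1)
      (a * (g0 (X s%:Z w) * ma_sum eps b N s%:Z w)) *
      (a * (g0 (X t%:Z w) * ma_sum eps b N t%:Z w)))); last first.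
    by apply/funext => w; rewrite expr2 /D_ big_distrlr.
  rewrite Ex_sum => [|s]; last exact: L1_sum.
  apply: ler_sum => s _; rewrite Ex_sum//; apply: ler_sum => t _.
  rewrite (_ : (fun w => _) = (fun w => a ^+ 2 * ((g0 (X s%:Z w) * ma_sum eps b N s%:Z w) *
      (g0 (X t%:Z w) * ma_sum eps b N t%:Z w)))); last by apply/funext => w; ring.
  have [L E] := Ex_design_ma N s%:Z t%:Z mg0 Lg0.
  rewrite ExZ// E ler_wpM2l ?sqr_ge0//.
  apply: (le_trans (ler_norm _)); rewrite normrM ler_wpM2r//.
  have h := design_center_gebelein XY_stationary X_gauss X_mean X_variance gamma0 s%:Z t%:Z mg Lg.
  exact: h.
have V_cvg : V_ N @[N --> \oo] --> a ^+ 2 * (M * corr_sum n).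
  rewrite /corr_sum /toeplitz_sum mulr_sumr mulr_sumr.
  apply: cvg_sumr => s; rewrite mulr_sumr mulr_sumr; apply: cvg_sumr => t.
  have -> : a ^+ 2 * (M * `|rho `|s%:Z - t%:Z|%N * second_moment u `|s%:Z - t%:Z|%N%:Z|) =
    a ^+ 2 * (`|rho `|s%:Z - t%:Z|%N| * M * `|second_moment u `|s%:Z - t%:Z|%N%:Z|).
    by rewrite normrM; ring.
  apply: cvgM; first exact: cvg_cst.
  apply: cvgM; first exact: cvg_cst.
  apply: cvg_norm; rewrite -(ma_stationary eps_iid eps_mean eps_var u_ma); exact: gam.
(* The Cauchy-Schwarz cost of replacing [u] by the finite averages. *)
pose rem N := \sum_(1 <= t < n.+1) `|a| * (Num.sqrt (Ex P (fun w => g0 (X t%:Z w) ^+ 2)) *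
  Num.sqrt (Ex P (fun w => (ma_sum eps b N t%:Z w - u t%:Z w) ^+ 2))).
have rem_cvg : rem N @[N --> \oo] --> (0 : R).
  rewrite (_ : 0 = \sum_(1 <= t < n.+1) (0 : R)); last by rewrite big1.
  apply: cvg_sumr => t; rewrite -(mulr0 `|a|); apply: cvgM; first exact: cvg_cst.
  rewrite -(mulr0 (Num.sqrt (Ex P (fun w => g0 (X t%:Z w) ^+ 2)))).
  apply: cvgM; first exact: cvg_cst.
  by apply: cvg_sqrt0; case: (L2cvg_ma eps_mean eps_var u_ma t%:Z).
have Lw : L1 P (weighted_sum g0 a n) by exact: L1_weighted_sum.
have bnd N : Ex P (fun w => `|weighted_sum g0 a n w|) <= Num.sqrt (V_ N) + rem N.
  have Lu t : L2 P (u t) := L2_ma eps_mean eps_var u_ma t.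
  have Ld t : L2 P (fun w => ma_sum eps b N t w - u t w).
    by apply: L2B => //; exact: L2_ma_sum.
  have Lgd t : L1 P (fun w => `|g0 (X t w) * (ma_sum eps b N t w - u t w)|).
    by apply: L1_norm; exact: L1M.
  apply: (@le_trans _ _ (Ex P (fun w => `|D_ N w| + \sum_(1 <= t < n.+1)
     `|a| * `|g0 (X t%:Z w) * (ma_sum eps b N t%:Z w - u t%:Z w)|))).
    apply: Ex_le => [||w]; first exact: L1_norm.
      apply: L1D; first by apply: L1_norm; exact: L2_L1.
      by apply: L1_sum => t; exact: L1Z.
    have -> : weighted_sum g0 a n w = D_ N w - \sum_(1 <= t < n.+1)
       a * (g0 (X t%:Z w) * (ma_sum eps b N t%:Z w - u t%:Z w)).
      by rewrite /D_ -sumrB; apply: eq_bigr => t _; ring.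
    apply: (le_trans (ler_normB _ _)); rewrite lerD2l.
    by apply: (le_trans (ler_norm_sum _ _ _)); apply: ler_sum => t _; rewrite normrM.
  rewrite ExD; [|by apply: L1_norm; exact: L2_L1|by apply: L1_sum => t; exact: L1Z].
  rewrite lerD//.
    by apply: (le_trans (Ex_norm_sqrt (LD N))); exact: ler_wsqrtr.
  rewrite Ex_sum => [|t]; last exact: L1Z.
  apply: ler_sum => t _; rewrite ExZ// ler_wpM2l//.
  exact: cauchy_schwarz_norm.
have lim : Num.sqrt (V_ N) + rem N @[N --> \oo] --> Num.sqrt (a ^+ 2 * (M * corr_sum n)).
  rewrite -[X in _ --> X]addr0; apply: cvgD => //.
  by apply: (@cvg_comp _ _ _ V_ Num.sqrt _ _ _ V_cvg); exact: sqrt_continuous.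
rewrite -(cvg_lim _ lim)//; apply: limr_ge; first by apply/cvg_ex; eexists; exact: lim.
by apply: nearW => N; exact: bnd.
Qed.

End long_memory_sums.

(** * Rates of normalised double sums *)

Section rates.
Context (R : realType).
Implicit Types (g : nat -> R) (p q l : R).

Lemma cvg_near_eq (f g : nat -> R) l : (\forall n \near \oo, f n = g n) ->
  f @ \oo --> l -> g @ \oo --> l.
Proof. by move=> fg; apply: cvg_trans; exact: near_eq_cvg. Qed.

Lemma powR_slow_decay g p q l : p < q -> g n * n%:R `^ q @[n --> \oo] --> l ->
  g n * n%:R `^ p @[n --> \oo] --> (0 : R).
Proof.
move=> pq gl; rewrite -(mulr0 l).
have qp : 0 < q - p by rewrite subr_gt0.
apply: (@cvg_near_eq (fun n => g n * n%:R `^ q * n%:R `^ (- (q - p)))); last first.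
  by apply: cvgM => //; exact: cvg_powRN.
near=> n; have n0 : (0 < n)%N by near: n; exact: nbhs_infty_gt.
rewrite /= -mulrA -powRD; last by rewrite pnatr_eq0 -lt0n n0 implybT.
by congr (_ * _ `^ _); ring.
Unshelve. all: by end_near. Qed.

Lemma ln_powRN_le p n : 0 < p -> (0 < n)%N -> ln (n%:R : R) * n%:R `^ (- p) <= p^-1.
Proof.
move=> p0 n0; have n0' : 0 < n%:R :> R by rewrite ltr0n.
rewrite powRN ler_pdivrMr ?powR_gt0// -ler_pdivrMl ?invr_gt0// invrK.
rewrite /powR gt_eqF//; apply: le_trans (expR_ge1Dx _).
by rewrite lerDr.
Qed.

Lemma toeplitz_mean_cvg0 g p : 0 < p < 1 -> g n * n%:R `^ p @[n --> \oo] --> (0 : R) ->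
  n%:R ^- 2 * toeplitz_sum g n @[n --> \oo] --> (0 : R).
Proof.
move=> p01 gp; have /andP[p0 p1] := p01.
have tp := toeplitz_sum_cvg p01 gp; rewrite mulr0 mul0r in tp.
apply: (@cvg_near_eq (fun n => toeplitz_sum g n / n%:R `^ (2 - p) * n%:R `^ (- p))); last first.
  by rewrite -(mulr0 0); apply: cvgM => //; exact: cvg_powRN.
near=> n; have n0 : (0 < n)%N by near: n; exact: nbhs_infty_gt.
have n0' : 0 < n%:R :> R by rewrite ltr0n.
rewrite /= -mulrA mulrC; congr (_ * _).
rewrite -powRN -powRD; last by rewrite pnatr_eq0 -lt0n n0 implybT.
by rewrite (_ : - (2 - p) + - p = - 2%:R) ?powRN ?powR_mulrn//; ring.
Unshelve. all: by end_near. Qed.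

(** The double sum is o(n^(2 H - e)), so the surplus n^(-e) absorbs the logarithm. The bound e < 2 H
    - 1 keeps the exponent 2 (1 - H) + e below 1, as [toeplitz_sum_cvg] requires. *)
Lemma toeplitz_ln_cvg0 g (H : R) e : 2^-1 < H < 1 -> 0 < e < 2 * H - 1 ->
  g n * n%:R `^ (2 * (1 - H) + e) @[n --> \oo] --> (0 : R) ->
  (n%:R `^ (- H)) ^+ 2 * toeplitz_sum g n * ln n%:R @[n --> \oo] --> (0 : R).
Proof.
move=> /andP[H1 H2] /andP[e0 e1]; set p := 2 * (1 - H) + e => gp.
have p01 : 0 < p < 1 by rewrite /p; apply/andP; split; lra.
have tp := toeplitz_sum_cvg p01 gp; rewrite mulr0 mul0r in tp.
apply: norm_cvg0.
have tn : e^-1 * `|toeplitz_sum g n / n%:R `^ (2 - p)| @[n --> \oo] --> (0 : R).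
  by rewrite -(mulr0 e^-1) -[X in _ * X](@normr0 _ R); apply: cvgM; [exact: cvg_cst|exact: cvg_norm].
apply/cvgrPdist_le => z z0; near=> n.
have n0 : (0 < n)%N by near: n; exact: nbhs_infty_gt.
have n0' : 0 < n%:R :> R by rewrite ltr0n.
rewrite sub0r normrN normr_id.
have : `|0 - e^-1 * `|toeplitz_sum g n / n%:R `^ (2 - p)| | <= z.
  by near: n; move/cvgrPdist_le : tn; exact.
rewrite sub0r normrN; apply: le_trans; apply: le_trans (ler_norm _).
have l0 : 0 <= ln (n%:R : R) by rewrite ln_ge0// ler1n.
have -> : (n%:R `^ (- H)) ^+ 2 * toeplitz_sum g n * ln n%:R =
   (ln n%:R * n%:R `^ (- e)) * (toeplitz_sum g n / n%:R `^ (2 - p)) :> R.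
  have -> : (n%:R `^ (- H)) ^+ 2 = n%:R `^ (- e) / n%:R `^ (2 - p) :> R.
    rewrite -powR_mulrn ?powR_ge0// -powRrM -powRN -powRD; last first.
      by rewrite pnatr_eq0 -lt0n n0 implybT.
    by congr (_ `^ _); rewrite /p; ring.
  by ring.
rewrite normrM ler_wpM2r// ger0_norm ?mulr_ge0 ?powR_ge0//.
exact: ln_powRN_le.
Unshelve. all: by end_near. Qed.

End rates.

(** * Law of large numbers for functions of the design *)

Section law_of_large_numbers.
Context d (T : measurableType d) (R : realType) (P : probability T R)
  (X Y : int -> {RV P >-> R}) (mu gamma p : R).
Hypothesis XY_stationary : strictly_stationary X Y.
Hypothesis X_gauss : gaussian_process X.
Hypothesis X_mean : forall t, 'E_P[X t]%E = mu%:E.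
Hypothesis X_variance : forall t, 'V_P[X t]%E = (gamma ^+ 2)%:E.
Hypothesis gamma0 : 0 < gamma ^+ 2.
Hypothesis p_range : 0 < p < 1.
Hypothesis corr_cvg0 : design_corr X gamma n * n%:R `^ p @[n --> \oo] --> (0 : R).

(** Gebelein's inequality bounds the variance of the mean by E f^2 times the normalised double sum
    of the absolute correlations. *)
Theorem design_lln (f : R -> R) : measurable_fun setT f ->
  L2 P (fun w => f (X 0 w)) ->
  Ex P (fun w => (sample_mean (fun t w => f (X t w) - Ex P (fun w => f (X 0 w))) n w) ^+ 2)
    @[n --> \oo] --> (0 : R).
Proof.
move=> mf Lf; set m := Ex P (fun w => f (X 0 w)).
set M := Ex P (fun w => f (X 0 w) ^+ 2).
have c0 : `|design_corr X gamma n| * n%:R `^ p @[n --> \oo] --> (0 : R).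
  rewrite -[X in _ --> X](@normr0 _ R).
  rewrite (_ : (fun n => _) = (fun n => `|design_corr X gamma n * n%:R `^ p|)); last first.
    by apply/funext => n; rewrite [RHS]normrM (ger0_norm (powR_ge0 _ _)).
  exact: cvg_norm.
have tm := toeplitz_mean_cvg0 p_range c0.
have {}tm : M * (n%:R ^- 2 * toeplitz_sum (fun k => `|design_corr X gamma k|) n) @[n --> \oo] --> (0 : R).
  by rewrite -(mulr0 M); apply: cvgM => //; exact: cvg_cst.
apply: cvg0_le tm => n.
apply/andP; split; first by apply: Ex_ge0 => w; exact: sqr_ge0.
have Lr r : L2 P (fun w => f (X r w) - m).
  by apply: L2B; [exact: (L2_design_comp X_gauss X_mean X_variance)|exact: L2_cst].
rewrite (_ : (fun w => _) = (fun w => n%:R ^- 2 * \sum_(1 <= s < n.+1) \sum_(1 <= t < n.+1)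
    (f (X s%:Z w) - m) * (f (X t%:Z w) - m))); last first.
  by apply/funext => w; rewrite /sample_mean exprMn exprVn [X in _ * X = _]expr2 big_distrlr.
have L s t : L1 P (fun w => (f (X s w) - m) * (f (X t w) - m)) by exact: L1M.
rewrite ExZ; last by apply: L1_sum => s; exact: L1_sum.
rewrite mulrCA ler_wpM2l ?invr_ge0 ?exprn_ge0//.
rewrite Ex_sum => [|s]; last exact: L1_sum.
rewrite /toeplitz_sum mulr_sumr; apply: ler_sum => s _.
rewrite Ex_sum// mulr_sumr; apply: ler_sum => t _.
apply: (le_trans (ler_norm _)); rewrite mulrC.
have h := design_center_gebelein XY_stationary X_gauss X_mean X_variance gamma0 s%:Z t%:Z mf Lf.
exact: h.
Qed.

End law_of_large_numbers.

(** * Convergence in probability *)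

Section min1.
Context (R : realDomainType).
Implicit Types x y : R.

Lemma min1_ge0 x : 0 <= Num.min 1 `|x|.
Proof. by rewrite le_min ler01 normr_ge0. Qed.

Lemma min1_le1 x : Num.min 1 `|x| <= 1.
Proof. by rewrite ge_min lexx. Qed.

Lemma min1_le x : Num.min 1 `|x| <= `|x|.
Proof. by rewrite ge_min lexx orbT. Qed.

Lemma min1_add x y : Num.min 1 `|x + y| <= Num.min 1 `|x| + Num.min 1 `|y|.
Proof.
have := ler_normD x y.
by case: (lerP 1 `|x|); case: (lerP 1 `|y|); case: (lerP 1 `|x + y|); have := normr_ge0 x; have := normr_ge0 y; lra.
Qed.

Lemma min1_mul x y : Num.min 1 `|x * y| <= Num.min 1 `|x| + Num.min 1 `|y|.
Proof.
rewrite normrM; set a := `|x|; set b := `|y|.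
have a0 : 0 <= a by exact: normr_ge0.
have b0 : 0 <= b by exact: normr_ge0.
case: (lerP 1 a) => a1; first by rewrite ge_min lerDl le_min ler01 b0.
case: (lerP 1 b) => b1; first by rewrite ge_min lerDr a0.
by rewrite ge_min; apply/orP; right; have := ler_piMl b0 (ltW a1); lra.
Qed.

Lemma min1_le_mul K x y : 1 <= K -> `|x| <= K * `|y| ->
  Num.min 1 `|x| <= K * Num.min 1 `|y|.
Proof.
move=> K1 xy; case: (lerP 1 `|y|) => y1; first by rewrite mulr1 ge_min K1.
by rewrite ge_min xy orbT.
Qed.

End min1.

(* Convergence in probability to 0, metrised by V |-> E min(1, |V|). *)
Definition cvg_in_prob0 {d} {T : measurableType d} {R : realType} (P : probability T R)
    (V : nat -> T -> R) : Prop :=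
  (forall n, measurable_fun setT (V n)) /\
  Ex P (fun w => Num.min 1 `|V n w|) @[n --> \oo] --> (0 : R).

Section cvg_in_prob0.
Context d (T : measurableType d) (R : realType) (P : probability T R).
Implicit Types U V W : nat -> T -> R.

Lemma L1_min1 (f : T -> R) : measurable_fun setT f -> L1 P (fun w => Num.min 1 `|f w|).
Proof.
move=> mf; apply: (@L1_bounded _ _ _ _ _ 1) => [|w]; last first.
  by rewrite ger0_norm ?min1_ge0// min1_le1.
by apply: measurable_minr => //; exact: measurableT_comp.
Qed.

Lemma cvg0_le_near (x y : nat -> R) : (forall n, 0 <= x n) ->
  (\forall n \near \oo, x n <= y n) -> y @ \oo --> (0 : R) -> x @ \oo --> (0 : R).
Proof.
move=> x0 xy y0; apply: (@squeeze_cvgr _ _ _ _ (fun=> 0) y) => //; last exact: cvg_cst.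
by apply: filterS xy => n ->; rewrite x0.
Qed.

Lemma cvg_in_prob0_L1 V : (forall n, L1 P (V n)) ->
  Ex P (fun w => `|V n w|) @[n --> \oo] --> (0 : R) -> cvg_in_prob0 P V.
Proof.
move=> LV V0; split => [n|]; first exact: L1_meas.
apply: cvg0_le V0 => n; apply/andP; split; first by apply: Ex_ge0 => w; exact: min1_ge0.
apply: Ex_le => [||w]; [|exact: L1_norm|exact: min1_le].
by apply: L1_min1; exact: L1_meas.
Qed.

(** Two majorants serve to split cases: one bounds the error in the generic case, the other reaches
    1 on an exceptional event. *)
Lemma cvg_in_prob0_dom V U W : (forall n, measurable_fun setT (V n)) ->
  cvg_in_prob0 P U -> cvg_in_prob0 P W ->
  (\forall n \near \oo, forall w, Num.min 1 `|V n w| <= Num.min 1 `|U n w| + Num.min 1 `|W n w|) ->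
  cvg_in_prob0 P V.
Proof.
move=> mV [mU U0] [mW W0] VUW; split => //.
have UW : Ex P (fun w => Num.min 1 `|U n w|) + Ex P (fun w => Num.min 1 `|W n w|)
    @[n --> \oo] --> (0 : R).
  by rewrite -(addr0 0); exact: cvgD.
apply: cvg0_le_near UW; first by move=> n; apply: Ex_ge0 => w; exact: min1_ge0.
apply: filterS VUW => n h.
rewrite -ExD; [|exact: L1_min1|exact: L1_min1].
by apply: Ex_le => //; [exact: L1_min1|apply: L1D; exact: L1_min1].
Qed.

Lemma cvg_in_prob0D U W : cvg_in_prob0 P U -> cvg_in_prob0 P W ->
  cvg_in_prob0 P (fun n w => U n w + W n w).
Proof.
move=> hU hW; apply: (cvg_in_prob0_dom _ hU hW) => [n|].
  by apply: measurable_funD; [case: hU|case: hW].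
by apply: nearW => n w; exact: min1_add.
Qed.

Lemma cvg_in_prob0M U W : cvg_in_prob0 P U -> cvg_in_prob0 P W ->
  cvg_in_prob0 P (fun n w => U n w * W n w).
Proof.
move=> hU hW; apply: (cvg_in_prob0_dom _ hU hW) => [n|].
  by apply: measurable_funM; [case: hU|case: hW].
by apply: nearW => n w; exact: min1_mul.
Qed.

(** Where |W| <= K the product is at most K |U|; elsewhere Chebyshev's inequality costs E W^2 /
    K^2. *)
Lemma cvg_in_prob0_tightM U W C : cvg_in_prob0 P U -> (forall n, L2 P (W n)) ->
  (\forall n \near \oo, Ex P (fun w => W n w ^+ 2) <= C) ->
  cvg_in_prob0 P (fun n w => U n w * W n w).
Proof.
move=> [mU U0] LW WC; split => [n|].
  by apply: measurable_funM => //; case: (LW n).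
apply/cvgrPdist_le => e e0.
(* K^2 >= 2 |C| / e makes the Chebyshev cost at most e / 2; K >= 1 is what [min1_le_mul] asks
   for. *)
pose K := Num.max 1 (Num.sqrt (2 * `|C| / e)).
have K1 : 1 <= K by rewrite le_max lexx.
have K0 : 0 < K by rewrite (lt_le_trans _ K1).
have CK : K ^- 2 * `|C| <= e / 2.
  rewrite ler_pdivrMl ?exprn_gt0//.
  have : 2 * `|C| / e <= K ^+ 2.
    rewrite -[leLHS]sqr_sqrtr ?divr_ge0 ?mulr_ge0 ?(ltW e0)//.
    by apply: lerXn2r; rewrite ?nnegrE ?sqrtr_ge0 ?(ltW K0)// le_max lexx orbT.
  by rewrite ler_pdivrMr// => h; lra.
have e2K : 0 < e / 2 / K by rewrite !divr_gt0.
move/cvgrPdist_le : U0 => /(_ _ e2K); apply: filterS2 WC => n WC Un.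
rewrite sub0r normrN ger0_norm; last by apply: Ex_ge0 => w; exact: min1_ge0.
have L2W := (LW n).2.
apply: (@le_trans _ _ (Ex P (fun w => K * Num.min 1 `|U n w| + K ^- 2 * W n w ^+ 2))).
  apply: Ex_le => [||w].
  - by apply: L1_min1; apply: measurable_funM => //; case: (LW n).
  - by apply: L1D; apply: L1Z => //; exact: L1_min1.
  have [WK|WK] := lerP `|W n w| K.
    apply: ler_wpDr; first by apply: mulr_ge0; [rewrite invr_ge0 exprn_ge0// ltW|exact: sqr_ge0].
    by apply: min1_le_mul => //; rewrite normrM mulrC ler_wpM2r.
  apply: ler_wpDl; first by apply: mulr_ge0; [exact: ltW|exact: min1_ge0].
  apply: (le_trans (min1_le1 _)); rewrite ler_pdivlMl ?exprn_gt0// mulr1 -[leRHS]sqr_abs.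
  by apply: lerXn2r; rewrite ?nnegrE ?(ltW K0) ?(ltW WK).
rewrite ExD; [|exact/L1Z/L1_min1|exact: L1Z].
rewrite !ExZ//; last exact: L1_min1.
have h1 : K * Ex P (fun w => Num.min 1 `|U n w|) <= e / 2.
  rewrite mulrC -ler_pdivlMr//; apply: le_trans Un; rewrite sub0r normrN; exact: ler_norm.
have h2 : K ^- 2 * Ex P (fun w => W n w ^+ 2) <= e / 2.
  apply: le_trans CK; rewrite ler_wpM2l ?invr_ge0 ?exprn_ge0 ?(ltW K0)//.
  by apply: (le_trans WC); exact: ler_norm.
by lra.
Qed.

Lemma cvg_in_prob0Z c U : cvg_in_prob0 P U -> cvg_in_prob0 P (fun n w => c * U n w).
Proof.
move=> hU; rewrite (_ : (fun n w => _) = (fun n w => U n w * c)).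
  apply: (cvg_in_prob0_tightM (C := c ^+ 2) hU) => [n|]; first exact: L2_cst.
  by apply: nearW => n; rewrite Ex_cst.
by apply/funext => n; apply/funext => w; rewrite mulrC.
Qed.

Lemma cvg_in_prob0B U W : cvg_in_prob0 P U -> cvg_in_prob0 P W ->
  cvg_in_prob0 P (fun n w => U n w - W n w).
Proof.
move=> hU /(cvg_in_prob0Z (-1)) hW; have := cvg_in_prob0D hU hW.
by congr (cvg_in_prob0 P _); apply/funext => n; apply/funext => w; rewrite mulN1r.
Qed.

End cvg_in_prob0.

(** * Weighted sums as multiples of the error sum *)

Section weighted_sum_limits.
Context d (T : measurableType d) (R : realType) (P : probability T R)
  (X Y u eps : int -> {RV P >-> R}) (b : nat -> R) (mu gamma : R) (a : nat -> R) (C : R).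
Hypothesis XY_stationary : strictly_stationary X Y.
Hypothesis eps_iid : iid eps.
Hypothesis eps_mean : forall t, 'E_P[eps t]%E = 0%E.
Hypothesis eps_var : forall t, 'V_P[eps t]%E = 1%E.
Hypothesis eps_X_indep : independent_processes eps X.
Hypothesis u_ma : moving_average b eps u.
Hypothesis X_gauss : gaussian_process X.
Hypothesis X_mean : forall t, 'E_P[X t]%E = mu%:E.
Hypothesis X_variance : forall t, 'V_P[X t]%E = (gamma ^+ 2)%:E.
Hypothesis gamma0 : 0 < gamma ^+ 2.
Hypothesis corr_ln_cvg0 :
  a n ^+ 2 * corr_sum X u gamma n * ln n%:R @[n --> \oo] --> (0 : R).
Hypothesis W_var : \forall n \near \oo, Ex P (fun w => scaled_sum u (a n) n w ^+ 2) <= C.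

Let mX t : measurable_fun setT (X t). Proof. exact: measurable_funP. Qed.
Let W n := scaled_sum u (a n) n.
Let LW n : L2 P (W n). Proof. exact: (L2_scaled_sum eps_mean eps_var u_ma). Qed.
Let S n := a n ^+ 2 * corr_sum X u gamma n.
Let S0 n : 0 <= S n.
Proof.
by apply: mulr_ge0; [exact: sqr_ge0|apply: sumr_ge0 => s _; exact: sumr_ge0].
Qed.

Let weighted_sumE g n w : weighted_sum X u g (a n) n w =
  weighted_sum X u (fun x => g x - Ex P (fun w => g (X 0 w))) (a n) n w +
  Ex P (fun w => g (X 0 w)) * W n w.
Proof.
rewrite /W /scaled_sum mulr_sumr -big_split; apply: eq_bigr => t _ /=; ring.
Qed.

(** The function may change with n and its second moment may grow like ln n, which leaves room for a
    truncation that widens with n. *)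
Let centered_cvg (g : nat -> R -> R) (M : R) :
  (forall n, measurable_fun setT (g n)) -> (forall n, L2 P (fun w => g n (X 0 w))) ->
  (\forall n \near \oo, Ex P (fun w => g n (X 0 w) ^+ 2) <= M * ln n%:R) ->
  cvg_in_prob0 P (fun n => weighted_sum X u
    (fun x => g n x - Ex P (fun w => g n (X 0 w))) (a n) n).
Proof.
move=> mg Lg gM; apply: cvg_in_prob0_L1 => [n|].
  apply: (L1_weighted_sum eps_mean eps_var u_ma X_gauss X_mean X_variance).
    exact: measurable_funB.
  by apply: L2B => //; exact: L2_cst.
have h : Num.sqrt (`|M| * (S n * ln n%:R)) @[n --> \oo] --> (0 : R).
  by apply: cvg_sqrt0; rewrite -(mulr0 `|M|); apply: cvgM => //; exact: cvg_cst.
apply: cvg0_le_near h => [n|]; first by apply: Ex_ge0 => w.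
apply: filterS2 gM (nbhs_infty_gt 0%N) => n gM n0.
have l0 : 0 <= ln (n%:R : R) by rewrite ln_ge0// ler1n.
apply: le_trans (centered_weighted_sum_le XY_stationary eps_iid eps_mean eps_var
  eps_X_indep u_ma X_gauss X_mean X_variance gamma0 (a n) n (mg n) (Lg n)) _.
apply: ler_wsqrtr; rewrite mulrCA -/(S n) [leRHS]mulrCA [leLHS]mulrC.
by apply: ler_wpM2l => //; apply: (le_trans gM); rewrite ler_wpM2r// ler_norm.
Qed.

Lemma weighted_sum_cvg (g : R -> R) : measurable_fun setT g ->
  L2 P (fun w => g (X 0 w)) ->
  cvg_in_prob0 P (fun n w => weighted_sum X u g (a n) n w - Ex P (fun w => g (X 0 w)) * W n w).
Proof.
move=> mg Lg; set M := Ex P (fun w => g (X 0 w) ^+ 2).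
have M0 : 0 <= M by apply: Ex_ge0 => w; exact: sqr_ge0.
(* Once ln n >= 1, a constant second moment obeys the logarithmic bound. *)
suff h : \forall n \near \oo, M <= M * ln (n%:R : R).
  have := @centered_cvg (fun=> g) M (fun=> mg) (fun=> Lg) h.
  congr (cvg_in_prob0 P _); apply/funext => n; apply/funext => w.
  by rewrite [in RHS]weighted_sumE addrK.
near=> n; rewrite ler_peMr// -ler_expR lnK ?posrE; last first.
  by near: n; exact: nbhs_infty_gtr.
by near: n; exact: nbhs_infty_ger.
Unshelve. all: by end_near. Qed.

(* (x - mu) * sigma x need not be square integrable.  It is truncated at |x - mu| <= c n
   with c n ^ 2 = 8 gamma ^ 2 ln n: since E exp((X - mu) ^ 2 / (4 gamma ^ 2)) is finite, the
   truncation is felt by one of X_1, ..., X_n with probability O(1 / n) only. *)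
Lemma weighted_sum_center_cvg (sigma : R -> R) : measurable_fun setT sigma ->
  L2 P (fun w => sigma (X 0 w)) ->
  cvg_in_prob0 P (fun n w => weighted_sum X u (fun x => (x - mu) * sigma x) (a n) n w -
    Ex P (fun w => (X 0 w - mu) * sigma (X 0 w)) * W n w).
Proof.
move=> ms Ls; set G := Ex P _.
have k_gt0 k : (0 < k)%N -> 0 < k%:R * gamma ^+ 2.
  by move=> k0; rewrite pmulr_lgt0// ltr0n.
have L n : 0 <= ln (n%:R : R).
  by case: n => [|n]; [rewrite ln0|rewrite ln_ge0// ler1n].
pose c n := Num.sqrt (8 * gamma ^+ 2 * ln (n%:R : R)).
have c0 n : 0 <= c n by exact: sqrtr_ge0.
have c2 n : c n ^+ 2 = 8 * gamma ^+ 2 * ln n%:R.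
  by rewrite sqr_sqrtr// (mulr_ge0 (mulr_ge0 (ler0n _ 8) (ltW gamma0)) (L n)).
pose D n : set R := [set` `[mu - c n, mu + c n]].
have mD n : measurable (D n) by exact: measurable_itv.
have DE n x : D n x = (`|x - mu| <= c n) by rewrite /D/= in_itv/= ler_distl.
pose g n (x : R) : R := (x - mu) * sigma x * \1_(D n) x.
have mf : measurable_fun setT (fun x : R => (x - mu) * sigma x).
  by apply: measurable_funM => //; exact: measurable_funB.
have mg n : measurable_fun setT (g n).
  by apply: measurable_funM => //; exact: measurable_indic.
have g_le n x : `|g n x| <= `|c n * sigma x|.
  rewrite /g indicE; have [xD|xD] := boolP (x \in D n); last first.
    by rewrite mulr0 normr0.
  rewrite mulr1 !normrM ler_wpM2r// (ger0_norm (c0 n)).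
  by move: xD; rewrite inE DE.
have Lg n : L2 P (fun w => g n (X 0 w)).
  apply: (@L2_le _ _ _ _ _ (fun w => c n * sigma (X 0 w))) => //.
  - exact: measurableT_comp.
  - exact: L2Z.
have g2 n : Ex P (fun w => g n (X 0 w) ^+ 2) <=
    8 * gamma ^+ 2 * Ex P (fun w => sigma (X 0 w) ^+ 2) * ln n%:R.
  rewrite mulrAC -c2 -ExZ; last by case: Ls.
  apply: Ex_le => [||w]; [by case: (Lg n)|by apply: L1Z; case: Ls|].
  rewrite -exprMn -sqr_abs -[leRHS]sqr_abs.
  by apply: lerXn2r; rewrite ?nnegrE.
have Lf : L1 P (fun w => (X 0 w - mu) * sigma (X 0 w)).
  apply: L1M => //; apply: L2B; last exact: L2_cst.
  exact: (L2_design X_gauss X_mean X_variance).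
have gG : Ex P (fun w => g n (X 0 w)) @[n --> \oo] --> G.
  apply: (@Ex_dominated _ _ _ _ _ _ (fun w => `|(X 0 w - mu) * sigma (X 0 w)|)).
  - by move=> n; exact: measurableT_comp.
  - exact: L1_norm.
  - move=> n w; rewrite /g normrM ler_piMr// indicE.
    by case: (_ \in _); rewrite ?normr1 ?normr0.
  - move=> w; apply: (@cvg_near_eq _ (fun=> (X 0 w - mu) * sigma (X 0 w))); last exact: cvg_cst.
    near=> n; rewrite /g indicE mem_set ?mulr1// DE.
    rewrite -(ler_pXn2r (n := 2)) ?nnegrE// c2 mulrC -ler_pdivrMr; last exact: (k_gt0 8%N).
    rewrite -ler_expR lnK ?posrE; last by near: n; exact: nbhs_infty_gtr.
    by near: n; exact: nbhs_infty_ger.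
(* For |x - mu| > c n the exponential exceeds n^2, so [tail] is at least 1 as soon as one
   observation is truncated, while its mean is O(1 / n). *)
pose tail n w := n%:R ^- 2 * \sum_(1 <= t < n.+1) expR ((X t%:Z w - mu) ^+ 2 / (4 * gamma ^+ 2)).
have s20 : Num.sqrt (gamma ^+ 2) ^+ 2 = gamma ^+ 2 by rewrite sqr_sqrtr// ltW.
have Le t : L1 P (fun w => expR ((X t w - mu) ^+ 2 / (4 * gamma ^+ 2))).
  rewrite -s20; apply: L1_normal_expR => // [|A mA].
    by rewrite gt_eqF// sqrtr_gt0.
  have [_ h] := design_normal X_gauss X_mean X_variance t.
  by rewrite h// gt_eqF.
have tail0 n w : 0 <= tail n w.
  by rewrite mulr_ge0 ?invr_ge0 ?exprn_ge0//; apply: sumr_ge0 => t _; exact: expR_ge0.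
have Lt n : L1 P (tail n) by apply: L1Z; exact: L1_sum.
have tail_cvg : cvg_in_prob0 P tail.
  apply: cvg_in_prob0_L1 => //.
  pose E0 := Ex P (fun w => expR ((X 0 w - mu) ^+ 2 / (4 * gamma ^+ 2))).
  have E_t t : Ex P (fun w => expR ((X t w - mu) ^+ 2 / (4 * gamma ^+ 2))) = E0.
    apply: (Ex_design X_gauss X_mean X_variance (f := fun x => expR ((x - mu) ^+ 2 / (4 * gamma ^+ 2)))).
    apply: measurableT_comp => //; apply: measurable_funM => //.
    by apply: measurable_funX; exact: measurable_funB.
  have h : n%:R^-1 * E0 @[n --> \oo] --> (0 : R).
    rewrite -(mul0r E0); apply: cvgM; last exact: cvg_cst.
    apply: cvg_near_eq (cvg_powRN (@ltr01 R)).
    by apply: nearW => n; rewrite powRN powRr1.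
  apply: cvg_near_eq h; near=> n.
  have n0 : n%:R != 0 :> R by rewrite pnatr_eq0 -lt0n; near: n; exact: nbhs_infty_gt.
  under eq_Rintegral do rewrite ger0_norm//.
  rewrite ExZ; last exact: L1_sum.
  rewrite Ex_sum// (eq_bigr (fun=> E0))// sumr_const_nat subSS subn0 -[_ *+ n]mulr_natr.
  by field.
have cst_cvg : cvg_in_prob0 P (fun n w => Ex P (fun w => g n (X 0 w)) - G).
  apply: cvg_in_prob0_L1 => [n|]; first exact: L1_cst.
  under eq_fun do rewrite Ex_cst.
  rewrite -(@normr0 _ R); apply: cvg_norm; exact/subr_cvg0.
have main : cvg_in_prob0 P (fun n => weighted_sum X u
    (fun x => g n x - Ex P (fun w => g n (X 0 w))) (a n) n).
  by apply: centered_cvg => //; apply: nearW; exact: g2.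
(* Replacing the mean of g n by its limit G costs a vanishing constant times [W], whose second
   moments are bounded. *)
have main2 := cvg_in_prob0D main (cvg_in_prob0_tightM cst_cvg LW W_var).
apply: (cvg_in_prob0_dom _ main2 tail_cvg).
  move=> n; apply: measurable_funB; last by apply: measurable_funM => //; case: (LW n).
  apply: measurable_sum => t; apply: measurable_funM => //; apply: measurable_funM => //.
  exact: (measurableT_comp mf).
near=> n => w.
have n0 : (0 < n)%N by near: n; exact: nbhs_infty_gt.
have n0' : 0 < n%:R :> R by rewrite ltr0n.
have [/allP h|/allPn[t]] := boolP (all (fun t => `|X t%:Z w - mu| <= c n) (index_iota 1 n.+1)).
  rewrite ler_wpDr ?min1_ge0//.
  have -> : weighted_sum X u (fun x => (x - mu) * sigma x) (a n) n w =
      weighted_sum X u (g n) (a n) n w.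
    rewrite /weighted_sum big_seq [RHS]big_seq; apply: eq_bigr => t tn.
    by rewrite /g indicE mem_set ?mulr1// DE; exact: h.
  by rewrite weighted_sumE -addrA -mulrBl.
rewrite -ltNge => tn cX.
rewrite ler_wpDl ?min1_ge0//; apply: (le_trans (min1_le1 _)).
rewrite le_min lexx/= ger0_norm// /tail mulrC ler_pdivlMr ?exprn_gt0// mul1r.
rewrite (big_rem t)//= ler_wpDr//; first by apply: sumr_ge0 => s _; exact: expR_ge0.
have -> : n%:R ^+ 2 = expR (2 * ln n%:R) :> R.
  by rewrite mulr_natl mulr2n expRD lnK ?posrE// expr2.
rewrite ler_expR ler_pdivlMr; last exact: (k_gt0 4%N).
have -> : 2 * ln n%:R * (4 * gamma ^+ 2) = c n ^+ 2 by rewrite c2; ring.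
by rewrite -[leRHS]sqr_abs; apply: lerXn2r; rewrite ?nnegrE ?c0 ?normr_ge0 ?(ltW cX).
Unshelve. all: by end_near. Qed.

End weighted_sum_limits.

(** * Slutsky's lemma along a line *)

(** The set where g > a is a countable union of rational balls, whose preimages are intersections of
    an event in [U] and an event in [V]. *)
Lemma measurable_continuous_pair d (T : measurableType d) (R : realType)
    (g : R * R -> R) (U V : T -> R) : continuous g ->
  measurable_fun setT U -> measurable_fun setT V ->
  measurable_fun setT (fun w => g (U w, V w)).
Proof.
move=> cg mU mV; apply: (measurability _ (RGenOInfty.measurableE R)).
move=> _ [_ [a ->] <-]; rewrite setTI.
pose C (p q r : rat) : bool :=
  `[< forall z, ball (ratr p : R, ratr q : R) (ratr r : R) z -> a < g z >].
rewrite (_ : _ @^-1` _ = \bigcup_(p : rat) \bigcup_(q : rat) \bigcup_(r : rat)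
   if C p q r then U @^-1` ball (ratr p : R) (ratr r : R) `&` V @^-1` ball (ratr q : R) (ratr r : R)
   else set0).
  apply: bigcupT_measurable_rat => p; apply: bigcupT_measurable_rat => q.
  apply: bigcupT_measurable_rat => r; case: (C p q r) => //.
  by apply: measurableI; rewrite -[X in measurable X]setTI;
    [apply: mU|apply: mV] => //; exact: measurable_ball.
apply/seteqP; split => [w /=|w [p _ [q _ [r _]]]]; last first.
  case: (boolP (C p q r)) => // /asboolP h [Uw Vw] /=.
  by rewrite in_itv/= andbT; apply: h.
rewrite in_itv/= andbT => agw.
have ga : 0 < g (U w, V w) - a by rewrite subr_gt0.
have /cvgrPdist_lt/(_ _ ga)/nbhs_ballP[e /= e0 he] := cg (U w, V w).
have e40 : 0 < e / 4 by rewrite divr_gt0.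
have near_rat (x : R) : exists2 p : rat, True & `|ratr p - x| < e / 4.
  have [|p] := @rat_in_itvoo R (x - e / 4) (x + e / 4); first by lra.
  by rewrite in_itv/= => xp; exists p => //; rewrite ltr_distl.
have [p _ hp] := near_rat (U w); have [q _ hq] := near_rat (V w).
(* A centre within e / 4 and a radius between e / 4 and e / 2 give a ball that contains the point
   and lies in its e-ball. *)
have [|r] := @rat_in_itvoo R (e / 4) (e / 2); first by lra.
rewrite in_itv/= => /andP[r1 r2].
exists p => //; exists q => //; exists r => //.
case: ifPn => [_|/asboolPn[]].
  by split => /=; rewrite /ball/= (lt_trans _ r1).
move=> z [] ; rewrite /ball/= => z1 z2.
suff /he : ball (U w, V w) e z by rewrite /= ltr_distl => /andP[_]; lra.
split; rewrite /ball/=.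
- have -> : U w - z.1 = (ratr p - z.1) - (ratr p - U w) by ring.
  by rewrite (le_lt_trans (ler_normB _ _))//; lra.
- have -> : V w - z.2 = (ratr q - z.2) - (ratr q - V w) by ring.
  by rewrite (le_lt_trans (ler_normB _ _))//; lra.
Qed.

(* Slutsky: all the mass outside a compact box is controlled by E W_n^2, and on the
   box g is uniformly continuous. *)
Lemma slutsky_line d (T : measurableType d) (R : realType) (P : probability T R)
    (g : R * R -> R) (M a1 a2 C l : R) (V1 V2 W : nat -> T -> R) :
  continuous g -> (forall x, `|g x| <= M) ->
  (forall n, measurable_fun setT (V1 n)) -> (forall n, measurable_fun setT (V2 n)) ->
  (forall n, L2 P (W n)) ->
  (\forall n \near \oo, Ex P (fun w => W n w ^+ 2) <= C) ->
  cvg_in_prob0 P (fun n w => V1 n w - a1 * W n w) ->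
  cvg_in_prob0 P (fun n w => V2 n w - a2 * W n w) ->
  Ex P (fun w => g (a1 * W n w, a2 * W n w)) @[n --> \oo] --> l ->
  Ex P (fun w => g (V1 n w, V2 n w)) @[n --> \oo] --> l.
Proof.
move=> cg gM mV1 mV2 LW WC D1 D2 gl.
have M0 : 0 <= M by rewrite (le_trans _ (gM (0, 0))).
suff d0 : Ex P (fun w => g (V1 n w, V2 n w)) - Ex P (fun w => g (a1 * W n w, a2 * W n w))
    @[n --> \oo] --> (0 : R).
  rewrite -[X in _ --> X]add0r (_ : (fun n => _) = (fun n => (Ex P (fun w => g (V1 n w, V2 n w)) -
    Ex P (fun w => g (a1 * W n w, a2 * W n w))) + Ex P (fun w => g (a1 * W n w, a2 * W n w)))).
    exact: cvgD.
  by apply/funext => n; rewrite subrK.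
apply/cvgrPdist_le => e e0.
pose C' := `|C| + 1.
have C'0 : 0 < C' by rewrite /C'; have := normr_ge0 C; lra.
(* Then 2 M C' / K^2 <= e / 8; [M + 1] keeps K positive when M = 0. *)
pose K := Num.sqrt (16 * (M + 1) * C' / e).
have K2 : K ^+ 2 = 16 * (M + 1) * C' / e.
  by rewrite sqr_sqrtr// divr_ge0 ?(ltW e0)// (mulr_ge0 (mulr_ge0 _ _) (ltW C'0))//; lra.
have K0 : 0 < K by rewrite sqrtr_gt0 divr_gt0// !mulr_gt0//; lra.
pose box (c : R) : set R := [set` `[- (`|c| * K), `|c| * K]].
have cbox : compact (box a1 `*` box a2) by apply: compact_setX; exact: segment_compact.
have e4 : 0 < e / 4 by rewrite divr_gt0.
have [r' r'0 hr'] := compact_uniform_continuity cbox cg e4.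
(* With r <= 1, r <= |x| implies r <= min (1, |x|), the quantity controlled in mean. *)
pose r := Num.min 1 r'.
have r0 : 0 < r by rewrite lt_min ltr01.
have r1 : r <= 1 by rewrite ge_min lexx.
have rr' : r <= r' by rewrite ge_min lexx orbT.
pose D1' n w := Num.min 1 `|V1 n w - a1 * W n w|.
pose D2' n w := Num.min 1 `|V2 n w - a2 * W n w|.
have ptw n w : `|g (V1 n w, V2 n w) - g (a1 * W n w, a2 * W n w)| <=
    e / 4 + 2 * M / K ^+ 2 * W n w ^+ 2 + 2 * M / r * (D1' n w + D2' n w).
  have t1 : 0 <= 2 * M / K ^+ 2 * W n w ^+ 2.
    by apply: mulr_ge0; [rewrite divr_ge0 ?sqr_ge0 ?mulr_ge0|exact: sqr_ge0].
  have Mr : 0 <= 2 * M / r by rewrite divr_ge0 ?(ltW r0)// mulr_ge0.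
  have s1 : 0 <= D1' n w by exact: min1_ge0.
  have s2 : 0 <= D2' n w by exact: min1_ge0.
  have t2 : 0 <= 2 * M / r * (D1' n w + D2' n w) by rewrite mulr_ge0// addr_ge0.
  have triv : `|g (V1 n w, V2 n w) - g (a1 * W n w, a2 * W n w)| <= 2 * M.
    by rewrite (le_trans (ler_normB _ _))// mulr_natl mulr2n lerD.
  have far (D : R) : r <= D -> 2 * M <= 2 * M / r * D.
    by move=> rD; rewrite -mulrA ler_peMr ?mulr_ge0// mulrC ler_pdivlMr ?mul1r.
  have small (x : R) : r <= `|x| -> r <= Num.min 1 `|x| by rewrite le_min r1.
  have [WK|WK] := lerP `|W n w| K; last first.
    apply: (le_trans triv); apply: (@le_trans _ _ (2 * M / K ^+ 2 * W n w ^+ 2)); last by lra.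
    rewrite -mulrA ler_peMr ?mulr_ge0// mulrC ler_pdivlMr ?exprn_gt0// mul1r.
    by rewrite -[leRHS]sqr_abs; apply: lerXn2r; rewrite ?nnegrE ?(ltW K0) ?(ltW WK) ?normr_ge0.
  have [d1|d1] := lerP r `|V1 n w - a1 * W n w|.
    have := far _ (small _ d1); have := mulr_ge0 Mr s2; rewrite mulrDr /D1'; lra.
  have [d2|d2] := lerP r `|V2 n w - a2 * W n w|.
    have := far _ (small _ d2); have := mulr_ge0 Mr s1; rewrite mulrDr /D2'; lra.
  suff : `|g (V1 n w, V2 n w) - g (a1 * W n w, a2 * W n w)| < e / 4 by lra.
  apply: hr'.
    by split; rewrite /box/= in_itv/= -ler_norml normrM ler_wpM2l.
  by split; rewrite /ball/= distrC (lt_le_trans _ rr').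
have mg n : measurable_fun setT (fun w => g (a1 * W n w, a2 * W n w)).
  by apply: measurable_continuous_pair => //; apply: measurable_funM => //; case: (LW n).
have Lg n : L1 P (fun w => g (a1 * W n w, a2 * W n w)) by exact: (@L1_bounded _ _ _ _ _ M).
have LgV n : L1 P (fun w => g (V1 n w, V2 n w)).
  by apply: (@L1_bounded _ _ _ _ _ M) => //; exact: measurable_continuous_pair.
have er : 0 < e / 4 / (2 * (2 * M / r + 1)).
  rewrite divr_gt0// mulr_gt0// ltr_wpDl// divr_ge0 ?(ltW r0)// mulr_ge0//.
have n1 := D1.2; move/cvgrPdist_le : n1 => /(_ _ er) n1.
have n2 := D2.2; move/cvgrPdist_le : n2 => /(_ _ er) n2.
apply: filterS3 WC n1 n2 => n Wn e1 e2.
rewrite sub0r normrN -ExB//.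
have L1' : L1 P (D1' n) by apply: L1_min1; exact: D1.1.
have L2' : L1 P (D2' n) by apply: L1_min1; exact: D2.1.
have L3 : L1 P (fun w => W n w ^+ 2) by case: (LW n).
apply: (@le_trans _ _ (Ex P (fun w => e / 4 + 2 * M / K ^+ 2 * W n w ^+ 2 +
   2 * M / r * (D1' n w + D2' n w)))).
  apply: Ex_norm_le => [||w]; [exact: L1B| |exact: ptw].
  by apply: L1D; [apply: L1D; [exact: L1_cst|exact: L1Z]|apply: L1Z; exact: L1D].
rewrite ExD; [|by apply: L1D; [exact: L1_cst|exact: L1Z]|by apply: L1Z; exact: L1D].
rewrite ExD; [|exact: L1_cst|exact: L1Z].
rewrite Ex_cst !ExZ//; last exact: L1D.
rewrite ExD//.
have h1 : 2 * M / K ^+ 2 * Ex P (fun w => W n w ^+ 2) <= e / 4.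
  have WC' : Ex P (fun w => W n w ^+ 2) <= C'.
    by rewrite (le_trans Wn)// /C'; have := ler_norm C; lra.
  apply: (@le_trans _ _ (2 * M / K ^+ 2 * C')).
    by rewrite ler_wpM2l// divr_ge0 ?sqr_ge0// mulr_ge0.
  have -> : 2 * M / K ^+ 2 * C' = e / 8 * (M / (M + 1)).
    have M1 : M + 1 != 0 by lra.
    by rewrite K2; have := lt0r_neq0 e0; have := lt0r_neq0 C'0 => C1 e1'; field; rewrite C1 M1 e1'.
  have M1 : 0 < M + 1 by lra.
  have MM : M / (M + 1) <= 1 by rewrite ler_pdivrMr// mul1r; lra.
  have e8 : 0 <= e / 8 by lra.
  by have := ler_wpM2l e8 MM; lra.
move: e1 e2; rewrite !sub0r !normrN !ger0_norm; last first.
- by apply: Ex_ge0 => w; exact: min1_ge0.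
- by apply: Ex_ge0 => w; exact: min1_ge0.
rewrite -/(D1' n) -/(D2' n) => e1 e2.
have h2 : 2 * M / r * (Ex P (D1' n) + Ex P (D2' n)) <= e / 4.
  have q0 : 0 <= 2 * M / r by rewrite divr_ge0 ?(ltW r0)// mulr_ge0.
  apply: (@le_trans _ _ (2 * M / r * (e / 4 / (2 * M / r + 1)))).
    apply: ler_wpM2l => //; apply: (le_trans (lerD e1 e2)).
    by rewrite le_eqVlt; apply/orP; left; apply/eqP; field; lra.
  rewrite mulrA ler_pdivrMr ?ltr_wpDl// mulrC ler_wpM2l//; lra.
by lra.
Qed.

(** * Least squares *)

Section least_squares.
Context (R : realType) (T : Type) (x s : int -> T -> R) (beta0 beta1 mu a : R).
Implicit Types (n : nat) (w : T).
Let y t w := beta0 + beta1 * x t w + s t w.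

Definition sample_var n w : R :=
  n%:R^-1 * \sum_(1 <= t < n.+1) (x t%:Z w - sample_mean x n w) ^+ 2.

Let sum_center n w : (0 < n)%N -> \sum_(1 <= t < n.+1) (x t%:Z w - sample_mean x n w) = 0.
Proof.
move=> n0; rewrite sumrB sumr_const_nat subSS subn0 -[_ *+ n]mulr_natl /sample_mean mulrA.
by rewrite mulfV ?mul1r ?subrr// pnatr_eq0 -lt0n.
Qed.

(** Centring at mu turns the main term into a mean of a fixed function of the X_t, to which the law
    of large numbers applies. *)
Lemma sample_varE n w : (0 < n)%N ->
  sample_var n w = n%:R^-1 * (\sum_(1 <= t < n.+1) (x t%:Z w - mu) ^+ 2) -
    (sample_mean x n w - mu) ^+ 2.
Proof.
move=> n0; have n1 : n%:R != 0 :> R by rewrite pnatr_eq0 -lt0n.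
rewrite /sample_var; set m := sample_mean x n w.
have -> : \sum_(1 <= t < n.+1) (x t%:Z w - mu) ^+ 2 =
    \sum_(1 <= t < n.+1) ((x t%:Z w - m) ^+ 2 + (2 * (m - mu)) * (x t%:Z w - m) + (m - mu) ^+ 2).
  by apply: eq_bigr => t _; ring.
rewrite !big_split /= -mulr_sumr sum_center// mulr0 addr0.
by rewrite sumr_const_nat subSS subn0 -[_ *+ n]mulr_natl; field.
Qed.

(** An exact identity with the design centred at mu, not at its sample mean. The free factor [a] is
    n^(-H) in the application, so that n a is the rate n^(1 - H). *)
Lemma ls_slope_error n w : (0 < n)%N -> sample_var n w != 0 ->
  n%:R * a * (ls_slope x y n w - beta1) =
  (\sum_(1 <= t < n.+1) a * ((x t%:Z w - mu) * s t%:Z w) -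
   (sample_mean x n w - mu) * \sum_(1 <= t < n.+1) a * s t%:Z w) / sample_var n w.
Proof.
move=> n0 v0; have n1 : n%:R != 0 :> R by rewrite pnatr_eq0 -lt0n.
have qE : \sum_(1 <= t < n.+1) (x t%:Z w - sample_mean x n w) ^+ 2 = n%:R * sample_var n w.
  by rewrite /sample_var mulrA mulfV// mul1r.
rewrite /ls_slope qE; set m := sample_mean x n w.
have -> : \sum_(1 <= t < n.+1) (x t%:Z w - m) * y t%:Z w =
    beta1 * (n%:R * sample_var n w) + \sum_(1 <= t < n.+1) (x t%:Z w - m) * s t%:Z w.
  transitivity (\sum_(1 <= t < n.+1) ((beta0 + beta1 * m) * (x t%:Z w - m) +
      beta1 * (x t%:Z w - m) ^+ 2 + (x t%:Z w - m) * s t%:Z w)).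
    by apply: eq_bigr => t _; rewrite /y; ring.
  by rewrite !big_split /= -!mulr_sumr sum_center// mulr0 add0r qE.
have -> : \sum_(1 <= t < n.+1) a * ((x t%:Z w - mu) * s t%:Z w) -
   (m - mu) * \sum_(1 <= t < n.+1) a * s t%:Z w =
   a * \sum_(1 <= t < n.+1) (x t%:Z w - m) * s t%:Z w.
  by rewrite !mulr_sumr -sumrB; apply: eq_bigr => t _; ring.
by field; rewrite v0 n1.
Qed.

Lemma ls_intercept_error n w : (0 < n)%N ->
  n%:R * a * (ls_intercept x y n w - beta0) =
  \sum_(1 <= t < n.+1) a * s t%:Z w -
  sample_mean x n w * (n%:R * a * (ls_slope x y n w - beta1)).
Proof.
move=> n0; have n1 : n%:R != 0 :> R by rewrite pnatr_eq0 -lt0n.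
have -> : \sum_(1 <= t < n.+1) a * s t%:Z w = n%:R * a * sample_mean s n w.
  by rewrite -mulr_sumr /sample_mean; field.
have my : sample_mean y n w = beta0 + beta1 * sample_mean x n w + sample_mean s n w.
  rewrite /sample_mean /y !big_split /= -mulr_sumr.
  rewrite sumr_const_nat subSS subn0 -[_ *+ n]mulr_natl.
  by field.
by rewrite /ls_intercept my; ring.
Qed.

End least_squares.

(** * Measurability of the estimators *)

Section measurable_least_squares.
Context d (T : measurableType d) (R : realType) (x y : int -> T -> R) (n : nat).
Hypothesis mx : forall t, measurable_fun setT (x t).
Hypothesis my : forall t, measurable_fun setT (y t).

Let measurable_mean (z : int -> T -> R) : (forall t, measurable_fun setT (z t)) ->
  measurable_fun setT (sample_mean z n).
Proof. by move=> mz; apply: measurable_funM => //; exact: measurable_sum. Qed.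

Lemma measurable_ls_slope : measurable_fun setT (ls_slope x y n).
Proof.
have mc t : measurable_fun setT (fun w => x t w - sample_mean x n w).
  by apply: measurable_funB => //; exact: measurable_mean.
apply: measurable_funM.
  by apply: measurable_sum => t; apply: measurable_funM.
(* The denominator is nonnegative, so its inverse is the measurable power of exponent -1, the value
   0 included. *)
rewrite (_ : (fun w => _) = (fun w =>
  (\sum_(1 <= t < n.+1) (x t%:Z w - sample_mean x n w) ^+ 2) `^ (- 1))).
  apply: (measurableT_comp (measurable_powR (- 1))).
  by apply: measurable_sum => t; exact: measurable_funX.
by apply/funext => w; rewrite powR_inv1//; apply: sumr_ge0 => t _; exact: sqr_ge0.
Qed.

Lemma measurable_ls_intercept : measurable_fun setT (ls_intercept x y n).
Proof.
apply: measurable_funB; first exact: measurable_mean.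
by apply: measurable_funM; [exact: measurable_ls_slope|exact: measurable_mean].
Qed.

End measurable_least_squares.

(** * Linearisation of the least squares errors *)

Section least_squares_limit.
Context d (T : measurableType d) (R : realType) (P : probability T R)
  (x s : int -> T -> R) (W : nat -> T -> R) (a : nat -> R)
  (beta0 beta1 mu v s0 G C : R).
Let y t w := beta0 + beta1 * x t w + s t w.
Let m n w := sample_mean x n w - mu.
Let D n w := sample_var x n w - v.
Let A n w := \sum_(1 <= t < n.+1) a n * s t%:Z w.
Let B n w := \sum_(1 <= t < n.+1) a n * ((x t%:Z w - mu) * s t%:Z w).
Let V1 n w := n%:R * a n * (ls_slope x y n w - beta1).
Let V0 n w := n%:R * a n * (ls_intercept x y n w - beta0).
Hypothesis v_gt0 : 0 < v.
Hypothesis mx : forall t, measurable_fun setT (x t).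
Hypothesis ms : forall t, measurable_fun setT (s t).
Hypothesis LW : forall n, L2 P (W n).
Hypothesis W_var : \forall n \near \oo, Ex P (fun w => W n w ^+ 2) <= C.
Hypothesis m_cvg : cvg_in_prob0 P m.
Hypothesis D_cvg : cvg_in_prob0 P D.
Hypothesis A_cvg : cvg_in_prob0 P (fun n w => A n w - s0 * W n w).
Hypothesis B_cvg : cvg_in_prob0 P (fun n w => B n w - G * W n w).

Let my t : measurable_fun setT (y t).
Proof.
apply: measurable_funD => //; apply: measurable_funD => //.
exact: measurable_funM.
Qed.

Let mV1 n : measurable_fun setT (V1 n).
Proof.
by apply: measurable_funM => //; apply: measurable_funB => //; exact: (measurable_ls_slope n mx my).
Qed.

Let mV0 n : measurable_fun setT (V0 n).
Proof.
by apply: measurable_funM => //; apply: measurable_funB => //; exact: (measurable_ls_intercept n mx my).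
Qed.

Let mcW c n : measurable_fun setT (fun w => c * W n w).
Proof. by apply: measurable_funM => //; case: (LW n). Qed.

Let D_small n w : Num.min 1 `|2 / v * D n w| < 1 -> v / 2 < sample_var x n w.
Proof.
rewrite gt_min ltxx /= normrM ger0_norm ?divr_ge0 ?(ltW v_gt0)//.
rewrite mulrAC ltr_pdivrMr// mul1r => h.
have := ler_norm (- D n w); rewrite normrN /D opprB; lra.
Qed.

(** The error is exactly [stuff] divided by the sample variance. Where |D| < v / 2 the sample
    variance exceeds v / 2 and the quotient is at most (2 / v) |stuff|; elsewhere min (1, |2 D / v|)
    is 1. *)
Theorem ls_slope_cvg : cvg_in_prob0 P (fun n w => V1 n w - G / v * W n w).
Proof.
have mA : cvg_in_prob0 P (fun n w => m n w * A n w).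
  have := cvg_in_prob0D (cvg_in_prob0M m_cvg A_cvg)
    (cvg_in_prob0Z s0 (cvg_in_prob0_tightM m_cvg LW W_var)).
  by congr (cvg_in_prob0 P _); apply/funext => n; apply/funext => w; ring.
pose stuff n w := (B n w - G * W n w) - m n w * A n w - G / v * (D n w * W n w).
have stuff_cvg : cvg_in_prob0 P stuff.
  apply: cvg_in_prob0B; first exact: cvg_in_prob0B.
  by apply: cvg_in_prob0Z; exact: (cvg_in_prob0_tightM D_cvg LW W_var).
apply: (cvg_in_prob0_dom _ (cvg_in_prob0Z (2 / v) stuff_cvg) (cvg_in_prob0Z (2 / v) D_cvg)).
  by move=> n; exact: measurable_funB.
near=> n => w; have n0 : (0 < n)%N by near: n; exact: nbhs_infty_gt.
have [d1|d1] := ltP (Num.min 1 `|2 / v * D n w|) 1; last first.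
  by rewrite ler_wpDl ?min1_ge0// (le_trans (min1_le1 _)).
have sv := D_small d1.
have sv0 : 0 < sample_var x n w by rewrite (lt_trans _ sv)// divr_gt0.
rewrite ler_wpDr ?min1_ge0// le_min ge_min lexx/= ge_min; apply/orP; right.
have -> : V1 n w - G / v * W n w = stuff n w / sample_var x n w.
  rewrite /V1 /y (@ls_slope_error _ _ x s beta0 beta1 mu (a n) n w)//; last by rewrite gt_eqF.
  rewrite /stuff /A /B /m /D.
  by field; rewrite !gt_eqF.
rewrite !normrM [leLHS]mulrC ler_wpM2r// ger0_norm ?ger0_norm ?invr_ge0 ?divr_ge0 ?(ltW v_gt0) ?(ltW sv0)//.
rewrite -[2 / v]invrK lef_pV2 ?posrE ?invr_gt0 ?divr_gt0//.
by rewrite invf_div ltW.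
Unshelve. all: by end_near. Qed.

(** The intercept error is A minus the sample mean times the slope error; the sample mean is mu + m,
    and the slope error is (G / v) W + E by the preceding result. *)
Theorem ls_intercept_cvg :
  cvg_in_prob0 P (fun n w => V0 n w - (s0 - mu * G / v) * W n w).
Proof.
pose E n w := V1 n w - G / v * W n w.
pose stuff n w := (A n w - s0 * W n w) - (m n w * E n w + mu * E n w + G / v * (m n w * W n w)).
have stuff_cvg : cvg_in_prob0 P stuff.
  apply: cvg_in_prob0B => //; apply: cvg_in_prob0D; first apply: cvg_in_prob0D.
  - by apply: cvg_in_prob0M => //; exact: ls_slope_cvg.
  - by apply: cvg_in_prob0Z; exact: ls_slope_cvg.
  - by apply: cvg_in_prob0Z; exact: (cvg_in_prob0_tightM m_cvg LW W_var).
apply: (cvg_in_prob0_dom _ stuff_cvg (cvg_in_prob0Z (2 / v) D_cvg)).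
  by move=> n; exact: measurable_funB.
near=> n => w; have n0 : (0 < n)%N by near: n; exact: nbhs_infty_gt.
rewrite ler_wpDr ?min1_ge0//.
suff -> : V0 n w - (s0 - mu * G / v) * W n w = stuff n w by [].
rewrite /V0 /y (@ls_intercept_error _ _ x s beta0 beta1 (a n) n w)// -/y -/(V1 n w) /stuff /E /m /A.
by field; rewrite gt_eqF.
Unshelve. all: by end_near. Qed.

End least_squares_limit.

(** * The regression model *)

Section regression.
Context d (T : measurableType d) (R : realType) (P : probability T R)
  (X Y u eps : int -> {RV P >-> R}) (sigma : R -> R) (b : nat -> R)
  (H h c cX mu gamma beta0 beta1 : R).
Hypothesis H_range : 2^-1 < H < 1.
Hypothesis h_range : 2^-1 < h < 1.
Hypothesis XY_stationary : strictly_stationary X Y.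
Hypothesis sigma_meas : measurable_fun setT sigma.
Hypothesis L2_sigma : L2 P (fun w => sigma (X 0 w)).
Hypothesis eps_iid : iid eps.
Hypothesis eps_mean : forall t, 'E_P[eps t]%E = 0%E.
Hypothesis eps_var : forall t, 'V_P[eps t]%E = 1%E.
Hypothesis eps_X_indep : independent_processes eps X.
Hypothesis u_ma : moving_average b eps u.
Hypothesis b_sum : \sum_(0 <= j < N) b j ^+ 2 @[N --> \oo] --> (1 : R).
Hypothesis gammau_cvg : second_moment u n%:Z * n%:R `^ (2 * (1 - H)) @[n --> \oo] --> c.
Hypothesis X_gauss : gaussian_process X.
Hypothesis X_mean : forall t, 'E_P[X t]%E = mu%:E.
Hypothesis X_variance : forall t, 'V_P[X t]%E = (gamma ^+ 2)%:E.
Hypothesis gamma0 : 0 < gamma ^+ 2.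
Hypothesis gammaX_cvg : autocov X n%:Z * n%:R `^ (2 * (1 - h)) @[n --> \oo] --> cX.

Let a n : R := n%:R `^ (- H).
Let W n := scaled_sum u (a n) n.
Let mX t : measurable_fun setT (X t). Proof. exact: measurable_funP. Qed.
Let mu_ t : measurable_fun setT (u t). Proof. exact: measurable_funP. Qed.

Let corr_decay p : p < 2 * (1 - h) ->
  design_corr X gamma n * n%:R `^ p @[n --> \oo] --> (0 : R).
Proof.
move=> /powR_slow_decay /(_ gammaX_cvg) h0.
have h1 : (gamma ^+ 2)^-1 * (autocov X n%:Z * n%:R `^ p) @[n --> \oo] --> (0 : R).
  by rewrite -(mulr0 (gamma ^+ 2)^-1); apply: cvgM => //; exact: cvg_cst.
by apply: cvg_near_eq h1; apply: nearW => n; rewrite /design_corr; ring.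
Qed.

Let corr_ln_cvg0 : a n ^+ 2 * corr_sum X u gamma n * ln n%:R @[n --> \oo] --> (0 : R).
Proof.
have /andP[H1 H2] := H_range; have /andP[h1 h2] := h_range.
(* Half the minimum is strictly below both: below 2 (1 - h) for the design correlation to absorb
   n^e, below 2 H - 1 for [toeplitz_ln_cvg0]. *)
pose e := Num.min (2 * (1 - h)) (2 * H - 1) / 2.
have m0 : 0 < Num.min (2 * (1 - h)) (2 * H - 1) by rewrite lt_min; apply/andP; split; lra.
have m1 : Num.min (2 * (1 - h)) (2 * H - 1) <= 2 * (1 - h) by rewrite ge_min lexx.
have m2 : Num.min (2 * (1 - h)) (2 * H - 1) <= 2 * H - 1 by rewrite ge_min lexx orbT.
apply: (toeplitz_ln_cvg0 (e := e)) => //; first by rewrite /e; apply/andP; split; lra.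
have de : e < 2 * (1 - h) by rewrite /e; lra.
have := corr_decay de => d0.
have d1 : design_corr X gamma n * n%:R `^ e * (second_moment u n%:Z * n%:R `^ (2 * (1 - H)))
    @[n --> \oo] --> (0 : R).
  by rewrite -(mul0r c); exact: cvgM.
have d2 : `|design_corr X gamma n * n%:R `^ e * (second_moment u n%:Z * n%:R `^ (2 * (1 - H)))|
    @[n --> \oo] --> (0 : R).
  by rewrite -(@normr0 _ R); exact: cvg_norm.
apply: cvg_near_eq d2; near=> n.
have n0 : (0 < n)%N by near: n; exact: nbhs_infty_gt.
rewrite [2 * (1 - H) + e]addrC powRD; last by rewrite pnatr_eq0 -lt0n n0 implybT.
rewrite -[X in _ = _ * (X * _)]ger0_norm ?powR_ge0//.
rewrite -[X in _ = _ * (_ * X)]ger0_norm ?powR_ge0//.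
by rewrite -!normrM; congr (`|_|); ring.
Unshelve. all: by end_near. Qed.

Let LW n : L2 P (W n). Proof. exact: (L2_scaled_sum eps_mean eps_var u_ma). Qed.

Let W_var : \forall n \near \oo, Ex P (fun w => W n w ^+ 2) <= c / (H * (2 * H - 1)) + 1.
Proof.
have := ma_sum_var_cvg eps_iid eps_mean eps_var u_ma H_range gammau_cvg.
move/cvgrPdist_le => /(_ 1 ltr01); apply: filterS => n.
by rewrite ler_distl => /andP[+ _]; rewrite lerBlDr.
Qed.

Let lln (f : R -> R) : measurable_fun setT f -> L2 P (fun w => f (X 0 w)) ->
  cvg_in_prob0 P (sample_mean (fun t w => f (X t w) - Ex P (fun w => f (X 0 w)))).
Proof.
move=> mf Lf; have /andP[h1 h2] := h_range.
(* Any exponent in ]0, 1[ strictly below 2 (1 - h) would do. *)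
have p01 : 0 < 1 - h < 1 by apply/andP; split; lra.
have pd : 1 - h < 2 * (1 - h) by lra.
have := design_lln XY_stationary X_gauss X_mean X_variance gamma0 p01 (corr_decay pd) mf Lf.
set Z := sample_mean _ => Z0.
have LZ n : L2 P (Z n).
  apply: L2Z; apply: L2_sum => t; apply: L2B; last exact: L2_cst.
  exact: (L2_design_comp X_gauss X_mean X_variance).
apply: cvg_in_prob0_L1 => [n|]; first exact: L2_L1.
apply: cvg0_le (cvg_sqrt0 Z0) => n; rewrite Ex_norm_sqrt// andbT.
by apply: Ex_ge0 => w; exact: normr_ge0.
Qed.

Let mean_cvg : cvg_in_prob0 P (fun n w => sample_mean X n w - mu).
Proof.
have z0 := lln (@measurable_id _ _ _) (L2_design X_gauss X_mean X_variance 0).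
apply: (cvg_in_prob0_dom _ z0 z0) => [n|].
  by apply: measurable_funB => //; apply: measurable_funM => //; exact: measurable_sum.
near=> n => w; have n0 : n%:R != 0 :> R by rewrite pnatr_eq0 -lt0n; near: n; exact: nbhs_infty_gt.
rewrite ler_wpDr ?min1_ge0//.
suff -> : sample_mean X n w - mu = sample_mean (fun t w => X t w - Ex P (fun w => X 0 w)) n w by [].
rewrite /sample_mean sumrB sumr_const_nat subSS subn0 -[X in _ = _ * (_ - X)]mulr_natl.
by rewrite mulrBr mulKf// -[mu]/(fine mu%:E) -(X_mean 0) fine_expectation.
Unshelve. all: by end_near. Qed.

(** The law of large numbers for (x - mu)^2, square integrable by the fourth normal moment, minus
    the squared error of the sample mean. *)
Let var_cvg : cvg_in_prob0 P (fun n w => sample_var X n w - gamma ^+ 2).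
Proof.
pose f x : R := (x - mu) ^+ 2.
have mf : measurable_fun setT f by apply: measurable_funX; exact: measurable_funB.
have NX := design_normal X_gauss X_mean X_variance 0.
have Lf : L2 P (fun w => f (X 0 w)).
  split; first exact: measurableT_comp.
  have s0 : Num.sqrt (gamma ^+ 2) != 0 by rewrite gt_eqF// sqrtr_gt0.
  have NX' A : measurable A -> P (X 0 @^-1` A) = normal_prob mu (Num.sqrt (gamma ^+ 2)) A.
    by move=> mA; rewrite NX.2// gt_eqF.
  have := L1_normal_pow4 s0 (mX 0) NX'.
  by congr (L1 P _); apply/funext => w; rewrite /f -exprM.
have Ef : Ex P (fun w => f (X 0 w)) = gamma ^+ 2 by exact: (normal_rv_var (mX 0) NX).
have z0 := lln mf Lf; rewrite Ef in z0.
have z1 := cvg_in_prob0B z0 (cvg_in_prob0M mean_cvg mean_cvg).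
apply: (cvg_in_prob0_dom _ z1 z1) => [n|].
  apply: measurable_funB => //; apply: measurable_funM => //.
  apply: measurable_sum => t; apply: measurable_funX; apply: measurable_funB => //.
  by apply: measurable_funM => //; exact: measurable_sum.
near=> n => w; have n0 : (0 < n)%N by near: n; exact: nbhs_infty_gt.
have n1 : n%:R != 0 :> R by rewrite pnatr_eq0 -lt0n.
rewrite ler_wpDr ?min1_ge0// (sample_varE _ mu)//.
have -> : sample_mean (fun t w => f (X t w) - gamma ^+ 2) n w =
    n%:R^-1 * \sum_(1 <= t < n.+1) f (X t%:Z w) - gamma ^+ 2.
  rewrite /sample_mean sumrB sumr_const_nat subSS subn0 -[X in _ * (_ - X)]mulr_natl.
  by rewrite mulrBr mulKf.
by rewrite -expr2 addrAC.
Unshelve. all: by end_near. Qed.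

Let s t w := sigma (X t w) * u t w.
Let y t w := beta0 + beta1 * X t w + s t w.
Let sigma0 := Ex P (fun w => sigma (X 0 w)).
Let G := Ex P (fun w => X 0 w * sigma (X 0 w)) - mu * sigma0.
Let V1 n w := n%:R `^ (1 - H) * (ls_slope X y n w - beta1).
Let V0 n w := n%:R `^ (1 - H) * (ls_intercept X y n w - beta0).

Let rate n : n%:R `^ (1 - H) = n%:R * a n.
Proof.
have /andP[H1 H2] := H_range.
(* At n = 0 both sides are 0, because 1 - H > 0. *)
case: n => [|n]; first by rewrite powR0 ?mul0r//; lra.
by rewrite powRD ?powRr1// pnatr_eq0 implybT.
Qed.

Let ms t : measurable_fun setT (s t).
Proof. by apply: measurable_funM => //; exact: measurableT_comp. Qed.

Let A_cvg : cvg_in_prob0 P (fun n w => \sum_(1 <= t < n.+1) a n * s t%:Z w - sigma0 * W n w).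
Proof.
exact: (weighted_sum_cvg XY_stationary eps_iid eps_mean eps_var eps_X_indep u_ma X_gauss
  X_mean X_variance gamma0 corr_ln_cvg0 sigma_meas L2_sigma).
Qed.

Let B_cvg : cvg_in_prob0 P
  (fun n w => \sum_(1 <= t < n.+1) a n * ((X t%:Z w - mu) * s t%:Z w) - G * W n w).
Proof.
have GE : Ex P (fun w => (X 0 w - mu) * sigma (X 0 w)) = G.
  under eq_Rintegral do rewrite mulrBl.
  rewrite ExB ?ExZ//; [exact: L2_L1|apply: L1M => //|apply/L1Z/L2_L1 => //].
  exact: (L2_design X_gauss X_mean X_variance).
have := weighted_sum_center_cvg XY_stationary eps_iid eps_mean eps_var eps_X_indep u_ma X_gauss
  X_mean X_variance gamma0 corr_ln_cvg0 W_var sigma_meas L2_sigma.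
rewrite GE; congr (cvg_in_prob0 P _); apply/funext => n; apply/funext => w.
congr (_ - _); apply: eq_bigr => t _; rewrite /s; ring.
Qed.

(** Stated for [y], which satisfies the model everywhere; [regression_ae] carries the result over to
    [Y], which satisfies it almost surely. *)
Theorem regression_cvg d' (T' : measurableType d') (P' : probability T' R)
    (Z : {RV P' >-> R}) (g : R * R -> R) (M : R) :
  normal_rv P' Z 0 (c / (H * (2 * H - 1))) -> continuous g -> (forall x, `|g x| <= M) ->
  Ex P (fun w => g (V0 n w, V1 n w)) @[n --> \oo] -->
  Ex P' (fun w => g ((sigma0 - mu * G / gamma ^+ 2) * Z w, G / gamma ^+ 2 * Z w)).
Proof.
move=> ZN cg gM.
have c1 := ls_slope_cvg beta0 beta1 gamma0 mX ms LW W_var mean_cvg var_cvg A_cvg B_cvg.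
have c0 := ls_intercept_cvg beta0 beta1 gamma0 mX ms LW W_var mean_cvg var_cvg A_cvg B_cvg.
have my t : measurable_fun setT (y t).
  by apply: measurable_funD => //; apply: measurable_funD => //; exact: measurable_funM.
apply: (slutsky_line (a1 := sigma0 - mu * G / gamma ^+ 2) (a2 := G / gamma ^+ 2) cg gM _ _ LW W_var).
- move=> n; apply: measurable_funM => //; apply: measurable_funB => //.
  exact: (measurable_ls_intercept n mX my).
- move=> n; apply: measurable_funM => //; apply: measurable_funB => //.
  exact: (measurable_ls_slope n mX my).
- by rewrite /V0; under eq_fun do under eq_fun do rewrite rate.
- by rewrite /V1; under eq_fun do under eq_fun do rewrite rate.
apply: (ma_clt eps_iid eps_mean eps_var u_ma b_sum H_range gammau_cvg
  (f := fun z => g ((sigma0 - mu * G / gamma ^+ 2) * z, G / gamma ^+ 2 * z)) ZN) => // z.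
have lin k : k * x @[x --> z] --> k * z by apply: cvgM => //; exact: cvg_cst.
apply: (@cvg_comp _ _ _ (fun z => ((sigma0 - mu * G / gamma ^+ 2) * z, G / gamma ^+ 2 * z)) g _
  (nbhs ((sigma0 - mu * G / gamma ^+ 2) * z, G / gamma ^+ 2 * z)));
  last exact: cg.
exact: (cvg_pair (lin _) (lin _)).
Qed.

Lemma regression_ae (model : forall t : int,
    {ae P, forall w, Y t w = beta0 + beta1 * X t w + sigma (X t w) * u t w}) g n :
  continuous g ->
  Ex P (fun w => g (n%:R `^ (1 - H) * (ls_intercept X Y n w - beta0),
                    n%:R `^ (1 - H) * (ls_slope X Y n w - beta1))) =
  Ex P (fun w => g (V0 n w, V1 n w)).
Proof.
move=> cg.
have mY t : measurable_fun setT (Y t) by exact: measurable_funP.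
have my t : measurable_fun setT (y t).
  by apply: measurable_funD => //; apply: measurable_funD => //; exact: measurable_funM.
(* The null sets, one for each time, are countably many and are discarded together. *)
have ae_all : {ae P, forall w, forall t : nat, Y t%:Z w = y t%:Z w}.
  by apply/ae_foralln => t; exact: model.
apply: Ex_ae.
- apply: measurable_continuous_pair => //; apply: measurable_funM => //; apply: measurable_funB => //.
  + exact: (measurable_ls_intercept n mX mY).
  + exact: (measurable_ls_slope n mX mY).
- apply: measurable_continuous_pair => //; apply: measurable_funM => //; apply: measurable_funB => //.
  + exact: (measurable_ls_intercept n mX my).
  + exact: (measurable_ls_slope n mX my).
apply: filterS ae_all => w Yy.
have slopeE : ls_slope X Y n w = ls_slope X y n w.
  by rewrite /ls_slope; congr (_ / _); apply: eq_bigr => t _; rewrite Yy.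
have meanE : sample_mean Y n w = sample_mean y n w.
  by rewrite /sample_mean; congr (_ * _); apply: eq_bigr => t _; rewrite Yy.
by rewrite /V0 /V1 /ls_intercept slopeE meanE.
Qed.

End regression.

Unset Implicit Arguments.

Theorem lemma2p1 (R : realType) (d : measure_display) (T : measurableType d)
    (P : probability T R)
    (X Y u eps : int -> {RV P >-> R})
    (beta0 beta1 : R) (sigma : R -> R) (b : nat -> R) (C : R)
    (H h Gu GX mu gamma : R) (fu : R -> R)
    (H_range : 2^-1 < H < 1) (h_range : 2^-1 < h < 1)
    (* regression model *)
    (XY_stationary : strictly_stationary X Y)
    (X_var : (0 < 'V_P[X 0%R] < +oo)%E) (Y_var : (0 < 'V_P[Y 0%R] < +oo)%E)
    (sigma_meas : measurable_fun setT sigma) (sigma_ge0 : forall x, 0 <= sigma x)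
    (sigma_L2 : ('E_P[fun w => (sigma (X 0 w) ^+ 2)%R] < +oo)%E)
    (model : forall t : int,
       {ae P, forall w, Y t w = beta0 + beta1 * X t w + sigma (X t w) * u t w})
    (* errors *)
    (eps_iid : iid eps)
    (eps_mean : forall t, 'E_P[eps t]%E = 0%E)
    (eps_var : forall t, 'V_P[eps t]%E = 1%E)
    (eps_X_indep : independent_processes eps X)
    (u_ma : moving_average b eps u)
    (b_asymp : b ~_\oo (fun j : nat => C * j%:R `^ (- (3 / 2 - H))))
    (b_sum : \sum_(0 <= j < N) b j ^+ 2 @[N --> \oo] --> (1 : R))
    (b_cvg0 : b @ \oo --> (0 : R))
    (b_quasi_mono : exists a : R,
       \forall j \near \oo, b j.+1 <= b j * (1 + j%:R^-1 * a))
    (Gu_gt0 : 0 < Gu)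
    (fu_density : spectral_density (second_moment u) fu)
    (fu_asymp : fu ~_(0^'+) (fun l : R => Gu * l `^ (1 - 2 * H)))
    (gammau_asymp : (fun k : nat => second_moment u k%:Z) ~_\oo
       (fun k : nat => Gu * theta H * k%:R `^ (- (2 * (1 - H)))))
    (* design *)
    (X_gauss : gaussian_process X)
    (X_mean : forall t, 'E_P[X t]%E = mu%:E)
    (X_variance : forall t, 'V_P[X t]%E = (gamma ^+ 2)%:E)
    (GX_gt0 : 0 < GX)
    (gammaX_asymp : (fun k : nat => autocov X k%:Z) ~_\oo
       (fun k : nat => GX * theta h * k%:R `^ (- (2 * (1 - h)))))
    (* limit variable *)
    (d' : measure_display) (T' : measurableType d') (P' : probability T' R)
    (Z1 : {RV P' >-> R})
    (Z1_normal : normal_rv P' Z1 0 (Gu * theta H / (H * (2 * H - 1)))) :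
  let sigma0 := fine 'E_P[sigma \o X 0%R]%E in
  let EXsigma := fine 'E_P[fun w => (X 0 w * sigma (X 0 w))%R]%E in
  let Gamma1 := (EXsigma - mu * sigma0) / gamma ^+ 2 in
  let Gamma0 := sigma0 - mu * (EXsigma - mu * sigma0) / gamma ^+ 2 in
  cvg_in_law P P'
    (fun (n : nat) (w : T) =>
       (n%:R `^ (1 - H) * (ls_intercept X Y n w - beta0),
        n%:R `^ (1 - H) * (ls_slope X Y n w - beta1)))
    (fun w : T' => (Gamma0 * Z1 w, Gamma1 * Z1 w)).
Proof.
move=> sigma0 EXsigma Gamma1 Gamma0 g cg [M gM].
have gamma0 : 0 < gamma ^+ 2 by have /andP[+ _] := X_var; rewrite X_variance lte_fin.
have mX t : measurable_fun setT (X t) by exact: measurable_funP.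
have mY t : measurable_fun setT (Y t) by exact: measurable_funP.
have mZ : measurable_fun setT Z1 by exact: measurable_funP.
have L2_sigma : L2 P (fun w => sigma (X 0 w)).
  have msX : measurable_fun setT (fun w => sigma (X 0 w)) by exact: measurableT_comp.
  split => //; apply/integrableP; split; first exact/measurable_EFinP/measurable_funX.
  move: sigma_L2; rewrite unlock; congr (_ < _)%E; apply: eq_integral => w _.
  by rewrite /= ger0_norm// sqr_ge0.
have lim := regression_cvg beta0 beta1 H_range h_range XY_stationary sigma_meas L2_sigma
  eps_iid eps_mean eps_var eps_X_indep u_ma b_sum (equiv_powR_cvg gammau_asymp)
  X_gauss X_mean X_variance gamma0 (equiv_powR_cvg gammaX_asymp) Z1_normal cg gM.
have s0E : Ex P (fun w => sigma (X 0 w)) = sigma0 by rewrite /sigma0 fine_expectation.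
have XsE : Ex P (fun w => X 0 w * sigma (X 0 w)) = EXsigma by rewrite /EXsigma fine_expectation.
rewrite s0E XsE -/Gamma1 -/Gamma0 in lim.
have Lg n : L1 P (fun w => g (n%:R `^ (1 - H) * (ls_intercept X Y n w - beta0),
                               n%:R `^ (1 - H) * (ls_slope X Y n w - beta1))).
  apply: (@L1_bounded _ _ _ _ _ M) => //; apply: measurable_continuous_pair => //.
  - apply: measurable_funM => //; apply: measurable_funB => //.
    exact: measurable_ls_intercept.
  - apply: measurable_funM => //; apply: measurable_funB => //.
    exact: measurable_ls_slope.
have LZ : L1 P' (fun w => g (Gamma0 * Z1 w, Gamma1 * Z1 w)).
  apply: (@L1_bounded _ _ _ _ _ M) => //; apply: measurable_continuous_pair => //.
  - exact: measurable_funM.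
  - exact: measurable_funM.
rewrite /comp ExE//; under eq_fun do rewrite ExE//.
apply: cvg_EFin; first by apply: nearW.
rewrite /comp /=; apply: cvg_near_eq lim; apply: nearW => n.
by rewrite (regression_ae H sigma_meas model n cg).
Qed.
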